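(* Let $s\in(0,1)$, $\alpha\ge 0$, $C_0>0$, $\beta>0$, and assume that one of the following conditions holds: (i) $0<\beta\le N-2s$ and $\alpha\le 2$; (ii) $N-2s<\beta<N$ and $\alpha\le 2s$; (iii) $\beta=N$ and $\alpha<2s$; (iv) $\beta>N$ and $\alpha+\beta\le 2s+N$. Then there exists a constant $\Lambda>0$, depending only on $N,s,\alpha,\beta,C_0$, with the following property. Let $\rho\in C(\mathbb{R}^N)$ satisfy $\rho(x)\ge C_0(1+|x|^2)^{-\alpha/2}$ for all $x\in\mathbb{R}^N$, let $c\in C(\mathbb{R}^N)$ satisfy $c(x)\ge c_0$ for all $x\in\mathbb{R}^N$, for some constant $c_0>0$, let $p\in[1,\infty)$ satisfy $p\,c_0>\Lambda$, and let $u\in C^2(\mathbb{R}^N)\cap\mathcal{L}^s(\mathbb{R}^N)$ be a solution of $$\Delta u-(-\Delta)^s u-\rho\, c\, u=0\quad\text{pointwise in }\mathbb{R}^N$$ with $|u|^p\in\mathcal{L}^s(\mathbb{R}^N)$. If $u\in L^p_{\psi_\beta}(\mathbb{R}^N)$, then $u\equiv 0$ in $\mathbb{R}^N$.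
   Context: $N\ge1$ is the space dimension. $\mathcal{L}^s(\mathbb{R}^N)$ is the space of measurable $f:\mathbb{R}^N\to\mathbb{R}$ with $\int_{\mathbb{R}^N}\frac{|f(x)|}{1+|x|^{N+2s}}\,dx<\infty$. The fractional Laplacian is defined pointwise by $$(-\Delta)^s u(x)=C_{N,s}\,\mathrm{P.V.}\int_{\mathbb{R}^N}\frac{u(x)-u(y)}{|x-y|^{N+2s}}\,dy=C_{N,s}\lim_{\varepsilon\to0^+}\int_{\{|x-y|\ge\varepsilon\}}\frac{u(x)-u(y)}{|x-y|^{N+2s}}\,dy,$$ with $C_{N,s}=\frac{2^{2s-1}\,2s\,\Gamma((N+2s)/2)}{\pi^{N/2}\Gamma(1-s)}>0$; it is well defined and continuous on $\mathbb{R}^N$ for $u\in C^2(\mathbb{R}^N)\cap\mathcal{L}^s(\mathbb{R}^N)$. For $\beta>0$, $\psi_\beta(x)=(1+|x|^2)^{-\beta/2}$, and $L^p_{\psi_\beta}(\mathbb{R}^N)$ is the set of measurable $u:\mathbb{R}^N\to\mathbb{R}$ with $\int_{\mathbb{R}^N}|u|^p\psi_\beta\,dx<\infty$. *)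

(* Defs.v *)
From HB Require Import structures.
From mathcomp Require Import all_boot all_order all_algebra.
From mathcomp Require Import all_classical all_reals all_analysis.

Set Implicit Arguments.
Unset Strict Implicit.
Unset Printing Implicit Defensive.

Import Order.TTheory GRing.Theory Num.Theory.
Import numFieldTopology.Exports numFieldNormedType.Exports.

Local Open Scope classical_set_scope.
Local Open Scope ring_scope.

(* [R^N] is ['rV[R]_N].  Its library norm [`|x|] is the sup norm: it is used
   only through the topology it induces, the Euclidean norm being [enorm]. *)

Definition measure_rV_display : measure_display -> measure_display.
Proof. exact. Qed.

Section measurable_rV.
Context (R : realType) (n : nat).

Let coords : 'I_n -> 'rV[R]_n -> measurableTypeR R := fun i x => x ord0 i.

Let rV_set0 : g_sigma_preimage coords set0.
Proof. exact: sigma_algebra0. Qed.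

Let rV_setC A : g_sigma_preimage coords A -> g_sigma_preimage coords (~` A).
Proof. exact: sigma_algebraC. Qed.

Let rV_bigcup (F : (set 'rV[R]_n)^nat) :
  (forall i, g_sigma_preimage coords (F i)) ->
  g_sigma_preimage coords (\bigcup_i (F i)).
Proof. exact: sigma_algebra_bigcup. Qed.

(* The product sigma-algebra; since [n] is finite and [R] is second countable,
   it is the Borel sigma-algebra of ['rV[R]_n]. *)
HB.instance Definition _ :=
  @isMeasurable.Build (measure_rV_display default_measure_display)
    'rV[R]_n (g_sigma_preimage coords) rV_set0 rV_setC rV_bigcup.

Lemma measurable_rV_coord (i : 'I_n) :
  measurable_fun setT (fun x : 'rV[R]_n => x ord0 i : measurableTypeR R).
Proof.
move=> _ Y mY; rewrite setTI; apply: sub_sigma_algebra => /=.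
rewrite -bigcup_seq/=; exists i => /=; first by rewrite mem_index_enum.
by exists Y => //; rewrite setTI.
Qed.

Lemma measurable_fun_rV d (T : measurableType d) (f : T -> 'rV[R]_n) :
  (forall i, measurable_fun setT (fun t => f t ord0 i : measurableTypeR R)) ->
  measurable_fun setT f.
Proof.
move=> mf; apply: (@measurability _ _ _ _ _ f
  (\big[setU/set0]_(i < n) preimage_set_system setT (coords i) measurable)) => //.
move=> _ [B + <-]; rewrite -bigcup_seq/= => -[i _ [A mA <-]].
have := mf i measurableT A mA.
by rewrite !setTI.
Qed.

End measurable_rV.

Section lebesgue_rV.
Context (R : realType).

Definition rV_cons n (p : measurableTypeR R * 'rV[R]_n) : 'rV[R]_n.+1 :=
  row_mx (p.1%:M : 'rV[R]_1) p.2.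

Definition rV_uncons n (x : 'rV[R]_n.+1) : measurableTypeR R * 'rV[R]_n :=
  (x ord0 ord0, \row_j x ord0 (lift ord0 j)).

Lemma rV_consK n : cancel (@rV_cons n) (@rV_uncons n).
Proof.
case=> t y; rewrite /rV_uncons /rV_cons; congr pair.
  by rewrite mxE; case: splitP => // j _; rewrite mxE [j]ord1 eqxx.
apply/rowP => j; rewrite !mxE -[lift ord0 j]/(lift (ord0 : 'I_(1 + n)) j).
by rewrite -rshift1; case: split_ordP => [k|k] => [/eqP|/rshift_inj->//];
  rewrite eq_rlshift.
Qed.

Lemma measurable_rV_cons n : measurable_fun setT (@rV_cons n).
Proof.
apply: measurable_fun_rV => i.
have [->|[j ->]] : i = ord0 \/ exists j, i = lift ord0 j.
  by case: (unliftP ord0 i) => [j|] ->; [right; exists j|left].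
  apply: (eq_measurable_fun fst) => // p _.
  by have := congr1 fst (rV_consK p).
apply: (eq_measurable_fun
    (fun p : measurableTypeR R * 'rV[R]_n => p.2 ord0 j : measurableTypeR R)).
  by move=> p _; have /(congr1 snd)/rowP/(_ j) := rV_consK p; rewrite !mxE.
exact: (measurableT_comp (measurable_rV_coord j)).
Qed.

Lemma measurable_rV_uncons n : measurable_fun setT (@rV_uncons n).
Proof.
apply/measurable_fun_pairP; split; first exact: measurable_rV_coord.
apply: measurable_fun_rV => j /=.
under eq_fun do rewrite mxE.
exact: measurable_rV_coord.
Qed.

Section lebesgue_rV_cons.
Context (n : nat) (mu : {sigma_finite_measure set 'rV[R]_n -> \bar R}).

Definition lebesgue_rV_cons : set 'rV[R]_n.+1 -> \bar R :=
  pushforward (lebesgue_measure \x mu)%E (@rV_cons n).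

Let lebesgue_rV_cons0 : lebesgue_rV_cons set0 = 0%E.
Proof. by rewrite /lebesgue_rV_cons /pushforward preimage_set0 measure0. Qed.

Let lebesgue_rV_cons_ge0 A : (0 <= lebesgue_rV_cons A)%E.
Proof. by rewrite /lebesgue_rV_cons /pushforward measure_ge0. Qed.

Let lebesgue_rV_cons_sigma_additive : semi_sigma_additive lebesgue_rV_cons.
Proof.
move=> F mF tF mUF; rewrite /lebesgue_rV_cons /pushforward preimage_bigcup.
have mcons A : measurable A -> measurable (@rV_cons n @^-1` A).
  by move=> mA; rewrite -[X in measurable X]setTI; exact: measurable_rV_cons.
apply: measure_semi_sigma_additive.
- by move=> i; exact: mcons.
- apply/trivIsetP => i j _ _ ij; rewrite -preimage_setI.
  by move/trivIsetP : tF => /(_ _ _ _ _ ij) ->//; rewrite preimage_set0.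
- by rewrite -preimage_bigcup; exact: mcons.
Qed.

HB.instance Definition _ := isMeasure.Build _ _ _ lebesgue_rV_cons
  lebesgue_rV_cons0 lebesgue_rV_cons_ge0 lebesgue_rV_cons_sigma_additive.

Let lebesgue_rV_cons_sigma_finite : sigma_finite setT lebesgue_rV_cons.
Proof.
have /sigma_finiteP[F [TF ndF Foo]] := sigma_finiteT (@lebesgue_measure R).
have /sigma_finiteP[G [TG ndG Goo]] := sigma_finiteT mu.
exists (fun k => @rV_uncons n @^-1` (F k `*` G k)) => [|k].
  rewrite -preimage_bigcup -[LHS](@preimage_setT _ _ (@rV_uncons n)).
  congr (_ @^-1` _); rewrite -setXTT TF TG predeqE => -[x y]; split.
    move=> [/= [i _ Fx] [j _ Gy]]; exists (maxn i j) => //; split.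
    - by move: x Fx; exact/subsetPset/ndF/leq_maxl.
    - by move: y Gy; exact/subsetPset/ndG/leq_maxr.
  by move=> [i _ []/= ? ?]; split; exists i.
have [mF Fk] := Foo k; have [mG Gk] := Goo k.
have mFG : measurable (F k `*` G k) by exact: measurableX.
split; first by rewrite -[X in measurable X]setTI; exact: measurable_rV_uncons.
rewrite /lebesgue_rV_cons /pushforward -comp_preimage.
have -> : @rV_uncons n \o @rV_cons n = id by apply/funext => p; exact: rV_consK.
by rewrite preimage_id product_measure1E// lte_mul_pinfty// ge0_fin_numE.
Qed.

HB.instance Definition _ := Measure_isSigmaFinite.Build _ _ _
  lebesgue_rV_cons lebesgue_rV_cons_sigma_finite.

End lebesgue_rV_cons.

(* The n-fold product of the one-dimensional Lebesgue measure. *)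
Fixpoint lebesgue_rV n : {sigma_finite_measure set 'rV[R]_n -> \bar R} :=
  match n with
  | 0 => \d_(0 : 'rV[R]_0)
  | m.+1 => lebesgue_rV_cons (lebesgue_rV m)
  end.

Lemma lebesgue_rV_box n (A : 'I_n -> set (measurableTypeR R)) :
  (forall i, measurable (A i)) ->
  lebesgue_rV n [set x | forall i, A i (x ord0 i)] =
  (\prod_(i < n) lebesgue_measure (A i))%E.
Proof.
elim: n A => [|n IHn] A mA.
  by rewrite big_ord0 /= diracE mem_set//= => -[].
have mB : measurable [set y : 'rV[R]_n | forall j, A (lift ord0 j) (y ord0 j)].
  rewrite [X in measurable X](_ : _ =
      \bigcap_(j : 'I_n) ((fun y : 'rV[R]_n => y ord0 j) @^-1` A (lift ord0 j))).
    apply: fin_bigcap_measurable => // j _; rewrite -[X in measurable X]setTI.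
    exact: measurable_rV_coord.
  by apply/seteqP; split => [y yA j _|y yA j]; exact: yA.
rewrite big_ord_recl -IHn; last by move=> i; exact: mA.
rewrite -product_measure1E//.
congr ((lebesgue_measure \x lebesgue_rV n)%E _).
have coord0 p : @rV_cons n p ord0 ord0 = p.1.
  by have := congr1 fst (rV_consK p).
have coordS p j : @rV_cons n p ord0 (lift ord0 j) = p.2 ord0 j.
  by have /(congr1 snd)/rowP/(_ j) := rV_consK p; rewrite !mxE.
apply/seteqP; split => -[t y] /= ty.
  split => [|j]; first by have := ty ord0; rewrite coord0.
  by have := ty (lift ord0 j); rewrite coordS.
move=> i; case: (unliftP ord0 i) => [j|] ->.
  by rewrite coordS; exact: ty.2.
by rewrite coord0; exact: ty.1.
Qed.

End lebesgue_rV.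

Section fractional_laplacian.
Context (R : realType).

(* Euler's integral; only used at positive arguments. *)
Definition Gamma (z : R) : R :=
  \int[lebesgue_measure]_(t in `]0, +oo[) (t `^ (z - 1) * expR (- t)).

Context (N : nat).
Implicit Types (f u : 'rV[R]_N -> R) (x : 'rV[R]_N) (s p beta : R).

Definition enorm x : R := Num.sqrt (\sum_(i < N) x ord0 i ^+ 2).

Definition partial (i : 'I_N) u : 'rV[R]_N -> R := 'D_('e_i) u.

(* [Ck k u]: all partial derivatives of [u] of order at most [k] exist and are
   continuous on the whole space. *)
Fixpoint Ck (k : nat) u : Prop :=
  continuous u /\
  match k with
  | 0 => True
  | k'.+1 => forall i : 'I_N,
      (forall x, derivable u x 'e_i) /\ Ck k' (partial i u)
  end.

Definition laplacian u x : R := \sum_(i < N) partial i (partial i u) x.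

Definition Ls_space s : set ('rV[R]_N -> R) :=
  [set f : 'rV[R]_N -> R | measurable_fun setT f /\
    (\int[lebesgue_rV R N]_x
       (`|f x| / (1 + enorm x `^ (N%:R + 2 * s)))%:E < +oo)%E].

Definition fraclap_const s : R :=
  2 `^ (2 * s - 1) * (2 * s) * Gamma ((N%:R + 2 * s) / 2) /
  (pi `^ (N%:R / 2) * Gamma (1 - s)).

(* The principal value, as the limit of the truncated integrals.  [lim] and the
   real-valued integral are total; for [u] in [Ck 2] and in [Ls_space s], with
   [0 < s < 1], the truncated integrands are integrable and the limit exists. *)
Definition fraclap s u x : R :=
  fraclap_const s *
  lim ((\int[lebesgue_rV R N]_(y in [set y | eps <= enorm (x - y)])
          ((u x - u y) / enorm (x - y) `^ (N%:R + 2 * s))) @[eps --> 0^'+]).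

Definition psi beta x : R := (1 + enorm x ^+ 2) `^ (- (beta / 2)).

Definition Lp_psi p beta : set ('rV[R]_N -> R) :=
  [set u : 'rV[R]_N -> R | measurable_fun setT u /\
    (\int[lebesgue_rV R N]_x (`|u x| `^ p * psi beta x)%:E < +oo)%E].

End fractional_laplacian.

(* Main.v *)
Require Import Defs.
From mathcomp Require Import all_boot all_order all_algebra.
From mathcomp Require Import all_classical all_reals all_analysis.
From mathcomp Require Import measurable_realfun.
From mathcomp Require Import ring lra.

Set Implicit Arguments.
Unset Strict Implicit.
Unset Printing Implicit Defensive.

Import Order.TTheory GRing.Theory Num.Theory.
Import numFieldTopology.Exports numFieldNormedType.Exports.

Local Open Scope classical_set_scope.
Local Open Scope ring_scope.

(** Write [W] for the function [|u|^p].  Since [|t|^p] is convex, Kato's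
    inequality says that the operator [Delta - (-Delta)^s] applied to [W] is at
    least [p rho c W], hence at least [p c0 r W] where [r] is the assumed lower
    bound of [rho].  Suppose that a positive weight [w], decaying like
    [|x|^(-beta)], satisfies [Delta w - (-Delta)^s w <= Lambda r w].  Testing the
    first inequality with [w] and moving the symmetric operator onto [w] bounds
    [p c0] times the integral of [r W w] by [Lambda] times the same integral,
    which is finite because [u] is in the weighted space; so [W] vanishes when
    [p c0 > Lambda].

    The weight is [barrier beta], that is [max(1, |x|)^(-beta)].  It is
    [(max(1, |x|)^2)^(-beta/2)], where [max(1, |x|)^2] is convex: its second
    differences are at most a constant times [w / max(1, |x|)^2] in spite of the
    kink ([barrier_second_diff]), and this is absorbed by [r w] because
    [alpha <= 2].  The nonlocal term is estimated in two ways.  When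
    [beta > N - 2s], the jumps of size at most [|x| / 2] are estimated by second
    differences and the long ones by the mass of [w] in the ball of radius
    [|x|], which the bound on [alpha] renders harmless ([mass_strong]).
    When [beta <= N - 2s], that estimate would only reach [alpha <= 2s], but [w]
    is superharmonic for the nonlocal operator itself: the inversion in the
    sphere of radius [|x|] exchanges the inside, where [w] exceeds [w x], with
    the outside, where it is below [w x], and the loss outweighs the gain
    ([barrier_superharmonic]).

    Since [W] need not be twice differentiable and [w] is not compactly
    supported, the operator is discretized and the weight is cut off.

    At scale [h], the Laplacian becomes the sum of the centred second differences
    along the axes and the fractional Laplacian is truncated to jumps of length
    at least [h].  The result is a positivity-preserving operator [Pop h] minus
    the multiplication by a constant [Pmass h].  At this level Kato's inequality
    is the convexity of [|t|^p] applied jump by jump ([Pop_kato]) and the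
    symmetry is Tonelli's theorem with translation invariance ([int_Pop_sym]);
    there is no integration by parts.

    The weight is replaced by [cutoff beta d], a function of [w] that agrees
    with [w] where [w >= 2d] and vanishes where [w <= d].  It satisfies the same
    inequality as [w], uniformly in [h], with an error at most [C w] supported
    where [w < 2d] ([Pop_cutoff]).

    Letting [h] tend to [0] on the support of the cutoff, where the discretized
    operator applied to [u] converges boundedly ([Sop_cvg], [Sop_bound]), gives
    [cutoff_inequality]: [p c0 - Lambda] times the integral of [r W w] over
    the set [w >= 2d] is at most [C] times the integral of [W w] over the set
    [w < 2d].  The latter tends to [0] with [d] ([outer_mass_cvg]), while the
    former stays away from [0] as soon as [u] is nonzero at some point
    ([inner_mass_lower]). *)

(** * Affine changes of variables *)

Section affine1.
Context (R : realType).
Local Notation lam := (@lebesgue_measure R).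

Lemma measurable_affine1 (a b : R) :
  measurable_fun setT ((fun t => a * t + b) : measurableTypeR R -> measurableTypeR R).
Proof. by apply: measurable_funD => //; apply: measurable_funM. Qed.

(** A measure that gives every half-open interval its length is the Lebesgue
    measure; this applies to the image of the latter under [t |-> a t + b],
    rescaled by [a]. *)
Lemma ge0_integral_affine1_pos (a b : R) (f : R -> \bar R) : 0 < a ->
  measurable_fun setT (f : measurableTypeR R -> _) -> (forall t, 0 <= f t)%E ->
  (\int[lam]_t f (a * t + b)%R = (a^-1)%:E * \int[lam]_t f t)%E.
Proof.
move=> a0 mf f0.
pose h : measurableTypeR R -> measurableTypeR R := fun t => a * t + b.
have mh : measurable_fun setT h by exact: measurable_affine1.
have anneg : 0 <= a by exact: ltW.
pose nu := measure_function_pushforward__canonical__measure_function_Measure lam mh.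
have E : (\int[lam]_t f t = \int[mscale (NngNum anneg) nu]_t f t)%E.
  apply: (eq_measure_integral (mscale (NngNum anneg) nu)) => A mA _.
  apply: lebesgue_measure_unique => //= _ [[c d]] _ <-.
  change (lam `]c, d] = a%:E * lam (h @^-1` `]c, d]%classic))%E.
  have -> : h @^-1` `]c, d]%classic = `](c - b) / a, (d - b) / a]%classic.
    apply/seteqP; split => t /=; rewrite !in_itv/= ltr_pdivrMr// ler_pdivlMr//.
      by rewrite ltrBlDr lerBrDr mulrC.
    by rewrite ltrBlDr lerBrDr mulrC.
  rewrite !lebesgue_measure_itv/= !lte_fin ltr_pM2r ?invr_gt0// ltrD2r.
  case: ifP => _; last by rewrite mule0.
  by rewrite -EFinM; congr EFin; field; rewrite gt_eqF.
rewrite E ge0_integral_mscale// [nu]lock /= -lock muleA -EFinM mulVf ?gt_eqF// mul1e.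
by rewrite ge0_integral_pushforward// preimage_setT.
Qed.

Lemma ge0_integral_opp1 (f : R -> \bar R) :
  measurable_fun setT (f : measurableTypeR R -> _) -> (forall t, 0 <= f t)%E ->
  (\int[lam]_t f (- t)%R = \int[lam]_t f t)%E.
Proof.
move=> mf f0.
have mh : measurable_fun setT (-%R : measurableTypeR R -> measurableTypeR R) by [].
pose nu := measure_function_pushforward__canonical__measure_function_Measure lam mh.
transitivity (\int[nu]_t f t)%E.
  by rewrite ge0_integral_pushforward// preimage_setT.
by apply: (eq_measure_integral lam) => A mA _; exact: lebesgue_measureN.
Qed.

Lemma ge0_integral_affine1 (a b : R) (f : R -> \bar R) : a != 0 ->
  measurable_fun setT (f : measurableTypeR R -> _) -> (forall t, 0 <= f t)%E ->
  (\int[lam]_t f (a * t + b)%R = (`|a|^-1)%:E * \int[lam]_t f t)%E.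
Proof.
move=> aN0 mf f0; have [a0|a0|a0] := ltgtP a 0; last by rewrite a0 eqxx in aN0.
  rewrite ltr0_norm// -(ge0_integral_opp1 mf)//.
  rewrite -(@ge0_integral_affine1_pos (- a) (- b) (fun t => f (- t)))//.
  - by apply: eq_integral => t _; rewrite opprD opprK mulNr opprK.
  - by rewrite oppr_gt0.
  - exact: measurableT_comp.
by rewrite gtr0_norm// ge0_integral_affine1_pos.
Qed.

End affine1.

Section affine.
Context (R : realType).
Local Notation lam := (@lebesgue_measure R).
Local Notation mu := (lebesgue_rV R).

Lemma ge0_integral_rV_cons n (f : 'rV[R]_n.+1 -> \bar R) :
  measurable_fun setT f -> (forall x, 0 <= f x)%E ->
  (\int[mu n.+1]_x f x = \int[lam]_t \int[mu n]_y f (rV_cons (t, y)))%E.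
Proof.
move=> mf f0; rewrite /= /lebesgue_rV_cons.
rewrite ge0_integral_pushforward//; last exact: measurable_rV_cons.
rewrite preimage_setT fubini_tonelli1//.
  by apply: measurableT_comp => //; exact: measurable_rV_cons.
by move=> x; exact: f0.
Qed.

Lemma measurable_affine n (a : R) (b : 'rV[R]_n) :
  measurable_fun setT (fun x : 'rV[R]_n => a *: x + b).
Proof.
apply: measurable_fun_rV => i.
under eq_fun do rewrite !mxE.
by apply: measurable_funD => //; apply: measurable_funM => //;
  exact: measurable_rV_coord.
Qed.

Lemma rV_cons_ord0 n (p : measurableTypeR R * 'rV[R]_n) : rV_cons p ord0 ord0 = p.1.
Proof. by have := congr1 fst (rV_consK p). Qed.

Lemma rV_cons_lift n (p : measurableTypeR R * 'rV[R]_n) j :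
  rV_cons p ord0 (lift ord0 j) = p.2 ord0 j.
Proof. by have /(congr1 snd)/rowP/(_ j) := rV_consK p; rewrite !mxE. Qed.

Lemma rV_cons_affine n (a : R) (b : 'rV[R]_n.+1) (p : measurableTypeR R * 'rV[R]_n) :
  a *: rV_cons p + b = rV_cons (a * p.1 + (rV_uncons b).1, a *: p.2 + (rV_uncons b).2).
Proof.
apply/rowP => i; rewrite mxE [X in X + _]mxE.
case: (unliftP ord0 i) => [j|] ->; last by rewrite !rV_cons_ord0.
by rewrite !rV_cons_lift !mxE.
Qed.

(** The product measure is built by adding one coordinate at a time, so the
    change of variables is an induction on the dimension. *)
Lemma ge0_integral_affine n (a : R) (b : 'rV[R]_n) (f : 'rV[R]_n -> \bar R) :
  a != 0 -> measurable_fun setT f -> (forall x, 0 <= f x)%E ->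
  (\int[mu n]_x f (a *: x + b)%R = (`|a| ^- n)%:E * \int[mu n]_x f x)%E.
Proof.
move=> a0; elim: n b f => [|n IHn] b f mf f0.
  rewrite expr0 invr1 mul1e; apply: eq_integral => x _.
  by congr f; apply/rowP => -[].
have mc : measurable_fun setT (f \o @rV_cons R n).
  by apply: measurableT_comp => //; exact: measurable_rV_cons.
rewrite ge0_integral_rV_cons//; last first.
  by apply: measurableT_comp => //; exact: measurable_affine.
under eq_integral => t _.
  under eq_integral do rewrite rV_cons_affine/=.
  rewrite (IHn _ (fun y => f (rV_cons (a * t + b ord0 ord0, y))))//; last first.
    apply: (measurableT_comp mf); apply: (measurableT_comp (@measurable_rV_cons R n)).
  exact: measurable_fun_pair.
  over.
pose h t := (\int[mu n]_y f (rV_cons (t, y)))%E.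
have mh : measurable_fun setT (h : measurableTypeR R -> _).
  apply: (measurable_fun_fubini_tonelli_F (f \o @rV_cons R n)) => // x.
  exact: f0.
have h0 t : (0 <= h t)%E by exact: integral_ge0.
rewrite ge0_integralZl//; last 2 first.
- rewrite -[X in measurable_fun _ X]/(h \o (fun t => a * t + b ord0 ord0)).
  by apply: (measurableT_comp mh); exact: measurable_affine1.
- by move=> t _; exact: h0.
rewrite (@ge0_integral_affine1 _ a _ h)// -ge0_integral_rV_cons//.
by rewrite muleA -EFinM; congr (_%:E * _)%E; rewrite exprS invfM mulrC.
Qed.

End affine.

(** * Euclidean norm and measurability *)

(** The Iverson bracket.  As a real factor of the integrand, it lets all
    integrals range over the whole space. *)
Definition ind {R : realType} (b : bool) : R := b%:R.

Section ind_theory.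
Context (R : realType).
Implicit Types b : bool.

Lemma ind_ge0 b : 0 <= ind b :> R.
Proof. exact: ler0n. Qed.

Lemma ind1 : ind true = 1 :> R. Proof. by []. Qed.

Lemma ind0 : ind false = 0 :> R. Proof. by []. Qed.

Lemma ind_le1 b : ind b <= 1 :> R.
Proof. by rewrite /ind; case: b; rewrite ?ler01. Qed.

Lemma ind_le b b' : (b -> b') -> ind b <= ind b' :> R.
Proof. by rewrite /ind; case: b => [->|_]//; exact: ler0n. Qed.

End ind_theory.

Section enorm_theory.
Context (R : realType) (N : nat).
Implicit Types (x y z : 'rV[R]_N) (a : R).

Definition dotp x y : R := \sum_(i < N) x ord0 i * y ord0 i.

Lemma dotpC x y : dotp x y = dotp y x.
Proof. by apply: eq_bigr => i _; rewrite mulrC. Qed.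

Lemma dotpDl x y z : dotp (x + y) z = dotp x z + dotp y z.
Proof. by rewrite -big_split; apply: eq_bigr => i _; rewrite mxE mulrDl. Qed.

Lemma dotpZl a x z : dotp (a *: x) z = a * dotp x z.
Proof. by rewrite mulr_sumr; apply: eq_bigr => i _; rewrite mxE mulrA. Qed.

Lemma dotpDr x y z : dotp z (x + y) = dotp z x + dotp z y.
Proof. by rewrite dotpC dotpDl !(dotpC z). Qed.

Lemma dotpZr a x z : dotp z (a *: x) = a * dotp z x.
Proof. by rewrite dotpC dotpZl dotpC. Qed.

Lemma enorm_ge0 x : 0 <= enorm x.
Proof. exact: sqrtr_ge0. Qed.

Lemma enorm_sqr x : enorm x ^+ 2 = dotp x x.
Proof. by rewrite sqr_sqrtr//; apply: sumr_ge0 => i _; exact: sqr_ge0. Qed.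

Lemma dotpxx_ge0 x : 0 <= dotp x x.
Proof. by rewrite -enorm_sqr sqr_ge0. Qed.

Lemma enormZ a x : enorm (a *: x) = `|a| * enorm x.
Proof.
apply/eqP; rewrite -(@eqrXn2 _ 2)// ?mulr_ge0 ?enorm_ge0//.
by rewrite exprMn !enorm_sqr dotpZl dotpZr mulrA real_normK ?num_real.
Qed.

Lemma enormN x : enorm (- x) = enorm x.
Proof. by rewrite -scaleN1r enormZ normrN1 mul1r. Qed.

Lemma enormB x y : enorm (x - y) = enorm (y - x).
Proof. by rewrite -opprB enormN. Qed.

Lemma enorm_eq0 x : (enorm x == 0) = (x == 0).
Proof.
apply/eqP/eqP => [x0|->]; last by rewrite -(scale0r 0) enormZ normr0 mul0r.
have /eqP : dotp x x = 0 by rewrite -enorm_sqr x0 expr0n.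
rewrite psumr_eq0 => [/allP h|i _]; last by rewrite -expr2 sqr_ge0.
apply/rowP => i; rewrite mxE; apply/eqP.
by have := h i (mem_index_enum _); rewrite -expr2 sqrf_eq0.
Qed.

Lemma enorm0 : enorm (0 : 'rV[R]_N) = 0.
Proof. by apply/eqP; rewrite enorm_eq0. Qed.

Lemma enorm_gt0 x : (0 < enorm x) = (x != 0).
Proof. by rewrite lt_def enorm_ge0 andbT enorm_eq0. Qed.

Lemma enormD_sqr x z :
  enorm (x + z) ^+ 2 = enorm x ^+ 2 + 2 * dotp x z + enorm z ^+ 2.
Proof. by rewrite !enorm_sqr !dotpDl !dotpDr (dotpC z x); ring. Qed.

(** Cauchy-Schwarz, from the square of the norm of [|x|^2 z - (x . z) x]. *)
Lemma dotp_le x z : `|dotp x z| <= enorm x * enorm z.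
Proof.
have [->|x0] := eqVneq x 0.
  by rewrite enorm0 mul0r -(scale0r 0) dotpZl mul0r normr0.
have ex0 : 0 < enorm x by rewrite enorm_gt0.
rewrite -(@ler_pXn2r _ 2)// ?nnegrE ?mulr_ge0 ?enorm_ge0//.
rewrite real_normK ?num_real// exprMn.
have := dotpxx_ge0 (dotp x x *: z + (- dotp x z) *: x).
rewrite !(dotpDl, dotpDr, dotpZl, dotpZr) (dotpC z x) -!enorm_sqr => h.
rewrite -subr_ge0 -(pmulr_rge0 _ (exprn_gt0 2 ex0)).
by apply: le_trans h _; rewrite le_eqVlt; apply/orP; left; apply/eqP; ring.
Qed.

Lemma ler_enormD x z : enorm (x + z) <= enorm x + enorm z.
Proof.
rewrite -(@ler_pXn2r _ 2)// ?nnegrE ?addr_ge0 ?enorm_ge0// enormD_sqr sqrrD.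
rewrite lerD2r lerD2l mulr_natl ler_wMn2r//.
exact: le_trans (ler_norm _) (dotp_le _ _).
Qed.

Lemma ler_enormB x z : enorm x - enorm z <= enorm (x + z).
Proof. by rewrite lerBlDr -{1}(addrK z x) (le_trans (ler_enormD _ _))// enormN. Qed.

Lemma coord_le_enorm x i : `|x ord0 i| <= enorm x.
Proof.
rewrite -(@ler_pXn2r _ 2)// ?nnegrE ?enorm_ge0// enorm_sqr real_normK ?num_real//.
rewrite /dotp (bigD1 i)//= -expr2 lerDl; apply: sumr_ge0 => j _.
by rewrite -expr2 sqr_ge0.
Qed.

Lemma enorm_delta i : enorm ('e_i : 'rV[R]_N) = 1.
Proof.
apply/eqP; rewrite -(@eqrXn2 _ 2)// ?enorm_ge0// enorm_sqr /dotp (bigD1 i)//=.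
rewrite !mxE !eqxx mulr1 big1 ?addr0 ?expr1n// => j ji.
by rewrite !mxE (negbTE ji) andbF mul0r.
Qed.

End enorm_theory.

Section rV_measurability.
Context d (T : measurableType d) (R : realType) (N : nat).

Lemma measurable_rVD (f g : T -> 'rV[R]_N) : measurable_fun setT f ->
  measurable_fun setT g -> measurable_fun setT (fun t => f t + g t).
Proof.
move=> mf mg; apply: measurable_fun_rV => i; under eq_fun do rewrite mxE.
by apply: measurable_funD;
  [exact: (measurableT_comp (measurable_rV_coord i) mf)
  |exact: (measurableT_comp (measurable_rV_coord i) mg)].
Qed.

Lemma measurable_rVZ (a : T -> R) (g : T -> 'rV[R]_N) : measurable_fun setT a ->
  measurable_fun setT g -> measurable_fun setT (fun t => a t *: g t).
Proof.
move=> mf mg; apply: measurable_fun_rV => i; under eq_fun do rewrite mxE.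
by apply: measurable_funM => //; exact: (measurableT_comp (measurable_rV_coord i) mg).
Qed.

Lemma measurable_rVN (g : T -> 'rV[R]_N) :
  measurable_fun setT g -> measurable_fun setT (fun t => - g t).
Proof.
move=> mg; apply: measurable_fun_rV => i; under eq_fun do rewrite mxE.
by apply: measurable_funN; exact: (measurableT_comp (measurable_rV_coord i) mg).
Qed.

Lemma measurable_dotp (f g : T -> 'rV[R]_N) : measurable_fun setT f ->
  measurable_fun setT g -> measurable_fun setT (fun t => dotp (f t) (g t)).
Proof.
move=> mf mg; apply: measurable_sum => i; apply: measurable_funM.
  exact: (measurableT_comp (measurable_rV_coord i) mf).
exact: (measurableT_comp (measurable_rV_coord i) mg).
Qed.

(** Written as a power, the square root is covered by the measurability of
    [powR]. *)
Lemma measurable_enorm (g : T -> 'rV[R]_N) :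
  measurable_fun setT g -> measurable_fun setT (fun t => enorm (g t)).
Proof.
move=> mg; rewrite (_ : (fun t => _) = (fun t => dotp (g t) (g t) `^ (2^-1))).
  by apply: (measurableT_comp (measurable_powR _)); exact: measurable_dotp.
by apply/funext => t; rewrite powR12_sqrt ?dotpxx_ge0.
Qed.

Lemma measurable_fun_powR (a : T -> R) (p : R) :
  measurable_fun setT a -> measurable_fun setT (fun t => a t `^ p).
Proof. exact: (measurableT_comp (measurable_powR p)). Qed.

Lemma measurable_enormV (g : T -> 'rV[R]_N) :
  measurable_fun setT g -> measurable_fun setT (fun t => (enorm (g t))^-1).
Proof.
move=> mg; rewrite (_ : (fun t => _) = (fun t => enorm (g t) `^ (-1))).
  by apply: measurable_fun_powR; exact: measurable_enorm.
by apply/funext => t; rewrite powR_inv1// enorm_ge0.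
Qed.

Lemma measurable_ind (b : T -> bool) :
  measurable_fun setT b -> measurable_fun setT (fun t => ind (b t) : R).
Proof.
move=> mb; rewrite (_ : (fun t => _) = (fun t => if b t then 1 else 0 : R)).
  exact: measurable_fun_ifT.
by apply/funext => t; rewrite /ind; case: (b t).
Qed.

End rV_measurability.

(** Syntax-directed proof of measurability; what no rule closes is left as a
    subgoal. *)
Ltac mfun :=
    lazymatch goal with
    | |- measurable_fun _ (fun t => GRing.mul _ _) => apply: measurable_funM; mfun
    | |- measurable_fun _ (fun t => Algebra.add _ _) =>
        first [apply: measurable_funD | apply: measurable_rVD]; mfun
    | |- measurable_fun _ (fun t => Algebra.opp _) =>
        first [apply: measurable_funN | apply: measurable_rVN]; mfun
    | |- measurable_fun _ (fun t => GRing.scale _ _) => apply: measurable_rVZ; mfun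
    | |- measurable_fun _ (fun t => GRing.exp _ _) => apply: measurable_funX; mfun
    | |- measurable_fun _ (fun t => Order.max _ _) => apply: measurable_maxr; mfun
    | |- measurable_fun _ (fun t => Order.min _ _) => apply: measurable_minr; mfun
    | |- measurable_fun _ (fun t => Order.le _ _) => apply: measurable_fun_ler; mfun
    | |- measurable_fun _ (fun t => Order.lt _ _) => apply: measurable_fun_ltr; mfun
    | |- measurable_fun _ (fun t => andb _ _) => apply: measurable_and; mfun
    | |- measurable_fun _ (fun t => ind _) => apply: measurable_ind; mfun
    | |- measurable_fun _ (fun t => enorm _) => apply: measurable_enorm; mfun
    | |- measurable_fun _ (fun t => GRing.inv _) =>
        first [exact: measurable_cst | apply: measurable_enormV; mfun | idtac]
    | |- measurable_fun _ (fun t => dotp _ _) => apply: measurable_dotp; mfun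
    | |- measurable_fun _ (fun t => powR _ _) => apply: measurable_fun_powR; mfun
    | |- measurable_fun _ (fun t => expR _) =>
        apply: (measurableT_comp (@measurable_expR _)); mfun
    | |- measurable_fun _ (@Algebra.opp _) =>
        first [apply: measurable_funN | apply: measurable_rVN]; mfun
    | |- measurable_fun _ (GRing.mul _) => apply: measurable_funM; mfun
    | |- measurable_fun _ (Algebra.add _) =>
        first [apply: measurable_funD | apply: measurable_rVD]; mfun
    | |- measurable_fun _ (GRing.scale _) => apply: measurable_rVZ; mfun
    | |- measurable_fun _ (Order.le _) => apply: measurable_fun_ler; mfun
    | |- measurable_fun _ (Order.lt _) => apply: measurable_fun_ltr; mfun
    | |- measurable_fun _ (Order.max _) => apply: measurable_maxr; mfun
    | |- measurable_fun _ (@enorm _ _) => apply: measurable_enorm; mfun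
    | |- measurable_fun _ expR => exact: measurable_expR
    | |- _ => first [ exact: measurable_id | exact: measurable_cst
        | exact: measurable_fst | exact: measurable_snd | assumption | idtac ]
    end.

(** * Integrals of nonnegative functions, polar coordinates *)

Section real_integrals.
Context d (T : measurableType d) (R : realType).
Variable mu : {measure set T -> \bar R}.
Implicit Types (f g : T -> R).
Local Open Scope ereal_scope.

Lemma le_int f g : measurable_fun setT f -> measurable_fun setT g ->
  (forall x, 0 <= f x)%R -> (forall x, f x <= g x)%R ->
  \int[mu]_x (f x)%:E <= \int[mu]_x (g x)%:E.
Proof.
move=> mf mg f0 fg; apply: ge0_le_integral => //;
  by [exact/measurable_EFinP|move=> x _; rewrite lee_fin].
Qed.

Lemma int_ge0 f : (forall x, 0 <= f x)%R -> 0 <= \int[mu]_x (f x)%:E.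
Proof. by move=> f0; apply: integral_ge0 => x _; rewrite lee_fin. Qed.

Lemma intD f g : measurable_fun setT f -> measurable_fun setT g ->
  (forall x, 0 <= f x)%R -> (forall x, 0 <= g x)%R ->
  \int[mu]_x (f x + g x)%:E = \int[mu]_x (f x)%:E + \int[mu]_x (g x)%:E.
Proof.
move=> mf mg f0 fg; under eq_integral do rewrite EFinD; apply: ge0_integralD => //;
  by [exact/measurable_EFinP|move=> x _; rewrite lee_fin].
Qed.

Lemma intZ (k : R) f : measurable_fun setT f -> (0 <= k)%R ->
  (forall x, 0 <= f x)%R ->
  \int[mu]_x (k * f x)%:E = k%:E * \int[mu]_x (f x)%:E.
Proof.
move=> mf k0 f0; under eq_integral do rewrite EFinM.
by rewrite ge0_integralZl//;
  by [exact/measurable_EFinP|move=> x _; rewrite lee_fin].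
Qed.

End real_integrals.

Section tonelli.
Context d1 d2 (T1 : measurableType d1) (T2 : measurableType d2) (R : realType).
Variables (m1 : {sigma_finite_measure set T1 -> \bar R})
  (m2 : {sigma_finite_measure set T2 -> \bar R}).
Variable f : T1 * T2 -> R.
Hypotheses (mf : measurable_fun setT f) (f0 : forall p, 0 <= f p).

Lemma tonelli : (\int[m1]_x \int[m2]_y (f (x, y))%:E =
  \int[m2]_y \int[m1]_x (f (x, y))%:E)%E.
Proof.
apply: (fubini_tonelli (EFin \o f)); first exact/measurable_EFinP.
by move=> p; rewrite lee_fin.
Qed.

Lemma measurable_tonelli : measurable_fun setT (fun x => \int[m2]_y (f (x, y))%:E)%E.
Proof.
apply: (measurable_fun_fubini_tonelli_F (EFin \o f)); first exact/measurable_EFinP.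
by move=> p; rewrite lee_fin.
Qed.

End tonelli.

Section lebesgue_rV_invariance.
Context (R : realType) (N : nat).
Local Notation mu := (lebesgue_rV R N).
Implicit Types f : 'rV[R]_N -> R.
Local Open Scope ereal_scope.

Lemma int_affine (a : R) (b : 'rV[R]_N) f : (a != 0)%R -> measurable_fun setT f ->
  (forall x, 0 <= f x)%R ->
  \int[mu]_x (f x)%:E = (`|a| ^+ N)%:E * \int[mu]_x (f (a *: x + b)%R)%:E.
Proof.
move=> a0 mf f0; rewrite (@ge0_integral_affine R N a b (EFin \o f))//.
- by rewrite muleA -EFinM mulfV ?mul1e// expf_neq0// normr_eq0.
- exact/measurable_EFinP.
Qed.

Lemma int_shift (b : 'rV[R]_N) f : measurable_fun setT f -> (forall x, 0 <= f x)%R ->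
  \int[mu]_x (f (x + b)%R)%:E = \int[mu]_x (f x)%:E.
Proof.
move=> mf f0; rewrite (@int_affine 1 b f) ?oner_neq0//.
by rewrite normr1 expr1n mul1e; under [RHS]eq_integral do rewrite scale1r.
Qed.

Lemma int_opp f : measurable_fun setT f -> (forall x, 0 <= f x)%R ->
  \int[mu]_x (f (- x)%R)%:E = \int[mu]_x (f x)%:E.
Proof.
move=> mf f0; rewrite (@int_affine (-1) 0 f) ?oppr_eq0 ?oner_neq0//.
rewrite normrN1 expr1n mul1e; apply: eq_integral => x _.
by rewrite scaleN1r addr0.
Qed.

Lemma int_scale (a : R) f : (0 < a)%R -> measurable_fun setT f ->
  (forall x, 0 <= f x)%R ->
  \int[mu]_x (f x)%:E = (a ^+ N)%:E * \int[mu]_x (f (a *: x)%R)%:E.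
Proof.
move=> a0 mf f0; rewrite (@int_affine a 0 f)// ?gt_eqF// gtr0_norm//.
by congr (_ * _); apply: eq_integral => x _; rewrite addr0.
Qed.

End lebesgue_rV_invariance.

Section polar.
Context (R : realType) (N : nat).
Local Notation mu := (lebesgue_rV R N).
Local Notation lam := (@lebesgue_measure R).
Implicit Types f : 'rV[R]_N -> R.

(** Polar coordinates without a measure on the sphere: every nonzero [y] lies in
    the dilated shell [expR t *: shell] for a set of [t] of length one, so that
    inserting the corresponding indicator and exchanging the integrals turns an
    integral over the space into one over [shell] and the dilation factor. *)
Definition shell (z : 'rV[R]_N) := (1 <= enorm z) && (enorm z < expR 1).

Lemma measurable_shell d (T : measurableType d) (g : T -> 'rV[R]_N) :
  measurable_fun setT g -> measurable_fun setT (fun t => shell (g t)).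
Proof. by move=> mg; rewrite /shell; mfun. Qed.

Lemma int_shell (y : 'rV[R]_N) : y != 0 ->
  (\int[lam]_t (ind (shell (expR (- t) *: y)))%:E = 1)%E.
Proof.
rewrite -enorm_gt0 => y0.
transitivity (\int[lam]_t (\1_(`]ln (enorm y) - 1, ln (enorm y)]%classic : set R)
  t)%:E)%E.
  apply: eq_integral => t _; congr EFin.
  rewrite indicE /ind; congr (nat_of_bool _)%:R.
  rewrite /shell enormZ gtr0_norm ?expR_gt0// mem_setE in_itv/=.
  rewrite -{1 2}(@lnK _ (enorm y)) ?posrE// -expRD ltr_expR -{1}expR0 ler_expR.
  by apply/andP/andP => -[h1 h2]; split; lra.
rewrite integral_indic//= setIT lebesgue_measure_itv/= lte_fin.
by rewrite ltrBlDr ltrDl ltr01 -EFinD; congr EFin; ring.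
Qed.

(** The value of [f] at the origin, which no dilate of [shell] contains, is
    normalized to be [0]. *)
Lemma polar f : measurable_fun setT f -> (forall x, 0 <= f x) -> f 0 = 0 ->
  (\int[mu]_y (f y)%:E = \int[mu]_z \int[lam]_t
     (ind (shell z) * (f (expR t *: z) * expR (N%:R * t)))%:E)%E.
Proof.
move=> mf f0 f00.
transitivity (\int[mu]_y \int[lam]_t (f y * ind (shell (expR (- t) *: y)))%:E)%E.
  apply: eq_integral => y _; rewrite intZ//.
    have [->|y0] := eqVneq y 0; first by rewrite f00 mul0e.
    by rewrite int_shell// mule1.
  by mfun; apply: measurable_shell; mfun.
rewrite (@tonelli _ _ _ _ R mu lam
  (fun p => f p.1 * ind (shell (expR (- p.2) *: p.1))))/=;
  first last.
- by move=> p; rewrite mulr_ge0 ?ind_ge0.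
- by mfun; [apply: (measurableT_comp mf)|apply: measurable_shell]; mfun.
rewrite [RHS](@tonelli _ _ _ _ R mu lam (fun p => ind (shell p.1) *
   (f (expR p.2 *: p.1) * expR (N%:R * p.2))))/=; first last.
- by move=> p; rewrite !mulr_ge0 ?ind_ge0 ?expR_ge0.
- by mfun; [apply: measurable_shell|apply: (measurableT_comp mf)]; mfun.
apply: eq_integral => t _.
rewrite (int_scale (expR_gt0 t)); first last.
- by move=> x; rewrite mulr_ge0 ?ind_ge0.
- by mfun; apply: measurable_shell; mfun.
rewrite -expRM_natl -intZ ?expR_ge0//; first last.
- by move=> x; rewrite mulr_ge0 ?ind_ge0.
- by mfun; [apply: (measurableT_comp mf)|apply: measurable_shell]; mfun.
apply: eq_integral => x _; congr EFin.
by rewrite scalerA -expRD addNr expR0 scale1r; ring.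
Qed.

End polar.

(** * Radial integrals and the inversion *)

Section exponential_integrals.
Context (R : realType).
Local Notation lam := (@lebesgue_measure R).

(** The integrand is a multiple of a shifted exponential density. *)
Lemma int_expR_ge (c a : R) : 0 < c ->
  (\int[lam]_t (ind (a <= t) * expR (- c * t))%:E = (expR (- c * a) / c)%:E)%E.
Proof.
move=> c0; have mf : measurable_fun setT (fun t : R => ind (a <= t) * expR (- c * t)).
  by mfun.
rewrite -[LHS]mul1e -[X in (X%:E * _)%E]invr1 -{1}(@normr1 R).
rewrite -(@ge0_integral_affine1 R 1 a
  (EFin \o (fun t : R => ind (a <= t) * expR (- c * t)))).
- transitivity (\int[lam]_t ((expR (- c * a) / c) * exponential_pdf c t)%:E)%E.
    apply: eq_integral => t _; congr EFin; rewrite /exponential_pdf patchE mul1r.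
    rewrite /ind lerDr mulrDr expRD mem_setE in_itv/= andbT.
    by case: (0 <= t) => /=; [field; rewrite gt_eqF|rewrite mul0r mulr0].
  rewrite intZ ?divr_ge0 ?expR_ge0// ?integral_exponential_pdf ?mule1//; try exact: ltW.
    exact: measurable_exponential_pdf.
  by move=> t; apply: exponential_pdf_ge0; exact: ltW.
- exact: oner_neq0.
- exact/measurable_EFinP.
- by move=> t; rewrite lee_fin mulr_ge0 ?ind_ge0 ?expR_ge0.
Qed.

Lemma int_expR_le (c a : R) : 0 < c ->
  (\int[lam]_t (ind (t <= a) * expR (c * t))%:E = (expR (c * a) / c)%:E)%E.
Proof.
move=> c0; have := @int_expR_ge c (- a) c0; rewrite mulrNN => <-.
rewrite -(@ge0_integral_opp1 R (EFin \o (fun t : R => ind (t <= a) * expR (c * t)))).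
- by apply: eq_integral => t _ /=; rewrite lerNl mulrN mulNr.
- by apply/measurable_EFinP; mfun.
- by move=> t; rewrite lee_fin mulr_ge0 ?ind_ge0 ?expR_ge0.
Qed.

End exponential_integrals.

Section radial.
Context (R : realType) (N : nat).
Local Notation mu := (lebesgue_rV R N).
Local Notation lam := (@lebesgue_measure R).

(** A ball is contained in a cube. *)
Lemma int_ball_fin (r : R) : (\int[mu]_z (ind (enorm z <= r))%:E < +oo)%E.
Proof.
pose box := [set x : 'rV[R]_N | forall i, `[- r, r]%classic (x ord0 i)].
have mbox : measurable box.
  rewrite (_ : box = \bigcap_(i : 'I_N)
    ((fun x : 'rV[R]_N => x ord0 i) @^-1` `[- r, r]%classic)).
    apply: fin_bigcap_measurable => // i _; rewrite -[X in measurable X]setTI.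
    exact: measurable_rV_coord.
  by apply/seteqP; split => [x h i _|x h i]; exact: h.
apply: (@le_lt_trans _ _ (\int[mu]_z (\1_box z)%:E)%E).
  apply: le_int => //; first by mfun.
  move=> x; rewrite indicE /ind ler_nat; apply/leq_trans; last exact: leqnn.
  case: (leP (enorm x) r) => // xr; rewrite (_ : x \in box)// inE => i /=.
  by rewrite in_itv/= -ler_norml (le_trans (coord_le_enorm _ _)).
rewrite integral_indic// setIT.
have E : mu box = (\prod_(i < N) lam (`[- r, r]%classic)%R)%E.
  by apply: (@lebesgue_rV_box R N (fun=> `[- r, r]%classic)) => i;
    exact: measurable_itv.
apply: (eq_ind_r (fun v => (v < +oo)%E) _ E).
have /andP[] // : (0 <= \prod_(i < N) lam (`[- r, r]%classic)%R < +oo)%E.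
elim/big_ind: _ => [|x y /andP[x0 xoo] /andP[y0 yoo]|i _].
- by rewrite ltry lee_fin ler01.
- by rewrite mule_ge0//= lte_mul_pinfty// ge0_fin_numE.
by rewrite measure_ge0/= lebesgue_measure_itv/=; case: ifP => _; rewrite ltry.
Qed.

(** The area of the unit sphere: in polar coordinates the radial factor is the
    integral of [1/r] over the interval from [1] to [e]. *)
Definition shell_mass : R := fine
  (\int[mu]_z (ind (shell z) * enorm z `^ (- N%:R))%:E)%E.

Lemma shell_gt0 (z : 'rV[R]_N) : shell z -> 0 < enorm z.
Proof. by move=> /andP[+ _]; exact: lt_le_trans. Qed.

Lemma shell_massE :
  (\int[mu]_z (ind (shell z) * enorm z `^ (- N%:R))%:E = shell_mass%:E)%E.
Proof.
rewrite /shell_mass fineK// ge0_fin_numE; last first.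
  by apply: int_ge0 => x; rewrite mulr_ge0 ?ind_ge0 ?powR_ge0.
apply: le_lt_trans (int_ball_fin (expR 1)); apply: le_int;
  [by mfun; apply: measurable_shell; mfun|by mfun| |].
  by move=> x; rewrite mulr_ge0 ?ind_ge0 ?powR_ge0.
move=> x; rewrite /ind; case: (boolP (shell x)) => [/andP[x1 xe]|_]; last first.
  by rewrite mul0r ler0n.
rewrite mul1r (ltW xe) powRN invf_le1 ?powR_gt0//; last exact: lt_le_trans x1.
by rewrite -[leLHS](powRr0 (enorm x)) ler_powR.
Qed.

Lemma shell_mass_ge0 : 0 <= shell_mass.
Proof.
rewrite -lee_fin -shell_massE; apply: int_ge0 => x.
by rewrite mulr_ge0 ?ind_ge0 ?powR_ge0.
Qed.

Lemma powR_expR_enorm (z : 'rV[R]_N) (t g : R) : 0 < enorm z ->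
  enorm (expR t *: z) `^ g = expR (g * t) * enorm z `^ g.
Proof.
move=> z0; rewrite enormZ gtr0_norm ?expR_gt0// powRM ?expR_ge0 ?enorm_ge0//.
by rewrite -expRM (mulrC t).
Qed.

(** In polar coordinates with [r = expR t], a power of the norm becomes an
    exponential of [t]. *)
Lemma int_radial_in (g r : R) : g < N%:R -> 0 < r ->
  (\int[mu]_y (ind (0 < enorm y) * (ind (enorm y <= r) * enorm y `^ (- g)))%:E =
   (shell_mass / (N%:R - g) * r `^ (N%:R - g))%:E)%E.
Proof.
move=> gN r0; have c0 : 0 < N%:R - g by rewrite subr_gt0.
rewrite polar; first last.
- by rewrite enorm0 ltxx /ind mul0r.
- by move=> x; rewrite !mulr_ge0 ?ind_ge0 ?powR_ge0.
- by mfun.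
transitivity (\int[mu]_z (r `^ (N%:R - g) / (N%:R - g) *
  (ind (shell z) * enorm z `^ (- N%:R)))%:E)%E.
  apply: eq_integral => z _; have [sz|_] := boolP (shell z); last first.
    by rewrite ind0 mul0r mulr0; apply: integral0_eq => t _; rewrite mul0r.
  have z0 := shell_gt0 sz.
  transitivity (\int[lam]_t (enorm z `^ (- g) *
    (ind (t <= ln r - ln (enorm z)) * expR ((N%:R - g) * t)))%:E)%E.
    apply: eq_integral => t _; congr EFin; rewrite powR_expR_enorm//.
    rewrite (_ : 0 < enorm (expR t *: z)); last first.
      by rewrite enormZ mulr_gt0// normr_gt0 gt_eqF ?expR_gt0.
    rewrite (_ : (enorm (expR t *: z) <= r) = (t <= ln r - ln (enorm z))); last first.
      rewrite enormZ gtr0_norm ?expR_gt0// -ler_pdivlMr//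
        -ler_ln ?posrE ?expR_gt0 ?divr_gt0//.
      by rewrite expRK ln_div.
    by rewrite mulrBl expRD mulNr !ind1; ring.
  rewrite intZ ?powR_ge0//; first last.
  - by move=> x; rewrite mulr_ge0 ?ind_ge0 ?expR_ge0.
  - by mfun.
  rewrite int_expR_le// -EFinM; congr EFin; rewrite /powR !gt_eqF//.
  by rewrite ind1 mul1r mulrA -expRD mulrAC -expRD; congr (expR _ / _); ring.
rewrite intZ ?divr_ge0 ?powR_ge0 ?(ltW c0)//; first last.
- by move=> x; rewrite mulr_ge0 ?ind_ge0 ?powR_ge0.
- by mfun; apply: measurable_shell; mfun.
by rewrite shell_massE -EFinM; congr EFin; ring.
Qed.

Lemma int_radial_out (g r : R) : N%:R < g -> 0 < r ->
  (\int[mu]_y (ind (r <= enorm y) * enorm y `^ (- g))%:E =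
   (shell_mass / (g - N%:R) * r `^ (N%:R - g))%:E)%E.
Proof.
move=> gN r0; have c0 : 0 < g - N%:R by rewrite subr_gt0.
rewrite polar; first last.
- by rewrite enorm0 leNgt r0 mul0r.
- by move=> x; rewrite !mulr_ge0 ?ind_ge0 ?powR_ge0.
- by mfun.
transitivity (\int[mu]_z (r `^ (N%:R - g) / (g - N%:R) *
  (ind (shell z) * enorm z `^ (- N%:R)))%:E)%E.
  apply: eq_integral => z _; have [sz|_] := boolP (shell z); last first.
    by rewrite ind0 mul0r mulr0; apply: integral0_eq => t _; rewrite mul0r.
  have z0 := shell_gt0 sz.
  transitivity (\int[lam]_t (enorm z `^ (- g) *
    (ind (ln r - ln (enorm z) <= t) * expR (- (g - N%:R) * t)))%:E)%E.
    apply: eq_integral => t _; congr EFin; rewrite powR_expR_enorm//.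
    rewrite (_ : (r <= enorm (expR t *: z)) = (ln r - ln (enorm z) <= t)); last first.
      rewrite enormZ gtr0_norm ?expR_gt0// -ler_pdivrMr//
        -ler_ln ?posrE ?expR_gt0 ?divr_gt0//.
      by rewrite expRK ln_div.
    rewrite (_ : - (g - N%:R) * t = - g * t + N%:R * t); last by ring.
    by rewrite expRD !ind1; ring.
  rewrite intZ ?powR_ge0//; first last.
  - by move=> x; rewrite mulr_ge0 ?ind_ge0 ?expR_ge0.
  - by mfun.
  rewrite int_expR_ge// -EFinM; congr EFin; rewrite /powR !gt_eqF//.
  by rewrite ind1 mul1r mulrA -expRD mulrAC -expRD; congr (expR _ / _); ring.
rewrite intZ ?divr_ge0 ?powR_ge0 ?(ltW c0)//; first last.
- by move=> x; rewrite mulr_ge0 ?ind_ge0 ?powR_ge0.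
- by mfun; apply: measurable_shell; mfun.
by rewrite shell_massE -EFinM; congr EFin; ring.
Qed.

End radial.

Section inversion.
Context (R : realType) (N : nat).
Local Notation mu := (lebesgue_rV R N).
Local Notation lam := (@lebesgue_measure R).

Definition inversion (r : R) (y : 'rV[R]_N) : 'rV[R]_N := (r / enorm y) ^+ 2 *: y.

(** On each ray, in the logarithmic coordinate [t] of [polar], the inversion is
    the reflection [t |-> b - t], and [(r / |y|)^(2N)] is its Jacobian. *)
Lemma int_inversion (r : R) (f : 'rV[R]_N -> R) : 0 < r ->
  measurable_fun setT f -> (forall x, 0 <= f x) -> f 0 = 0 ->
  (\int[mu]_y (f (inversion r y) * (r / enorm y) ^+ (2 * N))%:E =
    \int[mu]_y (f y)%:E)%E.
Proof.
move=> r0 mf f0 f00; rewrite [RHS]polar// [LHS]polar; first last.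
- by rewrite /inversion scaler0 f00 mul0r.
- by move=> x; rewrite mulr_ge0// exprn_ge0// divr_ge0 ?enorm_ge0// ltW.
- by mfun; apply: (measurableT_comp mf); rewrite /inversion; mfun.
apply: eq_integral => z _; have [sz|_] := boolP (shell z); last first.
  by rewrite !integral0_eq// => t _; rewrite mul0r.
have z0 := shell_gt0 sz.
pose F (t : R) := f (expR t *: z) * expR (N%:R * t).
(* [t = b / 2] is where the ray through [z] crosses the sphere of radius [r]. *)
pose b := 2 * (ln r - ln (enorm z)).
have mF : measurable_fun setT F.
  by rewrite /F; mfun; apply: (measurableT_comp mf); mfun.
rewrite ind1; under [RHS]eq_integral do rewrite mul1r.
transitivity (\int[lam]_t ((EFin \o F) (-1 * t + b)%R))%E; last first.
  rewrite (@ge0_integral_affine1 R (-1) b (EFin \o F)) ?oppr_eq0 ?oner_neq0//.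
  - by rewrite normrN1 invr1 mul1e.
  - exact/measurable_EFinP.
  - by move=> t; rewrite lee_fin mulr_ge0 ?expR_ge0.
apply: eq_integral => t _; rewrite mul1r /F /=; congr EFin.
have E : (r / enorm (expR t *: z)) ^+ 2 = expR (-1 * t + b) / expR t.
  rewrite -[X in X ^+ 2]lnK ?posrE ?divr_gt0 ?enormZ ?mulr_gt0 ?normr_gt0 ?gt_eqF
    ?expR_gt0//.
  rewrite -expRM_natl -expRB; congr expR.
  rewrite gtr0_norm ?expR_gt0// ln_div ?posrE ?mulr_gt0 ?expR_gt0//
    lnM ?posrE ?expR_gt0//.
  by rewrite expRK /b; ring.
rewrite /inversion E scalerA divfK ?gt_eqF ?expR_gt0//.
rewrite exprM E -mulrA; congr (_ * _).
rewrite exprMn exprVn !expRM_natl mulrVK//.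
by rewrite unitfE expf_neq0// gt_eqF ?expR_gt0.
Qed.

End inversion.

(** * The truncated kernel *)

Section kernel.
Context (R : realType) (N : nat) (s : R).
Local Notation q := (N%:R + 2 * s).
Implicit Types (eps : R).

(** The kernel of the fractional Laplacian, with the jumps shorter than [eps]
    removed; its singularity is the only obstruction to integrability. *)
Definition kern eps (z : 'rV[R]_N) : R := ind (eps <= enorm z) * enorm z `^ (- q).

Lemma kern_ge0 eps z : 0 <= kern eps z.
Proof. by rewrite mulr_ge0 ?ind_ge0 ?powR_ge0. Qed.

End kernel.

Ltac nneg := repeat first
  [ exact: kern_ge0 | exact: ind_ge0 | exact: powR_ge0 | exact: enorm_ge0
  | exact: sqr_ge0 | apply: mulr_ge0 | apply: addr_ge0 | done | move=> ? ].

Section truncated_kernel.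
Context (R : realType) (N : nat) (s : R).
Hypotheses (s_gt0 : 0 < s) (s_lt1 : s < 1).
Local Notation mu := (lebesgue_rV R N).
Local Notation q := (N%:R + 2 * s).
Implicit Types (f W phi H : 'rV[R]_N -> R) (eps : R).

Lemma kernN eps (z : 'rV[R]_N) : kern s eps (- z) = kern s eps z.
Proof. by rewrite /kern enormN. Qed.

Lemma measurable_kern eps d (T : measurableType d) (g : T -> 'rV[R]_N) :
  measurable_fun setT g -> measurable_fun setT (fun t => kern s eps (g t)).
Proof. by move=> mg; rewrite /kern; mfun. Qed.

Definition kmass eps : R := shell_mass R N / (2 * s) * eps `^ (- (2 * s)).

Lemma kmass_ge0 eps : 0 <= kmass eps.
Proof. by rewrite mulr_ge0 ?powR_ge0// divr_ge0 ?shell_mass_ge0// mulr_ge0// ltW. Qed.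

Lemma int_kern eps : 0 < eps ->
  (\int[mu]_z (kern s eps (z : 'rV[R]_N))%:E = (kmass eps)%:E)%E.
Proof.
move=> e0; rewrite int_radial_out//; last by rewrite ltrDl mulr_gt0.
by rewrite /kmass; congr (_ / _ * _ `^ _)%:E; ring.
Qed.

Lemma kern_le eps r (z : 'rV[R]_N) : 0 < r -> r <= enorm z -> kern s eps z <=
  r `^ (- q).
Proof.
move=> r0 rz; rewrite /kern -[leRHS]mul1r ler_pM ?ind_ge0 ?ind_le1 ?powR_ge0//.
rewrite !powRN lef_pV2 ?posrE ?powR_gt0 ?(lt_le_trans r0)//.
by rewrite ge0_ler_powR ?nnegrE ?enorm_ge0 ?(ltW r0)// addr_ge0// mulr_ge0// ltW.
Qed.

(** Up to normalization, the truncated fractional Laplacian maps [f] to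
    [kmass eps * f - Kop eps f].  On nonnegative functions, [Kop] makes sense
    without any integrability assumption. *)
Definition Kop eps f x : \bar R := (\int[mu]_z (kern s eps z * f (x + z)%R)%:E)%E.

Lemma Kop_ge0 eps f x : (forall x, 0 <= f x) -> (0 <= Kop eps f x)%E.
Proof. by move=> f0; apply: int_ge0 => z; rewrite mulr_ge0 ?kern_ge0. Qed.

Lemma measurable_Kop eps f : measurable_fun setT f -> (forall x, 0 <= f x) ->
  measurable_fun setT (Kop eps f).
Proof.
move=> mf f0.
have := @measurable_tonelli _ _ _ _ R mu (fun p : 'rV[R]_N * 'rV[R]_N =>
  kern s eps p.2 * f (p.1 + p.2)).
apply.
  apply: measurable_funM; first by apply: measurable_kern; mfun.
  by apply: (measurableT_comp mf); mfun.
by nneg.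
Qed.

Lemma le_Kop eps f g x : measurable_fun setT f -> measurable_fun setT g ->
  (forall x, 0 <= f x) -> (forall x, f x <= g x) -> (Kop eps f x <= Kop eps g x)%E.
Proof.
move=> mf mg f0 fg; apply: le_int.
- by apply: measurable_funM; [apply: measurable_kern; mfun|apply: (measurableT_comp mf);
    mfun].
- by apply: measurable_funM; [apply: measurable_kern; mfun|apply: (measurableT_comp mg);
    mfun].
- by nneg.
- by move=> z; rewrite ler_wpM2l ?kern_ge0.
Qed.

Lemma Kop_opp eps f x : measurable_fun setT f -> (forall x, 0 <= f x) ->
  Kop eps f x = (\int[mu]_z (kern s eps z * f (x - z)%R)%:E)%E.
Proof.
move=> mf f0; rewrite /Kop -int_opp.
- by apply: eq_integral => z _; rewrite kernN.
- by apply: measurable_funM; [apply: measurable_kern; mfun|apply: (measurableT_comp mf);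
    mfun].
- by nneg.
Qed.

(** Tonelli's theorem and the translation [x |-> x - z] for each jump [z]. *)
Lemma Kop_sym eps W phi : measurable_fun setT W -> (forall x, 0 <= W x) ->
  measurable_fun setT phi -> (forall x, 0 <= phi x) ->
  (\int[mu]_x ((W x)%:E * Kop eps phi x) = \int[mu]_x ((phi x)%:E * Kop eps W x))%E.
Proof.
move=> mW W0 mp p0.
transitivity (\int[mu]_x \int[mu]_z (W x * (kern s eps z * phi (x + z)%R))%:E)%E.
  apply: eq_integral => x _; rewrite intZ//.
    by apply: measurable_funM; [apply: measurable_kern;
      mfun|apply: (measurableT_comp mp); mfun].
  by nneg.
rewrite (@tonelli _ _ _ _ R mu mu (fun p : 'rV[R]_N * 'rV[R]_N => W p.1 *
  (kern s eps p.2 * phi (p.1 + p.2)%R)))/=;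
  first last.
- by nneg.
- apply: measurable_funM; first by apply: (measurableT_comp mW); mfun.
  by apply: measurable_funM; [apply: measurable_kern; mfun|apply: (measurableT_comp mp);
    mfun].
transitivity (\int[mu]_z \int[mu]_x (phi x * (kern s eps z * W (x - z)%R))%:E)%E.
  apply: eq_integral => z _; rewrite -(int_shift (- z)); first last.
  - by nneg.
  - apply: measurable_funM => //; apply: measurable_funM; first by mfun.
    by apply: (measurableT_comp mp); mfun.
  by apply: eq_integral => x _; rewrite subrK; congr EFin; ring.
rewrite -(@tonelli _ _ _ _ R mu mu (fun p : 'rV[R]_N * 'rV[R]_N => phi p.1 *
  (kern s eps p.2 * W (p.1 - p.2)%R)))/=;
  first last.
- by nneg.
- apply: measurable_funM; first by apply: (measurableT_comp mp); mfun.
  by apply: measurable_funM; [apply: measurable_kern; mfun|apply: (measurableT_comp mW);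
    mfun].
apply: eq_integral => x _; rewrite Kop_opp// intZ//.
  by apply: measurable_funM; [apply: measurable_kern; mfun|apply: (measurableT_comp mW);
    mfun].
by nneg.
Qed.

Definition near_const : R := shell_mass R N / (2 - 2 * s).

Lemma near_const_ge0 : 0 <= near_const.
Proof. by rewrite divr_ge0 ?shell_mass_ge0// subr_ge0; have := s_lt1; lra. Qed.

Lemma int_near r : 0 < r -> (\int[mu]_z (ind (0 < enorm z) * (ind (enorm z <= r) *
   enorm z `^ (- (q - 2))))%:E = (near_const * r `^ (2 - 2 * s))%:E)%E.
Proof.
move=> r0; rewrite int_radial_in//; last by have := s_lt1; lra.
by rewrite /near_const; congr (_ / _ * _ `^ _)%:E; ring.
Qed.

(** The long jumps, of length at least [r], see only the total mass of [H]
    because the kernel is bounded there; the short jumps are paired with their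
    opposites, which leaves the second difference.  The bound depends on [eps]
    only through the mass of the kernel. *)
Lemma Kop_le eps f H x (A r : R) : 0 < eps -> 0 < r -> 0 <= A ->
  measurable_fun setT f -> (forall x, 0 <= f x) ->
  measurable_fun setT H -> (forall x, 0 <= H x) ->
  (forall z, enorm z <= r -> f (x + z) + f (x - z) <= 2 * f x + A * enorm z ^+ 2) ->
  (forall y, f y <= f x + H y) ->
  (Kop eps f x <= (kmass eps * f x + A * near_const * r `^ (2 - 2 * s))%:E +
     (r `^ (- q))%:E * \int[mu]_y (H y)%:E)%E.
Proof.
move=> e0 r0 A0 mf f0 mH H0 f2 fH.
have mk : measurable_fun setT (kern s eps : 'rV[R]_N -> R) by apply:
  (@measurable_kern eps _ _ id); mfun.
have mfD : measurable_fun setT (fun z : 'rV[R]_N => f (x + z)) by apply: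
  (measurableT_comp mf); mfun.
have mfB : measurable_fun setT (fun z : 'rV[R]_N => f (x - z)) by apply:
  (measurableT_comp mf); mfun.
have mHD : measurable_fun setT (fun z : 'rV[R]_N => H (x + z)) by apply:
  (measurableT_comp mH); mfun.
have mHB : measurable_fun setT (fun z : 'rV[R]_N => H (x - z)) by apply:
  (measurableT_comp mH); mfun.
have -> : Kop eps f x = (\int[mu]_z (2^-1 * (kern s eps z * f (x + z)) + 2^-1 *
  (kern s eps z * f (x - z)%R))%:E)%E.
  have k0 z : 0 <= kern s eps z by exact: kern_ge0.
  rewrite intD; [|by mfun|by mfun|by nneg|by nneg].
  rewrite !intZ//; [|by mfun|by nneg|by mfun|by nneg].
  rewrite -Kop_opp// -/(Kop eps f x) -ge0_muleDl ?lee_fin// -EFinD.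
  by rewrite (_ : 2^-1 + 2^-1 = 1 :> R) ?mul1e//; lra.
pose near (z : 'rV[R]_N) := ind (0 < enorm z) *
  (ind (enorm z <= r) * enorm z `^ (- (q - 2))).
have mnear : measurable_fun setT near by rewrite /near; mfun.
have near0 z : 0 <= near z by rewrite !mulr_ge0 ?ind_ge0 ?powR_ge0.
apply: (@le_trans _ _ (\int[mu]_z ((f x * kern s eps z + A * near z) +
   r `^ (- q) * (2^-1 * H (x + z) + 2^-1 * H (x - z)))%:E)%E).
  apply: le_int; [by mfun|by mfun|by nneg|].
  move=> z; have [zr|rz] := leP (enorm z) r.
    apply: (@le_trans _ _ (f x * kern s eps z + A * near z)); last first.
      by rewrite lerDl mulr_ge0 ?powR_ge0// addr_ge0 ?mulr_ge0.
    rewrite -mulrDr -mulrDr mulrCA.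
    apply: (@le_trans _ _ (kern s eps z * (f x + A * enorm z ^+ 2))).
      rewrite ler_wpM2l ?kern_ge0//; have := f2 _ zr.
      by have := mulr_ge0 A0 (sqr_ge0 (enorm z)); lra.
    rewrite mulrDr (mulrC (f x)) lerD2l mulrCA ler_wpM2l// /near /kern zr ind1 mul1r.
    have [ez|_] := leP eps (enorm z);
      last by rewrite ind0 !mul0r mulr_ge0 ?ind_ge0 ?powR_ge0.
    have z0 : 0 < enorm z by exact: lt_le_trans ez.
    rewrite z0 ind1 !mul1r -powR_mulrn ?enorm_ge0// -powRD;
      last by rewrite (gt_eqF z0) implybT.
    by rewrite (_ : - q + 2 = - (q - 2)) ?lexx//; ring.
  have kr := kern_le eps r0 (ltW rz).
  apply: (@le_trans _ _ (f x * kern s eps z + r `^ (- q) *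
    (2^-1 * H (x + z) + 2^-1 * H (x - z)))); last first.
    by rewrite lerD2r lerDl mulr_ge0.
  apply: (@le_trans _ _ (kern s eps z * (f x + (2^-1 * H (x + z) + 2^-1 * H (x - z))))).
    rewrite -mulrDr -mulrDr mulrCA ler_wpM2l ?kern_ge0//.
    by have := fH (x + z); have := fH (x - z); lra.
  by rewrite mulrDr (mulrC (f x)) lerD2l ler_wpM2r// addr_ge0 ?mulr_ge0.
rewrite intD; [|by mfun|by mfun| |]; first last.
- by nneg.
- by nneg.
rewrite intD; [|by mfun|by mfun|by nneg|by nneg].
rewrite !intZ ?powR_ge0//; first last.
- exact: kern_ge0.
- by nneg.
- by mfun.
have -> : (\int[mu]_z (2^-1 * H (x + z)%R + 2^-1 * H (x - z)%R)%:E =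
  \int[mu]_z (H z)%:E)%E.
  have HD : (\int[mu]_z (H (x + z)%R)%:E = \int[mu]_z (H z)%:E)%E.
    by rewrite -[RHS](int_shift x)//; apply: eq_integral => z _; rewrite addrC.
  have HB : (\int[mu]_z (H (x - z)%R)%:E = \int[mu]_z (H z)%:E)%E.
    by rewrite -HD; exact: (@int_opp R N (fun z : 'rV[R]_N => H (x + z))).
  rewrite intD; [|by mfun|by mfun|by nneg|by nneg].
  rewrite !intZ// HD HB -ge0_muleDl ?lee_fin// -EFinD.
  by rewrite (_ : 2^-1 + 2^-1 = 1 :> R) ?mul1e//; lra.
by rewrite int_kern// int_near// -!EFinM -EFinD mulrC mulrA.
Qed.

End truncated_kernel.

(** * Superharmonicity of the barrier by inversion *)

Section superharmonicity.
Context (R : realType) (N : nat) (s : R).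
Hypotheses (N_ge1 : (1 <= N)%N) (s_gt0 : 0 < s) (s_lt1 : s < 1).
Local Notation mu := (lebesgue_rV R N).
Local Notation q := (N%:R + 2 * s).

Lemma Kop_center eps (f : 'rV[R]_N -> R) x : measurable_fun setT f ->
  (forall x, 0 <= f x) ->
  Kop s eps f x = (\int[mu]_y (kern s eps (y - x) * f y)%:E)%E.
Proof.
move=> mf f0; rewrite -(int_shift x).
- by apply: eq_integral => y _; rewrite addrK addrC.
- by apply: measurable_funM => //; apply: measurable_kern; mfun.
- by nneg.
Qed.

Lemma inversionK r (y : 'rV[R]_N) : 0 < r -> 0 < enorm y ->
  enorm (inversion r y) = r ^+ 2 / enorm y.
Proof.
move=> r0 y0; rewrite enormZ ger0_norm ?sqr_ge0//; field.
by rewrite gt_eqF.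
Qed.

Lemma enorm_inversionB r (x y : 'rV[R]_N) : 0 < r -> 0 < enorm y -> enorm x = r ->
  enorm (inversion r y - x) = r / enorm y * enorm (y - x).
Proof.
move=> r0 y0 xr; have c0 : 0 <= r / enorm y by rewrite divr_ge0 ?enorm_ge0 ?ltW.
apply/eqP; rewrite -(@eqrXn2 _ 2)// ?enorm_ge0 ?(mulr_ge0 c0) ?enorm_ge0//.
rewrite exprMn !enormD_sqr !enormN inversionK// xr.
rewrite -(scaleN1r x) !dotpZr /inversion dotpZl; apply/eqP; field.
by rewrite gt_eqF.
Qed.

(** The inversion multiplies the distance of [y] to a point [x] of the sphere by
    [r / |y|] ([enorm_inversionB]).  The image of the truncation radius [eps]
    therefore grows with the norm of the image point; outside of the ball this
    truncation is stronger than that of [kern]. *)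
Definition kern_sym eps r (x y : 'rV[R]_N) : R :=
  ind (eps * Num.max 1 (enorm y / r) <= enorm (y - x)) * enorm (y - x) `^ (- q).

(** The gain is the excess of [|y|^(-b)] over its value on the sphere of radius
    [r], inside of the ball; the loss is the deficit outside.  The inversion
    exchanges the two regions. *)
Definition gain r b (y : 'rV[R]_N) : R :=
  ind (0 < enorm y) * (ind (enorm y <= r) * (enorm y `^ (- b) - r `^ (- b))).
Definition loss r b (y : 'rV[R]_N) : R :=
  ind (r <= enorm y) * (r `^ (- b) - enorm y `^ (- b)).

Lemma powRN_le (a c b : R) : 0 < a -> a <= c -> 0 <= b -> c `^ (- b) <= a `^ (- b).
Proof.
move=> a0 ac b0; rewrite !powRN lef_pV2 ?posrE ?powR_gt0// ?(lt_le_trans a0)//.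
by rewrite ge0_ler_powR// nnegrE ltW// (lt_le_trans a0).
Qed.

Lemma gain_ge0 r b y : 0 < r -> 0 <= b -> 0 <= gain r b y.
Proof.
move=> r0 b0; rewrite /gain; have [y0|_] := ltP 0 (enorm y); last by rewrite ind0 mul0r.
have [yr|_] := leP (enorm y) r; last by rewrite ind0 mul0r mulr0.
by rewrite !ind1 !mul1r subr_ge0 powRN_le.
Qed.

Lemma loss_ge0 r b y : 0 < r -> 0 <= b -> 0 <= loss r b y.
Proof.
move=> r0 b0; rewrite /loss; have [ry|_] := leP r (enorm y); last by rewrite ind0 mul0r.
by rewrite ind1 mul1r subr_ge0 powRN_le.
Qed.

(** With [t = |y| / r <= 1], the quotient of the left-hand side by the right-hand
    side is [t^(N - 2s - b)]: this is where [b <= N - 2s] is needed. *)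
Lemma gain_loss_inversion eps r b x y : 0 < eps -> 0 < r -> 0 <= b -> b <= N%:R - 2 *
  s ->
  enorm x = r ->
  kern s eps (y - x) * gain r b y <=
  kern_sym eps r x (inversion r y) * loss r b (inversion r y) *
    (r / enorm y) ^+ (2 * N).
Proof.
move=> e0 r0 b0 bN xr.
have RHS0 : 0 <= kern_sym eps r x (inversion r y) * loss r b (inversion r y) *
  (r / enorm y) ^+ (2 * N).
  rewrite mulr_ge0 ?exprn_ge0 ?divr_ge0 ?enorm_ge0 ?(ltW r0)// mulr_ge0 ?loss_ge0//.
  by rewrite mulr_ge0 ?ind_ge0 ?powR_ge0.
rewrite {1}/gain; have [y0|_] := ltP 0 (enorm y); last by rewrite ind0 mul0r mulr0.
have [yr|_] := leP (enorm y) r; last by rewrite ind0 mul0r !mulr0.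
rewrite /kern; have [ey|_] := leP eps (enorm (y - x)); last by rewrite ind0 !mul0r.
rewrite {RHS0} /kern_sym /loss enorm_inversionB// inversionK//.
pose t := enorm y / r.
have t0 : 0 < t by rewrite divr_gt0.
have t1 : t <= 1 by rewrite ler_pdivrMr// mul1r.
have -> : r / enorm y = t^-1 by rewrite /t invf_div.
have -> : r ^+ 2 / enorm y = r / t by rewrite /t; field; rewrite !gt_eqF.
rewrite (_ : r <= r / t); last by rewrite ler_pdivlMr// ler_piMr// ltW.
rewrite (_ : eps * Num.max 1 (r / t / r) <= t^-1 * enorm (y - x)); last first.
  rewrite (_ : r / t / r = t^-1); last by field; rewrite !gt_eqF.
  by rewrite max_r ?invf_ge1// mulrC ler_pM2l ?invr_gt0.
rewrite !ind1 !mul1r powRM ?enorm_ge0 ?invr_ge0 ?(ltW t0)//.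
have -> : enorm y = r * t by rewrite /t; field; rewrite gt_eqF.
clearbody t.
rewrite !powRM ?invr_ge0 ?(ltW t0) ?(ltW r0)//.
have tV g : t^-1 `^ g = t `^ (- g) by rewrite -powR_inv1 ?(ltW t0)// -powRrM mulN1r.
rewrite !tV !opprK exprVn -powR_invn ?(ltW t0)//.
have tD a c : t `^ (a + c) = t `^ a * t `^ c by rewrite powRD// (gt_eqF t0) implybT.
have rb0 := powR_ge0 r (- b); have d0 := powR_ge0 (enorm (y - x)) (- q).
rewrite [leRHS](_ : _ = enorm (y - x) `^ (- q) * (r `^ (- b) *
   ((1 - t `^ b) * (t `^ q * t `^ (- (2 * N)%:R))))); last by ring.
rewrite [leLHS](_ : _ = enorm (y - x) `^ (- q) *
  (r `^ (- b) * ((1 - t `^ b) * t `^ (- b)))); last first.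
  have -> : (1 - t `^ b) * t `^ (- b) = t `^ (- b) - 1.
    by rewrite mulrBl mul1r -tD subrr powRr0.
  ring.
have tb1 : t `^ b <= 1.
  by rewrite -[leRHS](powRr0 t); apply: ger_powR; rewrite ?t0.
rewrite ler_wpM2l// ler_wpM2l// ler_wpM2l ?subr_ge0// -tD.
apply: ger_powR; first by rewrite t0.
by rewrite natrM; have := bN; lra.
Qed.

Lemma Kop_gain_loss eps r b x : 0 < eps -> 0 < r -> 0 <= b -> b <= N%:R - 2 * s ->
  enorm x = r -> (Kop s eps (gain r b) x <= Kop s eps (loss r b) x)%E.
Proof.
move=> e0 r0 b0 bN xr.
have mg : measurable_fun setT (gain r b) by rewrite /gain; mfun.
have ml : measurable_fun setT (loss r b) by rewrite /loss; mfun.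
have g0 y : 0 <= gain r b y by exact: gain_ge0.
have l0 y : 0 <= loss r b y by exact: loss_ge0.
have mk : measurable_fun setT (kern_sym eps r x) by rewrite /kern_sym; mfun.
have k0 y : 0 <= kern_sym eps r x y by rewrite mulr_ge0 ?ind_ge0 ?powR_ge0.
have mkk : measurable_fun setT (fun y : 'rV[R]_N => kern s eps (y - x)) by apply:
  measurable_kern; mfun.
rewrite !Kop_center//.
apply: (@le_trans _ _ (\int[mu]_y (kern_sym eps r x (inversion r y) *
  loss r b (inversion r y) *
   (r / enorm y) ^+ (2 * N))%:E)%E).
  have mi : measurable_fun setT (@inversion R N r) by rewrite /inversion; mfun.
  apply: le_int.
  - exact: measurable_funM.
  - apply: measurable_funM; last by mfun.
    by apply: measurable_funM; [exact: (measurableT_comp mk)|exact: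
      (measurableT_comp ml)].
  - by move=> y; rewrite mulr_ge0 ?kern_ge0.
  - by move=> y; exact: gain_loss_inversion.
rewrite (@int_inversion R N r (fun y : 'rV[R]_N => kern_sym eps r x y * loss r b y))//;
  first last.
- by rewrite /loss enorm0 leNgt r0 ind0 mul0r mulr0.
- by move=> y; rewrite mulr_ge0.
- exact: measurable_funM.
apply: le_int; [exact: measurable_funM|exact: measurable_funM|by move=> y;
  rewrite mulr_ge0|].
move=> y; rewrite ler_wpM2r// /kern_sym /kern ler_wpM2r ?powR_ge0// ind_le//.
by apply: le_trans; rewrite ler_peMr ?(ltW e0)// le_max lexx.
Qed.

(** The origin is invariant under the dilation by [2], which multiplies volumes
    by [2^N > 1]. *)
Lemma int_origin : (\int[mu]_y (ind (enorm y <= 0))%:E = 0)%E.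
Proof.
have fin := @int_ball_fin R N 0.
have h0 : (0 <= \int[mu]_y (ind (enorm y <= 0))%:E)%E by apply: int_ge0 => y;
  exact: ind_ge0.
have := @int_scale R N 2 (fun y : 'rV[R]_N => ind (enorm y <= 0)) (ltr0n _ 2) _ _.
move=> /(_ ltac:(by mfun) ltac:(by nneg)).
under [in X in _ = X -> _]eq_integral => y _.
  rewrite enormZ pmulr_rle0 ?normr_gt0 ?pnatr_eq0//; over.
move: fin h0; case: (\int[mu]_y _)%E => // v _ v0 /= [vE]; rewrite lee_fin in v0.
congr EFin; apply/eqP; rewrite eq_le v0 andbT.
have : v * 2 <= v * 2 ^+ N.
  by rewrite ler_wpM2l// -{1}[2]expr1 ler_weXn2l// ler1n.
by have : 2 ^+ N * v = v by []; lra.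
Qed.

Definition barrier b (x : 'rV[R]_N) : R := Num.max 1 (enorm x) `^ (- b).

Lemma measurable_barrier b : measurable_fun setT (barrier b).
Proof. by rewrite /barrier; mfun. Qed.

Lemma max1_gt0 (x : 'rV[R]_N) : 0 < Num.max 1 (enorm x).
Proof. by rewrite lt_max ltr01. Qed.

Lemma barrier_gt0 b x : 0 < barrier b x.
Proof. by rewrite powR_gt0// max1_gt0. Qed.

Lemma barrier_le1 b x : 0 <= b -> barrier b x <= 1.
Proof.
move=> b0; have m1 : 1 <= Num.max 1 (enorm x) by rewrite le_max lexx.
by have := powRN_le ltr01 m1 b0; rewrite powR1.
Qed.

(** If [|x| <= 1], then [barrier b x = 1] is the maximum of the barrier.
    Otherwise [barrier b] is at most [barrier b x + gain - loss] away from the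
    origin, for the sphere through [x], and the gain is compensated by the
    loss. *)
Lemma barrier_superharmonic eps b x : 0 < eps -> 0 <= b -> b <= N%:R - 2 * s ->
  (Kop s eps (barrier b) x <= (kmass N s eps * barrier b x)%:E)%E.
Proof.
move=> e0 b0 bN.
have mw := measurable_barrier b.
have w0 y : 0 <= barrier b y by exact/ltW/barrier_gt0.
have mk : measurable_fun setT (kern s eps : 'rV[R]_N -> R).
  by apply: (@measurable_kern _ _ _ _ _ _ id); mfun.
have kx (v : R) : 0 <= v -> (\int[mu]_z (kern s eps z * v)%:E =
  (kmass N s eps * v)%:E)%E.
  move=> v0; under eq_integral do rewrite mulrC.
  by rewrite intZ// ?int_kern// 1?mulrC// => z; exact: kern_ge0.
have [x1|x1] := leP (enorm x) 1.
  rewrite -kx; last exact: w0.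
  apply: le_int.
  - by apply: measurable_funM => //; apply: (measurableT_comp mw); mfun.
  - by mfun.
  - by nneg.
  move=> z; rewrite ler_wpM2l ?kern_ge0// {2}/barrier max_l// powR1.
  exact: barrier_le1.
set r := enorm x in x1; have r0 : 0 < r by exact: lt_trans x1.
pose O (y : 'rV[R]_N) : R := ind (enorm y <= 0).
have mg : measurable_fun setT (gain r b) by rewrite /gain; mfun.
have ml : measurable_fun setT (loss r b) by rewrite /loss; mfun.
have mO : measurable_fun setT O by rewrite /O; mfun.
have g0 y : 0 <= gain r b y by exact: gain_ge0.
have l0 y : 0 <= loss r b y by exact: loss_ge0.
have mD (f : 'rV[R]_N -> R) : measurable_fun setT f ->
    measurable_fun setT (fun z : 'rV[R]_N => kern s eps z * f (x + z)).
  by move=> mf; apply: measurable_funM => //; apply: (measurableT_comp mf); mfun.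
have KD (f g : 'rV[R]_N -> R) : measurable_fun setT f -> measurable_fun setT g ->
  (forall y, 0 <= f y) ->
    (forall y, 0 <= g y) -> (Kop s eps (fun y : 'rV[R]_N => f y + g y)%R x =
      Kop s eps f x + Kop s eps g x)%E.
  move=> mf mg' f0 g0'; rewrite /Kop -intD; [|exact: mD|exact: mD|by nneg|by nneg].
  by apply: eq_integral => z _; rewrite mulrDr.
have KO : Kop s eps O x = 0%E.
  apply/eqP; rewrite eq_le Kop_ge0 ?andbT; last by move=> y; exact: ind_ge0.
  apply: (@le_trans _ _ (\int[mu]_z (eps `^ (- q) * O (x + z)%R)%:E)%E).
    apply: le_int; [exact: mD| |by nneg|].
      by apply: measurable_funM; [mfun|apply: (measurableT_comp mO); mfun].
    move=> z; rewrite ler_wpM2r ?ind_ge0//.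
    have [ez|ez] := leP eps (enorm z); first exact: kern_le.
    by rewrite /kern [eps <= _]leNgt ez ind0 mul0r powR_ge0.
  rewrite intZ ?powR_ge0//; last by apply: (measurableT_comp mO); mfun.
  rewrite (_ : (\int[mu]_z (O (x + z)%R)%:E = 0)%E) ?mule0//
    -int_origin -[RHS](int_shift x)//.
  by apply: eq_integral => z _; rewrite addrC.
have main : (Kop s eps (barrier b) x + Kop s eps (loss r b) x <=
   (kmass N s eps * barrier b x)%:E + Kop s eps (gain r b) x)%E.
  have mc : measurable_fun setT (fun _ : 'rV[R]_N => barrier b x) by exact:
    measurable_cst.
  have O0 y : 0 <= O y by exact: ind_ge0.
  have cO0 y : 0 <= barrier b x + O y by rewrite addr_ge0.
  have L := KD _ _ mw ml w0 l0.
  have R1 := KD _ _ mc mO (fun=> w0 x) O0.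
  have R2 : (Kop s eps (fun y => barrier b x + O y + gain r b y)%R x =
      Kop s eps (fun y => barrier b x + O y)%R x + Kop s eps (gain r b) x)%E.
    by apply: KD => //; exact: measurable_funD.
  have C : Kop s eps (fun=> barrier b x) x =
    (kmass N s eps * barrier b x)%:E := kx _ (w0 x).
  rewrite -L -C -[X in (_ <= X + _)%E]adde0 -KO -R1.
  rewrite -R2.
  apply: le_Kop; [by mfun|by mfun|by move=> y; rewrite addr_ge0|].
  move=> y; rewrite /barrier -/r (max_r (ltW x1)) /gain /loss /O.
  have [y0|y0] := ltP 0 (enorm y); last first.
    have -> : enorm y = 0 by apply/eqP; rewrite eq_le y0 enorm_ge0.
    rewrite max_l// powR1 [r <= 0]leNgt r0 ind0 ind1 !mul0r !addr0.
    by rewrite lerDr powR_ge0.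
  rewrite ind0 ind1 addr0 mul1r.
  have wy : Num.max 1 (enorm y) `^ (- b) <= enorm y `^ (- b).
    by rewrite powRN_le// le_max lexx orbT.
  have [yr|yr] := leP (enorm y) r; have [ry|ry] := leP r (enorm y); rewrite ?ind0 ?ind1.
  - have e : enorm y = r by apply/eqP; rewrite eq_le yr.
    by rewrite e in wy *; lra.
  - by lra.
  - by lra.
  - by have := lt_trans yr ry; rewrite ltxx.
have lfin : Kop s eps (loss r b) x \is a fin_num.
  rewrite ge0_fin_numE ?Kop_ge0//;
    apply: (@le_lt_trans _ _ (kmass N s eps * barrier b x)%:E); last exact: ltry.
  rewrite -kx; last exact: w0.
  apply: le_int; [exact: mD|exact: (measurable_funM mk (measurable_cst _))|by move=> z;
    rewrite mulr_ge0 ?kern_ge0|].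
  move=> z; rewrite ler_wpM2l ?kern_ge0// /barrier -/r (max_r (ltW x1)) /loss.
  have := powR_ge0 (enorm (x + z)) (- b); have := powR_ge0 r (- b).
  by have [_|_] := leP r (enorm (x + z)); rewrite ?ind0 ?ind1; lra.
rewrite -(leeD2rE _ _ lfin); apply: (le_trans main).
by rewrite leeD2l//; exact: Kop_gain_loss.
Qed.

End superharmonicity.

(** * One-sided second-order bounds for the barrier and its cutoff *)

Section negative_powers.
Context (R : realType).
Implicit Types (b c t : R).

(** The graph of [t^(-c)] is above its tangent line at [1]; the next lemma is
    the same with the tangent line at [t], evaluated at [1]. *)
Lemma powRN_tangent1 c t : 0 <= c -> 0 < t -> 1 - c * (t - 1) <= t `^ (- c).
Proof.
move=> c0 t0; rewrite /powR gt_eqF//; apply: le_trans (expR_ge1Dx _).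
rewrite lerD2l mulNr lerN2 ler_wpM2l//.
have := @le_ln1Dx _ (t - 1); rewrite (_ : 1 + (t - 1) = t); last by ring.
by apply; lra.
Qed.

Lemma powRN_tangent c t : 0 <= c -> 0 < t -> t `^ (- c) <= 1 + c * t `^ (- (c + 1)) *
  (1 - t).
Proof.
move=> c0 t0; have tc : 0 < t `^ (- c) by exact: powR_gt0.
have tV : 0 < t^-1 by rewrite invr_gt0.
have := powRN_tangent1 c0 tV; rewrite -(ler_pM2l tc).
have -> : t `^ (- c) * t^-1 `^ (- c) = 1.
  rewrite -powRM ?invr_ge0 ?(ltW t0)// mulfV ?gt_eqF//;
    exact: (congr1 (fun f => f _) (powR1 R)).
have -> : t `^ (- (c + 1)) = t `^ (- c) * t^-1.
  by rewrite opprD powRD ?(gt_eqF t0) ?implybT// powR_inv1// ltW.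
move=> h; rewrite -lerBlDr; apply: le_trans h; rewrite le_eqVlt; apply/orP; left;
  apply/eqP.
by field; rewrite gt_eqF.
Qed.

Lemma powRN_quarter c t : 0 <= c -> 4^-1 <= t -> t `^ (- c) <= 4 `^ c.
Proof.
move=> c0 t4; have h : 0 < 4^-1 :> R by rewrite invr_gt0.
apply: le_trans (powRN_le h t4 c0) _.
by rewrite -powR_inv1// -powRrM mulN1r opprK.
Qed.

Definition quad_const b : R := b * ((b + 1) * 4 `^ (b + 2)).
Definition lip_const b : R := b * 4 `^ (b + 1).

Lemma quad_const_ge0 b : 0 <= b -> 0 <= quad_const b.
Proof. by move=> b0; rewrite !mulr_ge0 ?powR_ge0// addr_ge0. Qed.

Lemma lip_const_ge0 b : 0 <= b -> 0 <= lip_const b.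
Proof. by move=> b0; rewrite !mulr_ge0 ?powR_ge0. Qed.

(** The bound [powRN_tangent] has the slope at [t] instead of [1]; replacing it
    by the slope at [1] costs a quadratic term, by the tangent lines of
    [t^(-(b+1))].  The bound [4^-1 <= t] keeps the constant finite. *)
Lemma powRN_quad b t : 0 <= b -> 4^-1 <= t ->
  t `^ (- b) <= 1 - b * (t - 1) + quad_const b * (t - 1) ^+ 2.
Proof.
move=> b0 t4; have t0 : 0 < t by apply: lt_le_trans t4; rewrite invr_gt0.
have b1 : 0 <= b + 1 by rewrite addr_ge0.
apply: (le_trans (powRN_tangent b0 t0)).
suff : b * ((1 - t) * (t `^ (- (b + 1)) - 1)) <= b *
  ((b + 1) * 4 `^ (b + 2) * (t - 1) ^+ 2).
  by rewrite /quad_const; lra.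
rewrite ler_wpM2l//; have [t1|t1] := leP t 1.
  have h := powRN_tangent b1 t0.
  have b2 : 0 <= b + 1 + 1 by rewrite addr_ge0.
  have h4 := powRN_quarter b2 t4.
  rewrite -sqrrN opprB expr2 mulrCA ler_wpM2l ?subr_ge0//.
  apply: (@le_trans _ _ ((b + 1) * t `^ (- (b + 1 + 1)) * (1 - t)));
    first by rewrite lerBlDl.
  rewrite ler_wpM2r ?subr_ge0// ler_wpM2l//.
  by rewrite (_ : b + 2 = b + 1 + 1)//; lra.
have h := powRN_tangent1 b1 t0.
have h4 : 1 <= 4 `^ (b + 2).
  by rewrite -[leLHS](powRr0 4) ler_powR ?ler1n// addr_ge0.
apply: (@le_trans _ _ ((t - 1) * ((b + 1) * (t - 1)))).
  rewrite -mulrNN !opprB ler_wpM2l ?subr_ge0 ?(ltW t1)//; lra.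
rewrite mulrCA -mulrA ler_wpM2l// -expr2 ler_peMl// sqr_ge0//.
Qed.

Lemma powRN_lip b t : 0 <= b -> 4^-1 <= t -> `|t `^ (- b) - 1| <= lip_const b *
  `|t - 1|.
Proof.
move=> b0 t4; have t0 : 0 < t by apply: lt_le_trans t4; rewrite invr_gt0.
have b1 : 0 <= b + 1 by rewrite addr_ge0.
have h4 : 1 <= 4 `^ (b + 1) by rewrite -[leLHS](powRr0 4) ler_powR ?ler1n.
have hq := powRN_quarter b1 t4.
have p0 := powR_ge0 t (- (b + 1)).
rewrite ler_norml; apply/andP; split.
  rewrite lerNl opprB; apply: (@le_trans _ _ (b * (t - 1))).
    by have := powRN_tangent1 b0 t0; lra.
  rewrite /lip_const -mulrA ler_wpM2l//; apply: le_trans (ler_norm _) _.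
  by rewrite ler_peMl.
rewrite lerBlDl; apply: (le_trans (powRN_tangent b0 t0));
  rewrite lerD2l /lip_const -!mulrA ler_wpM2l//.
apply: (@le_trans _ _ (t `^ (- (b + 1)) * `|t - 1|)); last by rewrite ler_wpM2r.
by rewrite ler_wpM2l// distrC ler_norm.
Qed.

End negative_powers.

Section barrier_regularity.
Context (R : realType) (N : nat).
Implicit Types (x z y : 'rV[R]_N) (b d : R).
Local Notation m x := (Num.max 1 (enorm x)).

Lemma max1_ge1 x : 1 <= m x.
Proof. by rewrite le_max lexx. Qed.

Lemma max1_lip x z : `|m (x + z) - m x| <= enorm z.
Proof.
have z0 := enorm_ge0 z; have h1 := ler_enormD x z; have h2 := ler_enormB x z.
by rewrite ler_norml; apply/andP; split; rewrite !maxEle; case: ifP; case: ifP; lra.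
Qed.

(** Both [1] and the squared norm are convex, and so is their maximum. *)
Lemma max1_sqr_convex x z : 2 * m x ^+ 2 <= m (x + z) ^+ 2 + m (x - z) ^+ 2.
Proof.
have sq1 y : 1 <= m y ^+ 2 by rewrite -[leLHS](expr1n _ 2) lerXn2r ?nnegrE ?max1_ge1//
  ltW// max1_gt0.
have [x1|x1] := leP (enorm x) 1.
  by rewrite expr1n; have := sq1 (x + z); have := sq1 (x - z); lra.
have sqe y : enorm y ^+ 2 <= m y ^+ 2.
  by rewrite lerXn2r ?nnegrE ?enorm_ge0 ?(ltW (max1_gt0 _))// le_max lexx orbT.
have := sqe (x + z); have := sqe (x - z); rewrite !enormD_sqr enormN.
have -> : dotp x (- z) = - dotp x z by rewrite -scaleN1r dotpZr mulN1r.
by have := sqr_ge0 (enorm z); lra.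
Qed.

Lemma barrierE b x : barrier b x = (m x ^+ 2) `^ (- (b / 2)).
Proof.
rewrite -powR_mulrn ?(ltW (max1_gt0 _))// -powRrM; congr (_ `^ _); lra.
Qed.

Lemma barrier_ratio b x z : barrier b (x + z) = barrier b x *
  (m (x + z) ^+ 2 / m x ^+ 2) `^ (- (b / 2)).
Proof.
rewrite !barrierE -powRM ?divr_ge0 ?exprn_ge0 ?(ltW (max1_gt0 _))//.
by congr (_ `^ _); field; rewrite gt_eqF// max1_gt0.
Qed.

(** Jumps shorter than half of [max(1, |x|)] change the weight by a bounded
    factor. *)
Lemma max1_ratio x z : enorm z <= m x / 2 ->
  4^-1 <= m (x + z) ^+ 2 / m x ^+ 2 /\
  `|m (x + z) ^+ 2 / m x ^+ 2 - 1| <= 3 * enorm z / m x.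
Proof.
move=> zm; have m0 := max1_gt0 x; have m0' := max1_gt0 (x + z); have z0 := enorm_ge0 z.
have := max1_lip x z; rewrite ler_norml => /andP[h1 h2].
split.
  rewrite ler_pdivlMr ?exprn_gt0// -(_ : (2^-1 * m x) ^+ 2 = 4^-1 * m x ^+ 2);
    last by field.
  by rewrite lerXn2r ?nnegrE ?mulr_ge0 ?(ltW m0) ?(ltW m0')//; lra.
rewrite (_ : _ - 1 = (m (x + z) - m x) * ((m (x + z) + m x) / m x ^+ 2)); last by field;
  rewrite gt_eqF.
rewrite normrM (_ : 3 * enorm z / m x = enorm z * (3 / m x)); last by ring.
apply: ler_pM => //; first by rewrite ler_norml h1.
rewrite ger0_norm ?divr_ge0 ?addr_ge0 ?exprn_ge0 ?(ltW m0) ?(ltW m0')//.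
rewrite ler_pdivrMr ?exprn_gt0// (_ : 3 / m x * m x ^+ 2 = 3 * m x); last by field;
  rewrite gt_eqF.
lra.
Qed.

Definition barrier_quad b : R := 18 * quad_const (b / 2).
Definition barrier_lipc b : R := 3 * lip_const (b / 2).

Lemma barrier_quad_ge0 b : 0 <= b -> 0 <= barrier_quad b.
Proof. by move=> b0; rewrite mulr_ge0// quad_const_ge0// divr_ge0. Qed.

(** Only an upper bound is available at the kink [|x| = 1].  It is enough: the
    first-order terms of [powRN_quad] add up to a nonpositive multiple of a
    second difference of the convex function [max(1, |x|)^2]. *)
Lemma barrier_second_diff b x z : 0 <= b -> enorm z <= m x / 2 ->
  barrier b (x + z) + barrier b (x - z) <=
  2 * barrier b x + barrier_quad b * (barrier b x / m x ^+ 2) * enorm z ^+ 2.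
Proof.
move=> b0 zm; have b2 : 0 <= b / 2 by rewrite divr_ge0.
have m0 := max1_gt0 x; have w0 := barrier_gt0 b x; have z0 := enorm_ge0 z.
have [hp hp'] := max1_ratio zm.
have zm' : enorm (- z) <= m x / 2 by rewrite enormN.
have [hn hn'] := max1_ratio zm'; rewrite enormN in hn'.
rewrite !barrier_ratio.
have : 2 <= m (x + z) ^+ 2 / m x ^+ 2 + m (x - z) ^+ 2 / m x ^+ 2.
  by rewrite -mulrDl ler_pdivlMr ?exprn_gt0// max1_sqr_convex.
move: hp hp' hn hn'.
set tp := _ / _ ^+ 2; set tn := m (x - z) ^+ 2 / _ => hp hp' hn hn' hs.
have qp := powRN_quad b2 hp; have qn := powRN_quad b2 hn.
have Q0 := quad_const_ge0 b2.
have sq t : `|t - 1| <= 3 * enorm z / m x -> (t - 1) ^+ 2 <= 9 *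
  (enorm z ^+ 2 / m x ^+ 2).
  move=> ht; rewrite -real_normK ?num_real//.
  rewrite (_ : 9 * _ = (3 * enorm z / m x) ^+ 2); last by field; rewrite gt_eqF.
  by rewrite lerXn2r ?nnegrE// divr_ge0 ?mulr_ge0 ?(ltW m0).
have sp := ler_wpM2l Q0 (sq _ hp'); have sn := ler_wpM2l Q0 (sq _ hn').
have hs' : 0 <= (b / 2) * (tp + tn - 2) by rewrite mulr_ge0// subr_ge0.
rewrite -mulrDr (_ : _ + _ * _ * _ = barrier b x *
  (2 + 18 * (quad_const (b / 2) * (enorm z ^+ 2 / m x ^+ 2)))).
  by rewrite ler_pM2l//; clear - qp qn sp sn hs'; lra.
by rewrite /barrier_quad; ring.
Qed.

Lemma barrier_lip b x z : 0 <= b -> enorm z <= m x / 2 ->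
  `|barrier b (x + z) - barrier b x| <= barrier_lipc b * (barrier b x / m x) * enorm z.
Proof.
move=> b0 zm; have b2 : 0 <= b / 2 by rewrite divr_ge0.
have w0 := barrier_gt0 b x.
have [hp hp'] := max1_ratio zm.
rewrite barrier_ratio -[X in _ - X]mulr1 -mulrBr normrM gtr0_norm//.
rewrite (_ : barrier_lipc b * _ * _ = barrier b x *
  (lip_const (b / 2) * (3 * enorm z / m x))); last first.
  by rewrite /barrier_lipc; ring.
rewrite ler_wpM2l ?(ltW w0)//; apply: (le_trans (powRN_lip b2 hp)).
by rewrite ler_wpM2l// lip_const_ge0.
Qed.

(** The cutoff is [F(w)] for [F t = min(t, 2 (t - d)_+^2 / d)].  The two branches
    cross at [t = 2d], so [F] is the identity above [2d]; below it is a
    continuously differentiable function vanishing up to [d].  Being a minimum,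
    the cutoff inherits an upper bound on second differences from whichever
    branch is active. *)
Definition trunc d (t : R) : R := 2 * Num.max 0 (t - d) ^+ 2 / d.
Definition cutoff b d x : R := Num.min (barrier b x) (trunc d (barrier b x)).

Lemma trunc_ge0 d t : 0 < d -> 0 <= trunc d t.
Proof. by move=> d0; rewrite /trunc divr_ge0 ?(ltW d0)// mulr_ge0 ?sqr_ge0. Qed.

Lemma cutoff_ge0 b d x : 0 < d -> 0 <= cutoff b d x.
Proof. by move=> d0; rewrite le_min (ltW (barrier_gt0 _ _)) trunc_ge0. Qed.

Lemma cutoff_le b d x : cutoff b d x <= barrier b x.
Proof. by rewrite ge_min lexx. Qed.

Lemma measurable_cutoff b d : measurable_fun setT (@cutoff b d).
Proof.
by rewrite /cutoff /trunc; mfun; exact: measurable_barrier.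
Qed.

Lemma cutoff_in b d x : 0 < d -> 2 * d <= barrier b x -> cutoff b d x = barrier b x.
Proof.
move=> d0 dw; rewrite /cutoff min_l// /trunc max_r; last by lra.
rewrite ler_pdivlMr// -subr_ge0.
rewrite (_ : _ - _ = (2 * barrier b x - d) * (barrier b x - 2 * d)); last by ring.
by rewrite mulr_ge0//; lra.
Qed.

Lemma cutoff_out b d x : 0 < d -> barrier b x <= d -> cutoff b d x = 0.
Proof.
move=> d0 dw; rewrite /cutoff /trunc max_l; last by lra.
by rewrite expr0n/= mulr0 mul0r min_r// ltW// barrier_gt0.
Qed.

Lemma cutoff_trunc b d x : 0 < d -> barrier b x <= 2 * d -> cutoff b d x =
  trunc d (barrier b x).
Proof.
move=> d0 dw; rewrite /cutoff min_r// /trunc; have w0 := barrier_gt0 b x.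
have [wd|wd] := leP d (barrier b x); last first.
  by rewrite max_l ?expr0n/= ?mulr0 ?mul0r ?(ltW w0)//; lra.
rewrite max_r ?subr_ge0// ler_pdivrMr// -subr_ge0.
rewrite (_ : _ - _ = (2 * barrier b x - d) * (2 * d - barrier b x)); last by ring.
by rewrite mulr_ge0//; lra.
Qed.

(** The second derivative of [trunc d] is at most [4 / d]. *)
Lemma trunc_quad d (t a : R) : 0 < d ->
  trunc d t <= trunc d a + 4 / d * Num.max 0 (a - d) * (t - a) + 2 / d * (t - a) ^+ 2.
Proof.
move=> d0; rewrite /trunc.
rewrite (_ : _ + _ + _ = 2 * (Num.max 0 (a - d) ^+ 2 + 2 * Num.max 0 (a - d) * (t - a) +
  (t - a) ^+ 2) / d); last by ring.
rewrite ler_pM2r ?invr_gt0// ler_pM2l//.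
have [ad|ad] := leP 0 (a - d).
  rewrite (_ : _ + _ + _ = (t - d) ^+ 2); last by ring.
  by have [td|td] := leP 0 (t - d) => //; rewrite expr0n/= sqr_ge0.
rewrite expr0n/= mulr0 mul0r !add0r.
have [td|td] := leP 0 (t - d); last by rewrite expr0n/= sqr_ge0.
by rewrite lerXn2r ?nnegrE//; lra.
Qed.

Let second_diff_add (u v t k wp wn w r r' e1 e2 : R) :
  u <= t + k * (wp - w) + r -> v <= t + k * (wn - w) + r' ->
  k * (wp + wn - 2 * w) <= e1 -> r <= e2 -> r' <= e2 -> u + v <= 2 * t + (e1 + 2 * e2).
Proof. by move=> h1 h2 h3 h4 h5; lra. Qed.

Definition cutoff_quad b : R := 4 * barrier_quad b + 8 * barrier_lipc b ^+ 2.

Lemma cutoff_quad_ge0 b : 0 <= b -> 0 <= cutoff_quad b.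
Proof. by move=> b0; apply: addr_ge0; apply: mulr_ge0;
  rewrite ?barrier_quad_ge0 ?sqr_ge0. Qed.

(** Compose [trunc_quad] with the first- and second-order bounds of the barrier.
    The large curvature [4 / d] multiplies the square of an increment of size
    [w |z| / max(1, |x|)], and [w <= 2d] cancels the factor [1 / d]. *)
Lemma cutoff_second_diff b d x z : 0 <= b -> 0 < d -> barrier b x <= 2 * d ->
  enorm z <= m x / 2 ->
  cutoff b d (x + z) + cutoff b d (x - z) <=
  2 * cutoff b d x + cutoff_quad b * (barrier b x / m x ^+ 2) * enorm z ^+ 2.
Proof.
move=> b0 d0 wd zm; rewrite (cutoff_trunc d0 wd).
have zm' : enorm (- z) <= m x / 2 by rewrite enormN.
have w0 := barrier_gt0 b x; have m0 := max1_gt0 x.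
have hs := barrier_second_diff b0 zm.
have lp := barrier_lip b0 zm; have ln := barrier_lip b0 zm'; rewrite enormN in ln.
have cl y : cutoff b d y <= trunc d (barrier b y) by rewrite ge_min lexx orbT.
have tp := le_trans (cl (x + z)) (trunc_quad (barrier b (x + z)) (barrier b x) d0).
have tn := le_trans (cl (x - z)) (trunc_quad (barrier b (x - z)) (barrier b x) d0).
set k := 4 / d * Num.max 0 (barrier b x - d) in tp tn.
have k0 : 0 <= k by rewrite mulr_ge0 ?divr_ge0 ?(ltW d0)// le_max lexx.
have k4 : k <= 4.
  rewrite /k mulrAC ler_pdivrMr// ler_pM2l// ge_max (ltW d0)/= lerBlDr.
  by rewrite -mulr2n -mulr_natl.
set E := barrier b x / m x ^+ 2 * enorm z ^+ 2.
have E0 : 0 <= E by rewrite mulr_ge0 ?divr_ge0 ?sqr_ge0// ltW.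
have sq v : `|v| <= barrier_lipc b * (barrier b x / m x) * enorm z ->
    2 / d * v ^+ 2 <= 4 * barrier_lipc b ^+ 2 * E.
  move=> hv; rewrite (_ : 4 * _ * E = 2 / d * (2 * d * (barrier_lipc b ^+ 2 * E)));
    last first.
    by field; rewrite gt_eqF.
  rewrite ler_wpM2l ?divr_ge0 ?(ltW d0)//.
  apply: (@le_trans _ _ ((barrier_lipc b * (barrier b x / m x) * enorm z) ^+ 2)).
    by rewrite -real_normK ?num_real// lerXn2r ?nnegrE// (le_trans _ hv).
  rewrite (_ : _ ^+ 2 = barrier b x * (barrier_lipc b ^+ 2 * E)); last first.
    by rewrite /E; field; rewrite gt_eqF.
  by rewrite ler_wpM2r// mulr_ge0 ?sqr_ge0.
have sp := sq _ lp; have sn := sq _ ln.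
have hs' : k * (barrier b (x + z) + barrier b (x - z) - 2 * barrier b x) <= 4 *
  (barrier_quad b * E).
  apply: (@le_trans _ _ (k * (barrier_quad b * E))).
    by rewrite ler_wpM2l// lerBlDl mulrA.
  by rewrite ler_wpM2r// mulr_ge0// barrier_quad_ge0.
rewrite (_ : cutoff_quad b * _ * _ = 4 * (barrier_quad b * E) + 2 *
  (4 * barrier_lipc b ^+ 2 * E)); last first.
  by rewrite /cutoff_quad /E; ring.
exact: (second_diff_add tp tn hs' sp sn).
Qed.

End barrier_regularity.

(** * The barrier under the four growth conditions *)

Section barrier_mass.
Context (R : realType) (N : nat).
Hypothesis (N_ge1 : (1 <= N)%N).
Local Notation mu := (lebesgue_rV R N).
Implicit Types (y : 'rV[R]_N) (b g r : R).
Local Notation m x := (Num.max 1 (enorm x)).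

Definition mass b r : \bar R := (\int[mu]_y (ind (enorm y <= r) * barrier b y)%:E)%E.

Lemma barrier_le_powR b g y : 0 <= g -> g <= b -> 0 < enorm y -> barrier b y <=
  enorm y `^ (- g).
Proof.
move=> g0 gb y0; apply: (@le_trans _ _ (m y `^ (- g))).
  by rewrite ler_powR ?max1_ge1// lerN2.
by rewrite powRN_le// le_max lexx orbT.
Qed.

Lemma barrier_ge0 b y : 0 <= barrier b y.
Proof. exact/ltW/barrier_gt0. Qed.

Lemma mass_le b g r : 0 <= g -> g < N%:R -> g <= b -> 0 < r ->
  (mass b r <= (shell_mass R N / (N%:R - g) * r `^ (N%:R - g))%:E)%E.
Proof.
move=> g0 gN gb r0; have mw := @measurable_barrier R N b.
rewrite -int_radial_in// -[leRHS]adde0 -(int_origin R N_ge1) -intD; first last.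
- by move=> y; exact: ind_ge0.
- by move=> y; rewrite !mulr_ge0 ?ind_ge0 ?powR_ge0.
- by mfun.
- by mfun.
apply: le_int; [by mfun|by mfun|by move=> y; rewrite mulr_ge0 ?ind_ge0 ?barrier_ge0|].
move=> y; have [y0|y0] := ltP 0 (enorm y); last first.
  rewrite ind0 mul0r add0r ind1.
  by rewrite -[leRHS]mul1r ler_pM ?ind_ge0 ?barrier_ge0 ?ind_le1// barrier_le1//
    (le_trans g0).
rewrite ind1 mul1r ind0 addr0 ler_wpM2l ?ind_ge0//.
exact: barrier_le_powR.
Qed.

Lemma mass_fin b : N%:R < b -> exists2 V : R, 0 <= V & forall r, (mass b r <= V%:E)%E.
Proof.
move=> Nb; have mw := @measurable_barrier R N b.
have b0 : 0 <= b by apply: ltW; apply: le_lt_trans Nb.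
have V1 : (\int[mu]_y (ind (enorm y <= 1))%:E)%E \is a fin_num.
  rewrite ge0_fin_numE; first exact: int_ball_fin.
  by apply: int_ge0 => y; exact: ind_ge0.
exists (fine (\int[mu]_y (ind (enorm y <= 1))%:E)%E + shell_mass R N / (b - N%:R)).
  rewrite addr_ge0 ?divr_ge0 ?shell_mass_ge0 ?subr_ge0 ?(ltW Nb)//.
  by apply/fine_ge0/int_ge0 => y; exact: ind_ge0.
move=> r; rewrite EFinD fineK//.
have -> : (shell_mass R N / (b - N%:R))%:E =
  (\int[mu]_y (ind (1 <= enorm y) * enorm y `^ (- b))%:E)%E.
  by rewrite int_radial_out// powR1 mulr1.
rewrite -intD; first last.
- by move=> y; rewrite mulr_ge0 ?ind_ge0 ?powR_ge0.
- by move=> y; exact: ind_ge0.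
- by mfun.
- by mfun.
apply: le_int; [by mfun|by mfun|by move=> y; rewrite mulr_ge0 ?ind_ge0 ?barrier_ge0|].
move=> y; apply: (@le_trans _ _ (barrier b y)).
  by rewrite -[leRHS]mul1r ler_wpM2r ?barrier_ge0 ?ind_le1.
have [y1|y1] := leP (enorm y) 1.
  rewrite ind1; apply: (le_trans (barrier_le1 _ b0)).
  by rewrite lerDl mulr_ge0 ?ind_ge0 ?powR_ge0.
rewrite ind0 add0r (ltW y1) ind1 mul1r.
by apply: barrier_le_powR => //; exact: lt_trans y1.
Qed.

End barrier_mass.

Section growth_conditions.
Context (R : realType) (N : nat) (s alpha beta : R).
Hypotheses (N_ge1 : (1 <= N)%N) (s_gt0 : 0 < s) (s_lt1 : s < 1)
  (alpha_ge0 : 0 <= alpha) (beta_gt0 : 0 < beta).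
Local Notation mu := (lebesgue_rV R N).
Local Notation q := (N%:R + 2 * s).
Local Notation m x := (Num.max 1 (enorm x)).
Implicit Types (x y z : 'rV[R]_N) (r d eps : R).

Let beta_ge0 : 0 <= beta. Proof. exact: ltW. Qed.

Let conditions :=
  [\/ 0 < beta <= N%:R - 2 * s /\ alpha <= 2,
      N%:R - 2 * s < beta < N%:R /\ alpha <= 2 * s,
      beta = N%:R /\ alpha < 2 * s
    | N%:R < beta /\ alpha + beta <= 2 * s + N%:R].

Let strong_conditions :=
  [\/ N%:R - 2 * s < beta < N%:R /\ alpha <= 2 * s,
      beta = N%:R /\ alpha < 2 * s
    | N%:R < beta /\ alpha + beta <= 2 * s + N%:R].

(** The long jumps from [x] contribute [|x|^(-q)] times the mass of the barrier in
    the ball of radius [|x|].  This growth of the mass makes the contribution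
    at most [|x|^(-alpha) w]. *)
Lemma mass_strong : strong_conditions -> exists2 M : R, 0 <= M &
  forall r, 1 <= r -> (mass N beta r <= (M * r `^ (q - alpha - beta))%:E)%E.
Proof.
have N1 : 1 <= N%:R :> R by rewrite ler1n.
have s0 := s_gt0; have s1 := s_lt1; have b0 := beta_gt0.
have gen g : 0 <= g -> g < N%:R -> g <= beta -> N%:R - g <= q - alpha - beta ->
    exists2 M : R, 0 <= M & forall r,
      1 <= r -> (mass N beta r <= (M * r `^ (q - alpha - beta))%:E)%E.
  move=> g0 gN gb ge; exists (shell_mass R N / (N%:R - g)).
    by rewrite divr_ge0 ?shell_mass_ge0// subr_ge0 ltW.
  move=> r r1; have r0 : 0 < r by exact: lt_le_trans r1.
  apply: (le_trans (mass_le N_ge1 g0 gN gb r0)).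
  rewrite lee_fin ler_wpM2l//; last by rewrite ler_powR.
  by rewrite divr_ge0 ?shell_mass_ge0// subr_ge0 ltW.
case.
- move=> [/andP[_ bN] a2]; apply: (gen beta) => //.
  by lra.
(* At [beta = N] the mass grows logarithmically, which is absorbed by a small
   loss in the exponent; [alpha < 2 * s] leaves room for it. *)
- move=> [bN a2]; apply: (gen (N%:R - (2 * s - alpha) / 2)).
  + by have := alpha_ge0; lra.
  + by lra.
  + by lra.
  + by lra.
- move=> [bN ab]; have [V V0 hV] := mass_fin bN.
  exists V => // r r1; apply: (le_trans (hV r)); rewrite lee_fin ler_peMr//.
  rewrite -[leLHS](powRr0 r) ler_powR//.
  by lra.
Qed.

Lemma beta_le_q : conditions -> beta <= q.
Proof.
have := s_gt0; have := alpha_ge0 => ha hs.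
by case => -[+ +]; [move=> /andP[_ h1] h2|move=> /andP[_ h1] h2|move=> h1 h2|move=>
  h1 h2];
  lra.
Qed.

(** Outside of the region where the cutoff agrees with the barrier, an error of
    the order of [w] itself is acceptable; for this, less decay is required and
    all four conditions suffice. *)
Lemma mass_weak : conditions -> exists2 M : R, 0 <= M &
  forall r, 1 <= r -> (mass N beta r <= (M * r `^ (q - beta))%:E)%E.
Proof.
have weaken : strong_conditions -> exists2 M : R, 0 <= M &
    forall r, 1 <= r -> (mass N beta r <= (M * r `^ (q - beta))%:E)%E.
  move=> /mass_strong[M M0 hM]; exists M => // r r1; apply: (le_trans (hM r r1)).
  rewrite lee_fin ler_wpM2l// ler_powR//.
  by have ha := alpha_ge0; lra.
case=> [[/andP[_ bN] _]|h|h|h]; [|apply: weaken; constructor 1; exact: h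
  |apply: weaken; constructor 2; exact: h|apply: weaken; constructor 3; exact: h].
have hs := s_gt0.
have bN' : beta < N%:R by lra.
exists (shell_mass R N / (N%:R - beta)).
  by rewrite divr_ge0 ?shell_mass_ge0// subr_ge0 ltW.
move=> r r1; have r0 : 0 < r by exact: lt_le_trans r1.
apply: (le_trans (mass_le N_ge1 (ltW beta_gt0) bN' (lexx _) r0)).
rewrite lee_fin ler_wpM2l//.
  by rewrite divr_ge0 ?shell_mass_ge0// subr_ge0 ltW.
by rewrite ler_powR//; lra.
Qed.

Let near_far_add (a b u v w : R) : b <= u * w -> a + b + v * w <= a + (u + v) * w.
Proof. by move=> h; rewrite mulrDl addrA lerD2r lerD2l. Qed.

Lemma near_scale x : (m x / 2) `^ (2 - 2 * s) / m x ^+ 2 <= m x `^ (- (2 * s)).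
Proof.
have m0 := max1_gt0 x.
rewrite ler_pdivrMr ?exprn_gt0// -powR_mulrn ?(ltW m0)// -powRD;
  last by rewrite (gt_eqF m0) implybT.
rewrite (_ : - (2 * s) + 2%:R = 2 - 2 * s); last by rewrite addrC.
apply: ge0_ler_powR; rewrite ?nnegrE ?divr_ge0 ?(ltW m0)//.
  by have := s_lt1 => h; rewrite subr_ge0; lra.
by rewrite ler_pdivrMr// ler_peMr ?(ltW m0)// ler1n.
Qed.

Lemma far_scale x : (m x / 2) `^ (- q) = 2 `^ q * m x `^ (- q).
Proof.
rewrite powRM ?invr_ge0 ?(ltW (max1_gt0 _))// mulrC; congr (_ * _).
by rewrite -powR_inv1// -powRrM mulN1r opprK.
Qed.

(** When [beta <= N - 2 * s] the barrier is superharmonic and there is no error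
    term.  In the other cases, jumps are short or long according to
    [max(1, |x|) / 2]: points [y] with [w y > w x] lie in the ball of radius
    [max(1, |x|)], so only the mass in that ball matters for the long jumps. *)
Lemma barrier_Kop : conditions -> exists2 C : R, 0 <= C & forall eps x, 0 < eps ->
  (Kop s eps (barrier beta) x <=
   (kmass N s eps * barrier beta x + C * (m x `^ (- alpha) * barrier beta x))%:E)%E.
Proof.
have strong : strong_conditions -> alpha <= 2 * s -> exists2 C : R,
  0 <= C & forall eps x, 0 < eps ->
  (Kop s eps (barrier beta) x <=
   (kmass N s eps * barrier beta x + C * (m x `^ (- alpha) * barrier beta x))%:E)%E.
  move=> /mass_strong[M M0 hM] a2.
  have C1 : 0 <= barrier_quad beta *
    near_const N s by rewrite mulr_ge0 ?barrier_quad_ge0 ?near_const_ge0.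
  exists (barrier_quad beta * near_const N s + 2 `^ q * M) => [|eps x e0].
    by rewrite addr_ge0// mulr_ge0 ?powR_ge0.
  have m0 := max1_gt0 x; have w0 := barrier_gt0 beta x.
  have mw := @measurable_barrier R N beta.
  pose H y : R := ind (enorm y <= m x) * barrier beta y.
  have mH : measurable_fun setT H by rewrite /H; mfun.
  have H0 y : 0 <= H y by rewrite mulr_ge0 ?ind_ge0 ?barrier_ge0.
  have A0 : 0 <= barrier_quad beta * (barrier beta x / m x ^+ 2).
    by rewrite mulr_ge0 ?barrier_quad_ge0// divr_ge0 ?exprn_ge0 ?ltW.
  have r0 : 0 < m x / 2 by rewrite divr_gt0.
  have fH y : barrier beta y <= barrier beta x + H y.
    rewrite /H; have [ym|ym] := leP (enorm y) (m x);
      first by rewrite ind1 mul1r lerDr ltW.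
    rewrite ind0 mul0r addr0 powRN_le//.
    by rewrite le_max (ltW ym) orbT.
  have := Kop_le s_gt0 s_lt1 e0 r0 A0 mw (@barrier_ge0 _ _ beta) mH H0
    (fun z zr => barrier_second_diff beta_ge0 zr) fH.
  move=> h; apply: (le_trans h) => {h}.
  have near : barrier_quad beta * (barrier beta x / m x ^+ 2) * near_const N s *
    (m x / 2) `^ (2 - 2 * s) <=
      barrier_quad beta * near_const N s * (m x `^ (- alpha) * barrier beta x).
    rewrite [leLHS](_ : _ = barrier_quad beta * near_const N s *
      ((m x / 2) `^ (2 - 2 * s) / m x ^+ 2 * barrier beta x)); last by ring.
    rewrite ler_wpM2l// ler_wpM2r ?(ltW w0)//; apply: (le_trans (near_scale x)).
    by rewrite ler_powR ?max1_ge1// lerN2.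
  have far : (((m x / 2) `^ (- q))%:E * (\int[mu]_y (H y)%:E)%E <=
      (2 `^ q * M * (m x `^ (- alpha) * barrier beta x))%:E)%E.
    apply: (@le_trans _ _ (((m x / 2) `^ (- q))%:E *
      (M * m x `^ (q - alpha - beta))%:E)%E).
      by rewrite lee_wpmul2l ?lee_fin ?powR_ge0// hM// max1_ge1.
    rewrite -EFinM lee_fin far_scale -!mulrA ler_wpM2l ?powR_ge0// mulrCA ler_wpM2l//.
    have mD a b : m x `^ (a + b) = m x `^ a * m x `^ b by rewrite powRD//
      (gt_eqF m0) implybT.
    by rewrite /barrier -!mD; rewrite (_ : - q + (q - alpha - beta) = - alpha - beta)//;
      ring.
  apply: (le_trans (leeD (lexx _) far)).
  by rewrite -EFinD lee_fin; exact: near_far_add.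
case.
- move=> [/andP[_ bN] _]; exists 0 => // eps x e0.
  by rewrite mul0r addr0; apply: barrier_superharmonic.
- by move=> h; apply: strong; [constructor 1|case: h].
- by move=> h; apply: strong; [constructor 2|case: h => _ /ltW].
- move=> h; apply: strong; first by constructor 3.
  by case: h => h1 h2; lra.
Qed.

(** The cutoff is not superharmonic near its edge.  All its mass is in the ball
    of radius [d^(-1/beta)], which is comparable to [max(1, |x|)] or smaller
    because [w x <= 2d]. *)
Lemma cutoff_Kop : conditions -> exists2 C : R, 0 <= C & forall eps d x, 0 < eps ->
  0 < d -> d <= 1 -> barrier beta x <= 2 * d ->
  (Kop s eps (cutoff beta d) x <=
   (kmass N s eps * cutoff beta d x + C * barrier beta x)%:E)%E.
Proof.
move=> cond; have [M M0 hM] := mass_weak cond; have bq := beta_le_q cond.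
have C1 : 0 <= cutoff_quad beta *
  near_const N s by rewrite mulr_ge0 ?cutoff_quad_ge0 ?near_const_ge0.
pose c2 : R := (2 `^ beta^-1) `^ (q - beta).
exists (cutoff_quad beta * near_const N s + 2 `^ q * (M * c2)) =>
  [|eps d x e0 d0 d1 wd].
  by rewrite addr_ge0// !mulr_ge0 ?powR_ge0.
have m0 := max1_gt0 x; have w0 := barrier_gt0 beta x.
have mw := @measurable_barrier R N beta.
have mH := @measurable_cutoff R N beta d.
have H0 y := @cutoff_ge0 R N beta d y d0.
have A0 : 0 <= cutoff_quad beta * (barrier beta x / m x ^+ 2).
  by rewrite mulr_ge0 ?cutoff_quad_ge0// divr_ge0 ?exprn_ge0 ?ltW.
have r0 : 0 < m x / 2 by rewrite divr_gt0.
have fH y : cutoff beta d y <= cutoff beta d x + cutoff beta d y by rewrite lerDr.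
have := Kop_le s_gt0 s_lt1 e0 r0 A0 mH H0 mH H0
  (fun z zr => cutoff_second_diff beta_ge0 d0 wd zr) fH.
move=> h; apply: (le_trans h) => {h}.
have near : cutoff_quad beta * (barrier beta x / m x ^+ 2) * near_const N s *
  (m x / 2) `^ (2 - 2 * s) <=
    cutoff_quad beta * near_const N s * barrier beta x.
  rewrite [leLHS](_ : _ = cutoff_quad beta * near_const N s *
    ((m x / 2) `^ (2 - 2 * s) / m x ^+ 2 * barrier beta x)); last by ring.
  rewrite ler_wpM2l// -[leRHS]mul1r ler_wpM2r ?(ltW w0)//;
    apply: (le_trans (near_scale x)).
  by rewrite -[leRHS](powRr0 (m x)) ler_powR ?max1_ge1// oppr_le0 mulr_ge0// ltW.
(* [barrier beta] takes the value [d] at the radius [rd]. *)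
pose rd := d `^ (- beta^-1).
have bV : beta^-1 * beta = 1 by rewrite mulVf// gt_eqF.
have rdb : rd `^ (- beta) = d by rewrite -powRrM mulrNN bV powRr1// ltW.
have rd0 : 0 < rd by exact: powR_gt0.
have rd1 : 1 <= rd.
  have -> : 1 = 1 `^ (- beta^-1) :> R by rewrite powR1.
  by rewrite powRN_le// invr_ge0.
have int_cut : (\int[mu]_y (cutoff beta d y)%:E <= (M * rd `^ (q - beta))%:E)%E.
  apply: le_trans (hM _ rd1); apply: le_int => //; first by mfun.
  move=> y; have [yr|yr] := leP (enorm y) rd; first by rewrite ind1 mul1r cutoff_le.
  rewrite ind0 mul0r cutoff_out// -rdb powRN_le//.
  by rewrite le_max (ltW yr) orbT.
have rdm : rd <= 2 `^ beta^-1 * m x.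
  have h1 : d^-1 <= 2 * m x `^ beta.
    rewrite -ler_pdivrMl// -invfM; move: wd;
      rewrite /barrier powRN -lef_pV2 ?posrE ?invr_gt0 ?mulr_gt0 ?powR_gt0//.
    by rewrite invrK.
  have -> : m x = (m x `^ beta) `^ beta^-1 by rewrite -powRrM mulrC bV powRr1// ltW.
  rewrite -powRM ?powR_ge0//.
  have -> : rd = d^-1 `^ beta^-1 by rewrite -powR_inv1 ?(ltW d0)// -powRrM mulN1r.
  by rewrite ge0_ler_powR ?nnegrE ?invr_ge0 ?mulr_ge0 ?powR_ge0// ltW.
have far : (((m x / 2) `^ (- q))%:E * (\int[mu]_y (cutoff beta d y)%:E)%E <=
    (2 `^ q * (M * c2) * barrier beta x)%:E)%E.
  apply: (@le_trans _ _ (((m x / 2) `^ (- q))%:E *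
    (M * (2 `^ beta^-1 * m x) `^ (q - beta))%:E)%E).
    rewrite lee_wpmul2l ?lee_fin ?powR_ge0//; apply: (le_trans int_cut);
      rewrite lee_fin ler_wpM2l//.
    by rewrite ge0_ler_powR ?subr_ge0// nnegrE ?mulr_ge0 ?powR_ge0 ?ltW.
  rewrite -EFinM lee_fin far_scale powRM ?powR_ge0 ?(ltW m0)// -/c2.
  have mD a b : m x `^ (a + b) = m x `^ a * m x `^ b by rewrite powRD//
    (gt_eqF m0) implybT.
  rewrite [leLHS](_ : _ = 2 `^ q * (M * c2) * (m x `^ (- q) * m x `^ (q - beta)));
    last by ring.
  by rewrite -mD /barrier (_ : - q + (q - beta) = - beta)//; ring.
apply: (le_trans (leeD (lexx _) far)).
by rewrite -EFinD lee_fin; exact: near_far_add.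
Qed.

End growth_conditions.

(** * The discretized operator *)

Section discrete_operator.
Context (R : realType) (N : nat) (s c : R).
Hypotheses (c_ge0 : 0 <= c).
Local Notation mu := (lebesgue_rV R N).
Implicit Types (f W phi : 'rV[R]_N -> R) (h : R) (x : 'rV[R]_N).

(** Without the value at the centre, the sum of the centred second differences is
    a positivity-preserving operator, like [Kop]; [Pmass] collects the
    coefficients of the removed central values. *)
Definition Dop h f x : R :=
  \sum_(i < N) h ^- 2 * (f (x + h *: 'e_i) + f (x - h *: 'e_i)).

Definition Pop h f x : \bar R := ((Dop h f x)%:E + c%:E * Kop s h f x)%E.

Definition Pmass h : R := 2 * N%:R * h ^- 2 + c * kmass N s h.

Lemma Dop_ge0 h f x : (forall x, 0 <= f x) -> 0 <= Dop h f x.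
Proof.
move=> f0; apply: sumr_ge0 => i _.
by rewrite mulr_ge0 ?addr_ge0// invr_ge0 sqr_ge0.
Qed.

Lemma measurable_Dop h f : measurable_fun setT f -> measurable_fun setT (Dop h f).
Proof.
move=> mf; apply: measurable_sum => i; mfun.
  by apply: (measurableT_comp mf); mfun.
by apply: (measurableT_comp mf); mfun.
Qed.

Lemma Pop_ge0 h f x : (forall x, 0 <= f x) -> (0 <= Pop h f x)%E.
Proof.
by move=> f0; rewrite adde_ge0 ?lee_fin ?Dop_ge0// mule_ge0 ?lee_fin ?Kop_ge0.
Qed.

Lemma measurable_Pop h f : measurable_fun setT f -> (forall x, 0 <= f x) ->
  measurable_fun setT (Pop h f).
Proof.
move=> mf f0; apply: emeasurable_funD.
  by apply/measurable_EFinP; exact: measurable_Dop.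
by apply: emeasurable_funM; [exact: measurable_cst|exact: measurable_Kop].
Qed.

Lemma le_Pop h f g x : measurable_fun setT f -> measurable_fun setT g ->
  (forall x, 0 <= f x) -> (forall x, f x <= g x) -> (Pop h f x <= Pop h g x)%E.
Proof.
move=> mf mg f0 fg; apply: leeD.
  rewrite lee_fin; apply: ler_sum => i _.
  by rewrite ler_wpM2l ?lerD// invr_ge0 sqr_ge0.
by apply: lee_wpmul2l; [rewrite lee_fin|exact: le_Kop].
Qed.

Lemma Dop_le h f x (A : R) : 0 < h ->
  (forall z, enorm z = h -> f (x + z) + f (x - z) <= 2 * f x + A * enorm z ^+ 2) ->
  Dop h f x <= 2 * N%:R * h ^- 2 * f x + N%:R * A.
Proof.
move=> h0 fA; apply: (@le_trans _ _ (\sum_(i < N) (2 * h ^- 2 * f x + A))).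
  apply: ler_sum => i _.
  have eh : enorm (h *: 'e_i : 'rV[R]_N) =
    h by rewrite enormZ enorm_delta mulr1 gtr0_norm.
  rewrite mulrC ler_pdivrMr ?exprn_gt0//; apply: (le_trans (fA _ eh)); rewrite eh.
  rewrite le_eqVlt; apply/orP; left; apply/eqP; field.
  by rewrite gt_eqF.
by rewrite sumr_const card_ord -[leLHS]mulr_natl le_eqVlt; apply/orP; left; apply/eqP;
  ring.
Qed.

Lemma int_shift_sym z W phi : measurable_fun setT W -> (forall x, 0 <= W x) ->
  measurable_fun setT phi -> (forall x, 0 <= phi x) ->
  (\int[mu]_x (W x * phi (x + z)%R)%:E = \int[mu]_x (phi x * W (x - z)%R)%:E)%E.
Proof.
move=> mW W0 mp p0; rewrite -[RHS](int_shift z).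
- by apply: eq_integral => x _; rewrite addrK mulrC.
- by mfun; apply: (measurableT_comp mW); mfun.
- by move=> x; rewrite mulr_ge0.
Qed.

(** Exchanging [W] and [phi] exchanges the neighbours [x + h e_i] and
    [x - h e_i]. *)
Lemma int_Dop_sym h W phi : measurable_fun setT W -> (forall x, 0 <= W x) ->
  measurable_fun setT phi -> (forall x, 0 <= phi x) ->
  (\int[mu]_x (W x * Dop h phi x)%:E = \int[mu]_x (phi x * Dop h W x)%:E)%E.
Proof.
move=> mW W0 mp p0.
have expand (U V : 'rV[R]_N -> R) : measurable_fun setT U -> (forall x, 0 <= U x) ->
    measurable_fun setT V -> (forall x, 0 <= V x) ->
    (\int[mu]_x (U x * Dop h V x)%:E = \sum_(i < N) (h ^- 2)%:E *
      (\int[mu]_x (U x * V (x + h *: 'e_i)%R)%:E +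
        \int[mu]_x (U x * V (x - h *: 'e_i)%R)%:E))%E.
  move=> mU U0 mV V0.
  have mS (z : 'rV[R]_N) : measurable_fun setT (fun x => U x * V (x + z)).
    by mfun; apply: (measurableT_comp mV); mfun.
  have h2 : 0 <= h ^- 2 by rewrite invr_ge0 sqr_ge0.
  under eq_integral do rewrite mulr_sumr -sumEFin.
  rewrite ge0_integral_sum//; first last.
  - by move=> i x _; rewrite lee_fin !mulr_ge0 ?addr_ge0.
  - move=> i; apply/measurable_EFinP; rewrite /=.
    by mfun; apply: (measurableT_comp mV); mfun.
  apply: eq_bigr => i _; rewrite -intD; first last.
  - by move=> x; rewrite mulr_ge0.
  - by move=> x; rewrite mulr_ge0.
  - exact: mS.
  - exact: mS.
  rewrite -intZ//; first last.
  - by move=> x; rewrite addr_ge0 ?mulr_ge0.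
  - by apply: measurable_funD; exact: mS.
  by apply: eq_integral => x _; congr EFin; ring.
rewrite !expand//; apply: eq_bigr => i _; congr (_ * _)%E.
rewrite addeC; congr (_ + _)%E; last exact: int_shift_sym.
by have := int_shift_sym (- (h *: 'e_i)) mW W0 mp p0; rewrite opprK.
Qed.

Lemma int_Pop_sym h W phi : measurable_fun setT W -> (forall x, 0 <= W x) ->
  measurable_fun setT phi -> (forall x, 0 <= phi x) ->
  (\int[mu]_x ((W x)%:E * Pop h phi x) = \int[mu]_x ((phi x)%:E * Pop h W x))%E.
Proof.
move=> mW W0 mp p0.
have expand (U V : 'rV[R]_N -> R) : measurable_fun setT U -> (forall x, 0 <= U x) ->
    measurable_fun setT V -> (forall x, 0 <= V x) ->
    (\int[mu]_x ((U x)%:E * Pop h V x) = \int[mu]_x (U x * Dop h V x)%:E +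
      c%:E * \int[mu]_x ((U x)%:E * Kop s h V x))%E.
  move=> mU U0 mV V0.
  have mK := @measurable_Kop R N s h V mV V0.
  have mUK : measurable_fun setT (fun x => (U x)%:E * Kop s h V x)%E.
    by apply: emeasurable_funM => //; exact/measurable_EFinP.
  have UK0 x : (0 <= (U x)%:E * Kop s h V x)%E by rewrite mule_ge0 ?lee_fin ?Kop_ge0.
  rewrite -ge0_integralZl ?lee_fin//.
  rewrite -ge0_integralD//; first last.
  - by apply: emeasurable_funM => //; exact: measurable_cst.
  - by move=> x _; rewrite mule_ge0 ?lee_fin.
  - by apply/measurable_EFinP; apply: measurable_funM => //; exact: measurable_Dop.
  - by move=> x _; rewrite lee_fin mulr_ge0 ?Dop_ge0.
  apply: eq_integral => x _; rewrite /Pop ge0_muleDr ?lee_fin ?Dop_ge0//.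
    by rewrite -EFinM muleCA.
  by rewrite mule_ge0 ?lee_fin ?Kop_ge0.
rewrite (expand _ _ mW W0 mp p0) (expand _ _ mp p0 mW W0).
rewrite (int_Dop_sym h mW W0 mp p0).
by congr (_ + _ * _)%E; exact: Kop_sym.
Qed.

End discrete_operator.

Section cutoff_supersolution.
Context (R : realType) (N : nat) (s alpha beta C0 c : R).
Hypotheses (N_ge1 : (1 <= N)%N) (s_gt0 : 0 < s) (s_lt1 : s < 1)
  (alpha_ge0 : 0 <= alpha) (beta_gt0 : 0 < beta) (C0_gt0 : 0 < C0) (c_ge0 : 0 <= c).
Local Notation m x := (Num.max 1 (enorm x)).

Let conditions :=
  [\/ 0 < beta <= N%:R - 2 * s /\ alpha <= 2,
      N%:R - 2 * s < beta < N%:R /\ alpha <= 2 * s,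
      beta = N%:R /\ alpha < 2 * s
    | N%:R < beta /\ alpha + beta <= 2 * s + N%:R].

Lemma alpha_le2 : conditions -> alpha <= 2.
Proof.
have h := s_lt1.
by case => [[//]|[_]|[_]|[]] *; lra.
Qed.

Definition rho_min (x : 'rV[R]_N) : R := C0 * (1 + enorm x ^+ 2) `^ (- (alpha / 2)).

(** Since [1 + |x|^2 <= 2 max(1, |x|)^2]. *)
Lemma max1_rho_min x : m x `^ (- alpha) <= 2 `^ (alpha / 2) / C0 * rho_min x.
Proof.
rewrite /rho_min mulrA divfK ?gt_eqF//.
have m0 := max1_gt0 x; have a2 : 0 <= alpha / 2 by rewrite divr_ge0.
have -> : m x `^ (- alpha) = (m x ^+ 2) `^ (- (alpha / 2)).
  by rewrite -powR_mulrn ?(ltW m0)// -powRrM; congr (_ `^ _); field.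
have -> : 2 `^ (alpha / 2) = 2^-1 `^ (- (alpha / 2)).
  by rewrite -powR_inv1// -powRrM mulN1r opprK.
rewrite -powRM ?invr_ge0 ?addr_ge0 ?sqr_ge0//.
apply: powRN_le => //; first by rewrite mulr_gt0 ?invr_gt0// ltr_wpDr ?sqr_ge0.
have m1 := max1_ge1 x.
have h1 : 1 <= m x ^+ 2 by rewrite -[leLHS](expr1n _ 2) lerXn2r ?nnegrE ?(ltW m0).
have h2 : enorm x ^+ 2 <= m x ^+ 2.
  by rewrite lerXn2r ?nnegrE ?enorm_ge0 ?(ltW m0)// le_max lexx orbT.
by lra.
Qed.

(** The error in the supersolution inequality of the cutoff: where the cutoff
    agrees with the barrier it is absorbed by the zeroth-order term; elsewhere
    it lives on a set that escapes to infinity as [d] tends to [0]. *)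
Definition remainder (L C d : R) (x : 'rV[R]_N) : R :=
  ind (2 * d <= barrier beta x) * (L * (rho_min x * barrier beta x)) +
  ind (barrier beta x < 2 * d) * (C * barrier beta x).

(** Where [w >= 2d], the cutoff touches [w] from below at [x], so [Pop] only
    increases when the cutoff is replaced by [w].  Where [w < 2d], the direct
    estimates of the cutoff apply.  Steps [h <= 1/2] are in the range
    [max(1, |x|) / 2] of the second-difference bounds. *)
Lemma Pop_cutoff : conditions -> exists L C : R, [/\ 0 < L, 0 <= C &
  forall h d x, 0 < h -> h <= 2^-1 -> 0 < d -> d <= 1 ->
  (Pop s c h (cutoff beta d) x <=
   (Pmass N s c h * cutoff beta d x + remainder L C d x)%:E)%E].
Proof.
move=> cond; have a2 := alpha_le2 cond; have b0 := ltW beta_gt0.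
have [C1 C10 hC1] := barrier_Kop N_ge1 s_gt0 s_lt1 alpha_ge0 beta_gt0 cond.
have [C2 C20 hC2] := cutoff_Kop N_ge1 s_gt0 s_lt1 alpha_ge0 beta_gt0 cond.
pose A := N%:R * barrier_quad beta + c * C1.
have A0 : 0 <= A by apply: addr_ge0; apply: mulr_ge0 => //; exact: barrier_quad_ge0.
(* The summand [1] makes the constant positive. *)
exists (A * (2 `^ (alpha / 2) / C0) + 1), (N%:R * cutoff_quad beta + c * C2); split.
- by rewrite ltr_wpDl// mulr_ge0// divr_ge0 ?powR_ge0// ltW.
- by apply: addr_ge0; apply: mulr_ge0 => //; exact: cutoff_quad_ge0.
move=> h d x h0 h2 d0 d1.
have m0 := max1_gt0 x; have w0 := barrier_gt0 beta x; have m1 := max1_ge1 x.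
have mw := @measurable_barrier R N beta.
have mcut := @measurable_cutoff R N beta d.
have hm (z : 'rV[R]_N) : enorm z = h -> enorm z <= m x / 2.
  by move=> ->; apply: (le_trans h2); rewrite ler_pdivlMr// mulVf.
have [wd|wd] := leP (2 * d) (barrier beta x).
  apply: le_trans (le_Pop s c_ge0 h x mcut mw (fun y => cutoff_ge0 beta y d0)
    (cutoff_le beta d)) _.
  rewrite (cutoff_in d0 wd) /remainder wd (ltNge (barrier _ _)) wd ind1 ind0 mul1r mul0r
    addr0.
  have D := Dop_le h0 (fun z zh => barrier_second_diff b0 (hm z zh)).
  have K := hC1 h x h0.
  have K' : (c%:E * Kop s h (barrier beta) x <=
    (c * (kmass N s h * barrier beta x + C1 *
    (m x `^ (- alpha) * barrier beta x)))%:E)%E.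
    by rewrite EFinM lee_wpmul2l ?lee_fin.
  apply: (le_trans (leeD (_ : (_ <=
    (2 * N%:R * h ^- 2 * barrier beta x + N%:R *
    (barrier_quad beta * (barrier beta x / m x ^+ 2)))%:E)%E) K')).
    by rewrite lee_fin.
  rewrite -EFinD lee_fin.
  have m2 : barrier beta x / m x ^+ 2 <= m x `^ (- alpha) * barrier beta x.
    rewrite mulrC ler_wpM2r ?(ltW w0)// -powR_mulrn ?(ltW m0)// -powRN.
    by rewrite ler_powR// lerN2.
  have ma : A * (m x `^ (- alpha) * barrier beta x) <=
    (A * (2 `^ (alpha / 2) / C0) + 1) * (rho_min x * barrier beta x).
    rewrite [leRHS]mulrDl -[A * _ * _]mulrA [2 `^ _ / _ * (_ * _)]mulrA.
    apply: ler_wpDr; first by rewrite mul1r mulr_ge0 ?(ltW w0)//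
      mulr_ge0 ?powR_ge0 ?ltW.
    by rewrite ler_wpM2l// ler_wpM2r ?(ltW w0)// max1_rho_min.
  have bm2 : N%:R * (barrier_quad beta * (barrier beta x / m x ^+ 2)) <= N%:R *
    barrier_quad beta * (m x `^ (- alpha) * barrier beta x).
    by rewrite mulrA ler_wpM2l// mulr_ge0 ?barrier_quad_ge0.
  apply: (@le_trans _ _ (Pmass N s c h * barrier beta x + A *
    (m x `^ (- alpha) * barrier beta x))); last by rewrite lerD2l.
  apply: (@le_trans _ _ (2 * N%:R * h ^- 2 * barrier beta x + N%:R * barrier_quad beta *
    (m x `^ (- alpha) * barrier beta x) +
     c * (kmass N s h * barrier beta x + C1 * (m x `^ (- alpha) * barrier beta x)))).
    by rewrite lerD2r lerD2l.
  by rewrite le_eqVlt /Pmass /A; apply/orP; left; apply/eqP; ring.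
rewrite /remainder wd (leNgt _ (barrier _ _)) wd ind1 ind0 mul1r mul0r add0r.
have D := Dop_le h0 (fun z zh => cutoff_second_diff b0 d0 (ltW wd) (hm z zh)).
have K := hC2 h d x h0 d0 d1 (ltW wd).
have K' : (c%:E * Kop s h (cutoff beta d) x <=
  (c * (kmass N s h * cutoff beta d x + C2 * barrier beta x))%:E)%E.
  by rewrite EFinM lee_wpmul2l ?lee_fin.
apply: (le_trans (leeD (_ : (_ <=
  (2 * N%:R * h ^- 2 * cutoff beta d x + N%:R *
  (cutoff_quad beta * (barrier beta x / m x ^+ 2)))%:E)%E) K')).
  by rewrite lee_fin.
rewrite -EFinD lee_fin.
have m2 : barrier beta x / m x ^+ 2 <= barrier beta x.
  by rewrite ler_pdivrMr ?exprn_gt0// ler_peMr ?(ltW w0)// exprn_ege1.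
apply: (@le_trans _ _ (2 * N%:R * h ^- 2 * cutoff beta d x + N%:R *
  (cutoff_quad beta * barrier beta x) +
   c * (kmass N s h * cutoff beta d x + C2 * barrier beta x))).
  by rewrite lerD2r lerD2l ler_wpM2l// ler_wpM2l// cutoff_quad_ge0.
by rewrite le_eqVlt /Pmass; apply/orP; left; apply/eqP; ring.
Qed.

End cutoff_supersolution.

(** * Second differences of twice continuously differentiable functions *)

Section calculus.
Context (R : realType) (N : nat).
Implicit Types (f u : 'rV[R]_N -> R) (x y z a : 'rV[R]_N) (r t : R).

Lemma is_derive_line f x v t : derivable f (x + t *: v) v ->
  is_derive t 1 (fun r => f (x + r *: v)) ('D_v f (x + t *: v)).
Proof.
move=> df.
have E : (fun h : R => h^-1 *:
  (((fun r => f (x + r *: v)) \o shift t) (h *: 1) - f (x + t *: v)))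
       = (fun h : R => h^-1 *: ((f \o shift (x + t *: v)) (h *: v) - f (x + t *: v))).
  apply/funext => h /=; congr (_ *: (f _ - _)).
  by rewrite [h *: 1]mulr1 scalerDl addrCA.
by apply: DeriveDef; rewrite /derivable /derive E.
Qed.

Lemma mvt_line f x v t : (forall a, derivable f a v) ->
  exists2 r, `|r| <= `|t| & f (x + t *: v) - f x = t * 'D_v f (x + r *: v).
Proof.
move=> df.
have dl a r : is_derive r 1 (fun r => f (a + r *: v)) ('D_v f (a + r *: v)).
  exact: is_derive_line.
have dc (a b : R) : {within `[a, b], continuous (fun r => f (x + r *: v))}.
  by apply: derivable_within_continuous => r _; case: (dl x r).
have dx (a b : R) r (_ : r \in `]a, b[%R) := dl x r.
have [t0|t0] := leP 0 t.
  have [c] := MVT_segment t0 (@dx 0 t) (@dc 0 t).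
  rewrite in_itv/= scale0r addr0 subr0 mulrC => /andP[c0 ct] E; exists c => //.
  by rewrite !ger0_norm.
have [c] := MVT_segment (ltW t0) (@dx t 0) (@dc t 0).
rewrite in_itv/= scale0r addr0 sub0r => /andP[tc c0] E; exists c => //.
  by rewrite !ler0_norm ?lerN2// ltW.
by rewrite -opprB E mulrN opprK mulrC.
Qed.

Lemma continuous_ball_bounded f r : continuous f ->
  exists2 B, 0 <= B & forall x, enorm x <= r -> `|f x| <= B.
Proof.
move=> cf; pose K := [set x : 'rV[R]_N | forall i, `[- r, r]%classic (x ord0 i)].
have cK : compact K.
  by apply: (@rV_compact R N (fun=> `[- r, r]%classic)) => i; exact: segment_compact.
have := continuous_compact (continuous_subspaceT cf) cK.
move=> /compact_bounded[M [_ MP]].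
exists (`|M| + 1); first by rewrite addr_ge0.
move=> x xr; have hM : M < `|M| + 1 by rewrite (le_lt_trans (ler_norm M))// ltrDl.
apply: (MP _ hM (f x)); exists x => // i /=; rewrite in_itv/= -ler_norml.
exact: le_trans (coord_le_enorm _ _) xr.
Qed.

(** Only partial derivatives are at hand, so an increment [z] is decomposed into
    increments along the axes: [headv z k] keeps the first [k] coordinates. *)
Definition headv z k : 'rV[R]_N := \row_i (if (i < k)%N then z ord0 i else 0).

Lemma headv0 z : headv z 0 = 0.
Proof. by apply/rowP => i; rewrite !mxE. Qed.

Lemma headv_full z : headv z N = z.
Proof. by apply/rowP => i; rewrite !mxE ltn_ord. Qed.

Lemma headvS z (k : 'I_N) : headv z k.+1 = headv z k + z ord0 k *: 'e_k.
Proof.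
apply/rowP => i; rewrite !mxE eqxx/=.
have [->|ik] := eqVneq i k; first by rewrite ltnS leqnn ltnn mulr1 add0r.
rewrite mulr0 addr0 ltnS leq_eqVlt.
by rewrite (_ : (nat_of_ord i == nat_of_ord k) = false)//; apply/negbTE.
Qed.

Lemma enorm_headv z k : enorm (headv z k) <= enorm z.
Proof.
rewrite -(@ler_pXn2r _ 2)// ?nnegrE ?enorm_ge0// !enorm_sqr; apply: ler_sum => i _.
by rewrite mxE; case: ifP => _ //; rewrite mul0r -expr2 sqr_ge0.
Qed.

Lemma telescope_headv (F : 'rV[R]_N -> R) z :
  F z - F 0 = \sum_(k < N) (F (headv z k.+1) - F (headv z k)).
Proof.
rewrite -(headv0 z) -{1}(headv_full z).
rewrite -(@telescope_sumr _ 0 N (fun k => F (headv z k)))// big_mkord.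
by [].
Qed.

Lemma enormZ_delta t i : enorm (t *: 'e_i : 'rV[R]_N) = `|t|.
Proof. by rewrite enormZ enorm_delta mulr1. Qed.

(** The broken line from [x] to [x + z] along the axes stays in the ball of radius
    [|x| + 2 |z|]. *)
Lemma lipschitz_ball f B r : (forall i x, derivable f x 'e_i) ->
  (forall i x, enorm x <= r -> `|partial i f x| <= B) ->
  forall x z, enorm x + 2 * enorm z <= r -> `|f (x + z) - f x| <= N%:R * B * enorm z.
Proof.
move=> df fB x z xz; rewrite -{2}(addr0 x) (telescope_headv (fun z => f (x + z))).
apply: (le_trans (ler_norm_sum _ _ _)).
rewrite -mulrA mulr_natl -[X in _ *+ X]card_ord -sumr_const; apply: ler_sum => k _.
have [t tk E] := mvt_line (x + headv z k) (z ord0 k) (df k).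
rewrite headvS addrA E normrM mulrC.
have zk := coord_le_enorm z k.
apply: ler_pM => //; apply: fB.
have h1 := ler_enormD (x + headv z k) (t *: 'e_k).
have h2 := ler_enormD x (headv z k); have h3 := enorm_headv z k.
by rewrite enormZ_delta in h1; lra.
Qed.

(** Along each axis, the second difference is a difference of two increments of
    [u], that is a coordinate of [z] times a difference of values of a partial
    derivative, which is Lipschitz on balls. *)
Lemma second_diff_bound u r : Ck 2 u ->
  exists2 B, 0 <= B & forall x z, enorm x <= r -> enorm z <= 1 ->
    `|u (x + z) + u (x - z) - 2 * u x| <= B * enorm z ^+ 2.
Proof.
move=> [_ cu].
(* Slack for [lipschitz_ball]: the points compared below are at most [r + 2]
   from the origin and at most [4] apart. *)
have bnd i : exists2 B, 0 <= B & forall j x,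
  enorm x <= r + 10 -> `|partial j (partial i u) x| <= B.
  have [_ [_ ci]] := cu i.
  have bj j : exists2 B, 0 <= B & forall x,
    enorm x <= r + 10 -> `|partial j (partial i u) x| <= B.
    by have [_ [cj _]] := ci j; exact: continuous_ball_bounded.
  have [b hb] := choice (fun j =>
    (fun '(ex_intro2 B p q) => ex_intro (fun B => 0 <= B /\ _) B (conj p q)) (bj j)).
  exists (\sum_j b j) => [|j x xr]; first by apply: sumr_ge0 => j _; case: (hb j).
  have [_ /(_ x xr) h] := hb j; apply: (le_trans h).
  by rewrite (bigD1 j)//= lerDl; apply: sumr_ge0 => k _; case: (hb k).
have [b hb] := choice (fun j =>
  (fun '(ex_intro2 B p q) => ex_intro (fun B => 0 <= B /\ _) B (conj p q)) (bnd j)).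
exists (\sum_i (N%:R * b i * 4)) => [|x z xr z1].
  by apply: sumr_ge0 => i _; rewrite !mulr_ge0//; case: (hb i).
have z0 := enorm_ge0 z.
have -> : u (x + z) + u (x - z) - 2 * u x =
    \sum_(k < N) ((u (x + headv z k.+1) - u (x + headv z k)) -
      (u (x - headv z k) - u (x - headv z k.+1))).
  rewrite sumrB -(telescope_headv (fun z => u (x + z))) addr0.
  have := telescope_headv (fun z => - u (x - z)) z.
  under eq_bigr do rewrite opprK addrC.
  by move=> <-; rewrite subr0; ring.
apply: (le_trans (ler_norm_sum _ _ _)); rewrite mulr_suml; apply: ler_sum => k _.
have [du _] := cu k.
have [t tk E] := mvt_line (x + headv z k) (z ord0 k) du.
have [t' tk' E'] := mvt_line (x - headv z k.+1) (z ord0 k) du.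
have zk := coord_le_enorm z k.
rewrite headvS addrA E.
rewrite (_ : x - headv z k = x - headv z k.+1 + z ord0 k *: 'e_k); last first.
  by rewrite headvS opprD addrA subrK.
rewrite -headvS E' -mulrBr normrM.
have [b0 hk] := hb k.
set p := x + _ + _; set p' := x - _ + _.
have hz := enorm_headv z k; have hz' := enorm_headv z k.+1.
have pp' : enorm (p - p') <= 4 * enorm z.
  rewrite (_ : p - p' = (headv z k + t *: 'e_k) + (headv z k.+1 - t' *: 'e_k));
    last first.
    by apply/rowP => i; rewrite !mxE; ring.
  have h1 := ler_enormD (headv z k + t *: 'e_k) (headv z k.+1 - t' *: 'e_k).
  have h2 := ler_enormD (headv z k) (t *: 'e_k).
  have h3 := ler_enormD (headv z k.+1) (- (t' *: 'e_k)).
  by rewrite enormZ_delta in h2; rewrite enormN enormZ_delta in h3; lra.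
have np' : enorm p' <= r + 2.
  have h1 := ler_enormD (x - headv z k.+1) (t' *: 'e_k).
  have h2 := ler_enormD x (- headv z k.+1).
  by rewrite enormZ_delta in h1; rewrite enormN in h2; lra.
have dk i y : derivable (partial k u) y 'e_i.
  by have [_ [_ /(_ i)[]]] := cu k.
have := @lipschitz_ball (partial k u) (b k) (r + 10) dk hk p' (p - p').
rewrite (_ : p' + (p - p') = p) => [L|]; last by rewrite addrC subrK.
apply: (@le_trans _ _ (enorm z * (N%:R * b k * (4 * enorm z)))).
  apply: ler_pM => //; apply: (le_trans (L _)); first by lra.
  by rewrite ler_wpM2l// mulr_ge0.
by rewrite le_eqVlt; apply/orP; left; apply/eqP; ring.
Qed.

(** The mean value theorem on [0, h] for [k t = u (x + t e) + u (x - t e) - A t^2],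
    where [A] is the limit, and once more for the first derivative. *)
Lemma second_diff_cvg u i x : Ck 2 u ->
  forall e, 0 < e -> exists2 d, 0 < d & forall h, 0 < h -> h < d ->
   `|h ^- 2 * (u (x + h *: 'e_i) + u (x - h *: 'e_i) - 2 * u x) - partial i
     (partial i u) x| <= e.
Proof.
move=> [_ /(_ i)[du [_ /(_ i)[ddu [cdd _]]]]] e e0.
have e20 : 0 < e / 2 by rewrite divr_gt0.
have cl : {for 0, continuous (fun t : R => partial i (partial i u) (x + t *: 'e_i))}.
  apply: continuous_comp; last exact: cdd.
  by apply: cvgD; [exact: cvg_cst|apply: cvgZr_tmp; exact: cvg_id].
have /cvgrPdist_le /(_ _ e20) := cl; rewrite scale0r addr0.
move=> [d /= d0 hd]; exists (d / 3) => [|h h0 hlt]; first by rewrite divr_gt0.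
pose A := partial i (partial i u) x.
have hdd t : `|t| <= 3 * h -> `|A - partial i (partial i u) (x + t *: 'e_i)| <= e / 2.
  by move=> th; apply: hd => /=;
    rewrite sub0r normrN (le_lt_trans th)// mulrC -ltr_pdivlMr.
pose k t := u (x + t *: 'e_i) + u (x + (- t) *: 'e_i) - A * t ^+ 2.
have dk t : is_derive t 1 k (partial i u (x + t *: 'e_i) - partial i u
  (x + (- t) *: 'e_i) - 2 * A * t).
  have d1 : is_derive t 1 (fun r => u (x + r *: 'e_i)) (partial i u (x + t *: 'e_i)).
    exact: is_derive_line.
  have d2 : is_derive (- t) 1 (fun r => u (x + r *: 'e_i))
    (partial i u (x + (- t) *: 'e_i)).
    exact: is_derive_line.
  have d3 : is_derive t 1 (fun r => u (x + (- r) *: 'e_i))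
    (- partial i u (x + (- t) *: 'e_i)).
    have d4 : is_derive t 1 (-%R : R -> R) (-1) by exact: is_deriveNid.
    have := @is_derive1_comp _ (fun r => u (x + r *: 'e_i)) _ t _ _ d2 d4.
    by rewrite mulrN1.
  rewrite /k; apply: is_derive_eq.
  by rewrite /GRing.scale /=; ring.
have ck : {within `[0, h], continuous k}.
  by apply: derivable_within_continuous => r _; case: (dk r).
have dk' r (_ : r \in `]0, h[%R) := dk r.
have [c] := MVT_segment (ltW h0) dk' ck.
rewrite in_itv/= subr0 => /andP[c0 ch] E.
have [t tc E'] := mvt_line (x + (- c) *: 'e_i) (2 * c) ddu.
rewrite -addrA -scalerDl (_ : - c + 2 * c = c) in E'; last by ring.
rewrite -addrA -scalerDl in E'.
set P := 'D_('e_i) _ _ in E'.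
have hP : `|P - A| <= e / 2.
  rewrite distrC; apply: hdd; rewrite (le_trans (ler_normD _ _))// normrN.
  move: tc; rewrite normrM !(ger0_norm c0) gtr0_norm// => tc.
  by apply: (@le_trans _ _ (3 * c)); [lra|rewrite ler_pM2l].
have -> : u (x + h *: 'e_i) + u (x - h *: 'e_i) - 2 * u x = A * h ^+ 2 + 2 * c *
  (P - A) * h.
  have k0 : k 0 = 2 * u x by rewrite /k oppr0 scale0r addr0; ring.
  have kh : u (x + h *: 'e_i) + u (x - h *: 'e_i) = k h + A *
    h ^+ 2 by rewrite /k scaleNr; ring.
  rewrite kh -k0.
  rewrite (_ : k h + A * h ^+ 2 - k 0 = k h - k 0 + A * h ^+ 2); last by ring.
  by rewrite E E'; ring.
rewrite -/A; clearbody P A.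
rewrite (_ : _ - _ = 2 * (c / h) * (P - A)); last by field; rewrite gt_eqF.
rewrite normrM ger0_norm; last by rewrite mulr_ge0// divr_ge0// ltW.
apply: (@le_trans _ _ (2 * `|P - A|)).
  by rewrite ler_wpM2r// ler_piMr// ler_pdivrMr// mul1r.
by rewrite -ler_pdivlMl// mulrC.
Qed.

End calculus.

(** * The truncated fractional Laplacian *)

Section signed_invariance.
Context (R : realType) (N : nat).
Local Notation mu := (lebesgue_rV R N).
Implicit Types f : 'rV[R]_N -> R.

Let signed_invariance (T : 'rV[R]_N -> 'rV[R]_N) f : measurable_fun setT f ->
  (forall g : 'rV[R]_N -> R, measurable_fun setT g -> (forall x, 0 <= g x) ->
    (\int[mu]_x (g (T x))%:E = \int[mu]_x (g x)%:E)%E) ->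
  (\int[mu]_x (f (T x))%:E = \int[mu]_x (f x)%:E)%E.
Proof.
move=> mf inv; rewrite integralE [RHS]integralE; congr (_ - _)%E.
  under eq_integral do rewrite funeposE -EFin_max.
  under [RHS]eq_integral do rewrite funeposE -EFin_max.
  by apply: (inv (fun x => Num.max (f x) 0)) => [|x]; [mfun|rewrite le_max lexx orbT].
under eq_integral do rewrite funenegE -EFinN -EFin_max.
under [RHS]eq_integral do rewrite funenegE -EFinN -EFin_max.
by apply: (inv (fun x => Num.max (- f x) 0)) => [|x]; [mfun|rewrite le_max lexx orbT].
Qed.

Lemma int_shift_signed b f : measurable_fun setT f ->
  (\int[mu]_x (f (x + b)%R)%:E = \int[mu]_x (f x)%:E)%E.
Proof.
by move=> mf; apply: (@signed_invariance (fun x => x + b)) => // g mg g0;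
  exact: int_shift.
Qed.

Lemma int_opp_signed f : measurable_fun setT f ->
  (\int[mu]_x (f (- x)%R)%:E = \int[mu]_x (f x)%:E)%E.
Proof.
by move=> mf; apply: (@signed_invariance (fun x => - x)) => // g mg g0; exact: int_opp.
Qed.

End signed_invariance.

Section truncated_fraclap.
Context (R : realType) (N : nat) (s : R).
Hypotheses (s_gt0 : 0 < s) (s_lt1 : s < 1).
Local Notation mu := (lebesgue_rV R N).
Local Notation q := (N%:R + 2 * s).
Implicit Types (u f : 'rV[R]_N -> R) (x y z : 'rV[R]_N) (eps r : R).

Let q_gt0 : 0 < q. Proof. by rewrite ltr_wpDl// mulr_gt0. Qed.

Definition Ls_weight y : R := (1 + enorm y `^ q)^-1.

Lemma Ls_weight_gt0 y : 0 < Ls_weight y.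
Proof. by rewrite invr_gt0 ltr_wpDr ?powR_ge0. Qed.

Lemma measurable_Ls_weight : measurable_fun setT Ls_weight.
Proof.
rewrite (_ : Ls_weight = (fun y => (1 + enorm y `^ q) `^ (-1))); first by mfun.
by apply/funext => y; rewrite powR_inv1// addr_ge0 ?powR_ge0.
Qed.

(** Away from its singularity, and uniformly for [x] in a ball, the kernel centred
    at [x] is at most a constant times the weight that defines the space. *)
Lemma Kop_Ls r eps : 0 <= r -> 0 < eps -> exists2 C : R, 0 <= C &
  forall x f, enorm x <= r -> measurable_fun setT f -> (forall y, 0 <= f y) ->
  (Kop s eps f x <= C%:E * \int[mu]_y (f y * Ls_weight y)%:E)%E.
Proof.
(* From [|y| <= |z| + r <= (r / eps + 1) |z|] when [eps <= |z|]. *)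
move=> r0 e0; pose C := eps `^ (- q) + (r / eps + 1) `^ q.
have C0 : 0 <= C by rewrite addr_ge0 ?powR_ge0.
exists C => // x f xr mf f0; rewrite Kop_center//.
have mw := measurable_Ls_weight.
have w0 y := ltW (Ls_weight_gt0 y).
rewrite -intZ//; [|by mfun|by move=> y; rewrite mulr_ge0].
apply: le_int.
- by apply: measurable_funM => //; apply: measurable_kern; mfun.
- by mfun.
- by move=> y; rewrite mulr_ge0 ?kern_ge0.
move=> y; rewrite mulrCA mulrC ler_wpM2l// /kern.
have [ez|_] := leP eps (enorm (y - x)); last by rewrite ind0 mul0r mulr_ge0.
set z := y - x in ez *; have z0 : 0 < enorm z by exact: lt_le_trans ez.
suff main : 1 + enorm y `^ q <= C * enorm z `^ q.
  by rewrite ind1 mul1r powRN ler_pdivlMr ?ltr_wpDr ?powR_ge0//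
    mulrC ler_pdivrMr ?powR_gt0.
rewrite /C [leRHS]mulrDl; apply: lerD.
  rewrite powRN mulrC ler_pdivlMr ?powR_gt0// mul1r.
  by rewrite ge0_ler_powR ?nnegrE ?(ltW q_gt0) ?(ltW e0) ?(ltW z0).
have re0 : 0 <= r / eps + 1 by rewrite addr_ge0// divr_ge0// ltW.
rewrite -powRM ?(ltW z0)//.
rewrite ge0_ler_powR ?nnegrE ?(ltW q_gt0) ?enorm_ge0// ?mulr_ge0 ?(ltW z0)//.
have -> : y = z + x by rewrite /z subrK.
apply: (le_trans (ler_enormD _ _)); rewrite [leRHS]mulrDl mul1r addrC lerD2r.
apply: (le_trans xr); rewrite mulrAC ler_pdivlMr//; exact: ler_wpM2l.
Qed.

(** The truncated integrals whose limit defines [fraclap]. *)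
Definition tfrac eps u x : R :=
  \int[mu]_(y in [set y | eps <= enorm (x - y)]) ((u x - u y) / enorm (x - y) `^ q).

Section fixed_u.
Variable u : 'rV[R]_N -> R.
Hypotheses (Cu : Ck 2 u) (Lu : Ls_space s u).

Let mu_ : measurable_fun setT u. Proof. by case: Lu. Qed.

(** The truncated kernel is even, so [tfrac] is an integral of symmetric second
    differences ([tfracE]); these are quadratic in [z], and the integral converges
    absolutely as the truncation is removed. *)
Definition sdiff x z : R := u (x + z) + u (x - z) - 2 * u x.

Let m_kern eps : measurable_fun setT (kern s eps : 'rV[R]_N -> R).
Proof. by apply: (@measurable_kern _ _ _ _ _ _ id); mfun. Qed.

Let m_shift x : measurable_fun setT (fun z => u (x + z)).
Proof. by apply: (measurableT_comp mu_); mfun. Qed.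

Let m_shiftN x : measurable_fun setT (fun z => u (x - z)).
Proof. by apply: (measurableT_comp mu_); mfun. Qed.

Lemma measurable_sdiff x : measurable_fun setT (sdiff x).
Proof. by rewrite /sdiff; mfun. Qed.

Lemma Ls_fin : (\int[mu]_y (`|u y| * Ls_weight y)%:E < +oo)%E.
Proof. by case: Lu. Qed.

Let mnu : measurable_fun setT (fun y => `|u y|%R).
Proof. exact: (measurableT_comp (@normr_measurable _ _) mu_). Qed.

Lemma Kop_fin eps x : 0 < eps -> (Kop s eps (fun y => `|u y|%R) x < +oo)%E.
Proof.
move=> e0; have [C C0 h] := Kop_Ls (enorm_ge0 x) e0.
apply: (le_lt_trans (h x _ (lexx _) mnu (fun y => normr_ge0 _))).
rewrite lte_mul_pinfty ?lee_fin//; exact: Ls_fin.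
Qed.

Lemma integrable_kern eps : 0 < eps ->
  mu.-integrable setT (EFin \o (kern s eps : 'rV[R]_N -> R)).
Proof.
move=> e0; apply/integrableP; split; first exact/measurable_EFinP.
rewrite (_ : \int[mu]_x _ = (kmass N s eps)%:E)%E ?ltry// -int_kern//.
by apply: eq_integral => z _; rewrite /= ger0_norm ?kern_ge0.
Qed.

Lemma integrable_kern_shift eps x : 0 < eps ->
  mu.-integrable setT (fun z => (kern s eps z * u (x + z))%:E).
Proof.
move=> e0; apply/integrableP; split.
  by apply/measurable_EFinP; apply: measurable_funM.
apply: le_lt_trans (Kop_fin x e0); rewrite le_eqVlt; apply/orP; left; apply/eqP.
by apply: eq_integral => z _; rewrite /= normrM ger0_norm ?kern_ge0.
Qed.

Lemma integrable_kern_diff eps x : 0 < eps ->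
  mu.-integrable setT (fun z => (kern s eps z * (u x - u (x + z)))%:E).
Proof.
move=> e0; rewrite (_ : (fun z => _) =
  (fun z => (u x)%:E * (kern s eps z)%:E - (kern s eps z * u (x + z))%:E)%E).
  apply: integrableB => //; last exact: integrable_kern_shift.
  by apply: integrableZl => //; exact: integrable_kern.
by apply/funext => z; rewrite -EFinM -EFinB; congr EFin; ring.
Qed.

Lemma tfrac_int eps x : 0 < eps ->
  (tfrac eps u x)%:E = (\int[mu]_z (kern s eps z * (u x - u (x + z)%R))%:E)%E.
Proof.
move=> e0; rewrite /tfrac /Rintegral.
have E : (\int[mu]_(y in [set y | (eps <= enorm (x - y))%R])
  ((u x - u y) / enorm (x - y) `^ q)%:E =
    \int[mu]_z (kern s eps z * (u x - u (x + z)%R))%:E)%E.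
  rewrite integral_mkcond -(int_shift_signed (- x)); last first.
    by apply: measurable_funM => //; apply: measurable_funB => //;
      exact: measurable_cst.
  apply: eq_integral => y _; rewrite patchE /kern addrCA subrr addr0 (enormB y x).
  rewrite (_ : (y \in _) = (eps <= enorm (x - y))); last first.
    by apply/idP/idP => [/set_mem|h]; [|apply/mem_set].
  have [_|_] := leP eps (enorm (x - y)); last by rewrite ind0 !mul0r.
  by rewrite ind1 mul1r powRN mulrC.
by rewrite E fineK//; apply: integrable_fin_num => //; exact: integrable_kern_diff.
Qed.

Lemma tfracE eps x : 0 < eps ->
  mu.-integrable setT (fun z => (kern s eps z * sdiff x z)%:E) /\
  (tfrac eps u x)%:E = ((- 2^-1)%:E * \int[mu]_z (kern s eps z * sdiff x z)%:E)%E.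
Proof.
move=> e0; have iF := integrable_kern_diff x e0.
set F := fun z => kern s eps z * (u x - u (x + z)).
have mF : measurable_fun setT F.
  by apply: measurable_funM => //; apply: measurable_funB => //; exact: measurable_cst.
have iF' : mu.-integrable setT (fun z => (F (- z))%:E).
  apply/integrableP; split.
    by apply/measurable_EFinP; apply: (measurableT_comp mF); mfun.
  move/integrableP : iF => [_]; apply: le_lt_trans.
  rewrite le_eqVlt; apply/orP; left; apply/eqP.
  apply: (@int_opp_signed R N (fun z => `|F z|)).
  exact: (measurableT_comp (@normr_measurable _ _) mF).
have E : (fun z => (kern s eps z * sdiff x z)%:E) =
  (fun z => (-1)%:E * ((F z)%:E + (F (- z))%:E))%E.
  by apply/funext => z; rewrite -EFinD -EFinM /F kernN /sdiff; congr EFin; ring.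
have iS : mu.-integrable setT (fun z => ((F z)%:E + (F (- z))%:E)%E) by exact:
  integrableD.
rewrite E; split; first exact: integrableZl.
rewrite tfrac_int// integralZl// integralD//.
rewrite (int_opp_signed mF) -/F.
have : (\int[mu]_z (F z)%:E)%E \is a fin_num by exact: integrable_fin_num.
by case: (\int[mu]_z _)%E => // v _; rewrite -!EFinD -!EFinM; congr EFin; lra.
Qed.

(** An integrable bound that does not involve the truncation parameter: quadratic
    for short jumps, and using the growth of [u] for long ones. *)
Definition majorant (B : R) x z : R :=
  B * (ind (0 < enorm z) * (ind (enorm z <= 1) * enorm z `^ (- (q - 2)))) +
  kern s 1 z * (`|u (x + z)| + `|u (x - z)| + 2 * `|u x|).

Lemma kern_sdiff_le (B : R) x : 0 <= B ->
  (forall z, enorm z <= 1 -> `|sdiff x z| <= B * enorm z ^+ 2) ->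
  forall eps z, 0 < eps -> `|kern s eps z * sdiff x z| <= majorant B x z.
Proof.
move=> B0 hB eps z e0; rewrite normrM ger0_norm ?kern_ge0// /majorant.
have near0 : 0 <= B * (ind (0 < enorm z) *
  (ind (enorm z <= 1) * enorm z `^ (- (q - 2)))).
  by rewrite !mulr_ge0 ?ind_ge0 ?powR_ge0.
have far0 : 0 <= kern s 1 z * (`|u (x + z)| + `|u (x - z)| + 2 * `|u x|).
  by rewrite mulr_ge0 ?kern_ge0// !addr_ge0// mulr_ge0.
rewrite {1}/kern; have [ez|_] := leP eps (enorm z);
  last by rewrite ind0 !mul0r addr_ge0.
have z0 : 0 < enorm z by exact: lt_le_trans ez.
rewrite ind1 mul1r; have [z1|z1] := leP (enorm z) 1.
  rewrite -[leLHS]addr0; apply: lerD => //.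
  apply: (@le_trans _ _ (enorm z `^ (- q) * (B * enorm z ^+ 2))).
    by rewrite ler_wpM2l ?powR_ge0// hB.
  rewrite z0 !ind1 !mul1r mulrCA ler_wpM2l// -powR_mulrn ?(ltW z0)// -powRD.
    by rewrite (_ : - q + 2%:R = - (q - 2)) ?lexx//; ring.
  by rewrite (gt_eqF z0) implybT.
rewrite ind0 !(mul0r, mulr0) add0r /kern (ltW z1) ind1 mul1r ler_wpM2l ?powR_ge0//.
rewrite /sdiff (le_trans (ler_normB _ _))// normrM (ger0_norm (_ : 0 <= 2))// lerD2r.
exact: ler_normD.
Qed.

Lemma measurable_majorant B x : measurable_fun setT (majorant B x).
Proof.
rewrite /majorant; apply: measurable_funD; first by mfun.
apply: measurable_funM => //; apply: measurable_funD; last by mfun.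
by apply: measurable_funD; exact: (measurableT_comp (@normr_measurable _ _)).
Qed.

Lemma majorant_ge0 B x z : 0 <= B -> 0 <= majorant B x z.
Proof.
move=> B0; rewrite addr_ge0//; first by rewrite !mulr_ge0 ?ind_ge0 ?powR_ge0.
by rewrite mulr_ge0 ?kern_ge0// !addr_ge0// mulr_ge0.
Qed.

Lemma int_majorant B x : 0 <= B ->
  (\int[mu]_z (majorant B x z)%:E =
   (B * near_const N s)%:E + (Kop s 1 (fun y => `|u y|%R) x +
     Kop s 1 (fun y => `|u y|%R) x +
     (2 * `|u x| * kmass N s 1)%:E))%E.
Proof.
move=> B0.
have mn f : measurable_fun setT f -> measurable_fun setT (fun z : 'rV[R]_N => `|f z|).
  exact: (measurableT_comp (@normr_measurable _ _)).
have mp : measurable_fun setT (fun z => `|u (x + z)|) by exact: mn.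
have mm : measurable_fun setT (fun z => `|u (x - z)|) by exact: mn.
have mk := @m_kern 1.
rewrite intD; first last.
- by move=> z; rewrite mulr_ge0 ?kern_ge0// !addr_ge0// mulr_ge0.
- by move=> z; rewrite !mulr_ge0 ?ind_ge0 ?powR_ge0.
- by apply: measurable_funM => //; apply: measurable_funD;
    [exact: measurable_funD|exact: measurable_cst].
- by mfun.
congr (_ + _)%E.
  rewrite intZ//; last 2 first.
  - by mfun.
  - by move=> z; rewrite !mulr_ge0 ?ind_ge0 ?powR_ge0.
  by rewrite int_near// powR1 mulr1.
rewrite (_ : (2 * `|u x| * kmass N s 1)%:E =
  \int[mu]_z ((2 * `|u x|) * kern s 1 z)%:E)%E; last first.
  by rewrite intZ ?int_kern// => z; exact: kern_ge0.
rewrite {2}Kop_opp// /Kop.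
have k0 z : 0 <= kern s 1 z := @kern_ge0 R N s 1 z.
have ma : measurable_fun setT (fun z => kern s 1 z * `|u (x + z)|) by exact:
  measurable_funM.
have mb : measurable_fun setT (fun z => kern s 1 z * `|u (x - z)|) by exact:
  measurable_funM.
have mc : measurable_fun setT (fun z : 'rV[R]_N => 2 * `|u x| * kern s 1 z).
  by apply: measurable_funM => //; exact: measurable_cst.
have a0 z : 0 <= kern s 1 z * `|u (x + z)| by rewrite mulr_ge0.
have b0 z : 0 <= kern s 1 z * `|u (x - z)| by rewrite mulr_ge0.
have c0 z : 0 <= 2 * `|u x| * kern s 1 z by apply: mulr_ge0 => //; apply: mulr_ge0.
rewrite -(intD mu ma mb a0 b0)
  -(intD mu (measurable_funD ma mb) mc (fun z => addr_ge0 (a0 z) (b0 z)) c0).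
by apply: eq_integral => z _; congr EFin => /=; ring.
Qed.

Lemma integrable_majorant B x : 0 <= B ->
  mu.-integrable setT (fun z => (majorant B x z)%:E).
Proof.
move=> B0; apply/integrableP; split; first by apply/measurable_EFinP;
  exact: measurable_majorant.
rewrite (_ : (\int[mu]_z _ = \int[mu]_z (majorant B x z)%:E)%E); last first.
  by apply: eq_integral => z _; rewrite /= ger0_norm// majorant_ge0.
rewrite int_majorant//.
apply: lte_add_pinfty; first exact: ltry.
by apply: lte_add_pinfty; [apply: lte_add_pinfty; exact: Kop_fin|exact: ltry].
Qed.

Lemma tfrac_bound r : 0 <= r -> exists2 B : R, 0 <= B &
  forall eps x, 0 < eps -> enorm x <= r -> `|tfrac eps u x| <= B.
Proof.
move=> r0; have [B B0 hB] := second_diff_bound r Cu.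
have [Bu Bu0 hBu] := continuous_ball_bounded r Cu.1.
have [C C0 hC] := Kop_Ls r0 ltr01.
have [lf lf0] : exists2 l : R, (\int[mu]_y (`|u y| * Ls_weight y)%:E = l%:E)%E & 0 <= l.
  have h0 : (0 <= \int[mu]_y (`|u y| * Ls_weight y)%:E)%E.
    by apply: int_ge0 => y; rewrite mulr_ge0 ?(ltW (Ls_weight_gt0 _)).
  have := Ls_fin; move: h0; case: (\int[mu]_y _)%E => // l l0 _.
  by exists l.
move=> hl; exists (B * near_const N s + (C * lf + C * lf + 2 * Bu * kmass N s 1)).
  by repeat first [done | exact: near_const_ge0 | exact: kmass_ge0
    | apply: addr_ge0 | apply: mulr_ge0].
move=> eps x e0 xr; have [iD E] := tfracE x e0.
have hK : (Kop s 1 (fun y => `|u y|%R) x <= (C * lf)%:E)%E.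
  by apply: (le_trans (hC x _ xr mnu (fun y => normr_ge0 _))); rewrite lf0 -EFinM.
rewrite -lee_fin; apply: (@le_trans _ _ (\int[mu]_z (majorant B x z)%:E)%E); last first.
  rewrite int_majorant// 3!EFinD; apply: leeD => //; apply: leeD; first exact: leeD.
  by rewrite lee_fin ler_wpM2r ?kmass_ge0// ler_wpM2l// hBu.
rewrite -abse_EFin E abseM.
apply: (@le_trans _ _ (1%:E * `|\int[mu]_z (kern s eps z * sdiff x z)%:E|)%E).
  by apply: lee_wpmul2r; rewrite ?abse_ge0// lee_fin normrN gtr0_norm ?invf_le1 ?ler1n.
rewrite mul1e; apply: (le_trans (le_abse_integral _ _ _)) => //.
  by case/integrableP : iD.
apply: ge0_le_integral => //.
- by apply: measurableT_comp => //; case/integrableP : iD.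
- by apply/measurable_EFinP; exact: measurable_majorant.
by move=> z _; rewrite lee_fin; apply: kern_sdiff_le => // z' z1; apply: hB.
Qed.

(** Dominated convergence along every sequence of truncation parameters. *)
Lemma tfrac_cvg x : exists l : R, tfrac eps u x @[eps --> (0:R)^'+] --> l.
Proof.
have [B B0 hB'] := second_diff_bound (enorm x) Cu.
have hB z : enorm z <= 1 -> `|sdiff x z| <= B * enorm z ^+ 2 by move=> z1; exact: hB'.
pose F (z : 'rV[R]_N) := (ind (0 < enorm z) * enorm z `^ (- q)) * sdiff x z.
have mF : measurable_fun setT F.
  by apply: measurable_funM; [mfun|exact: measurable_sdiff].
exists (- 2^-1 * fine (\int[mu]_z (F z)%:E)%E).
apply/cvg_at_rightP => e [e0 ecvg].
have mks n : measurable_fun setT (fun z => (kern s (e n) z * sdiff x z)%:E).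
  by apply/measurable_EFinP/measurable_funM => //; exact: measurable_sdiff.
have [||||iF _ cv] := @dominated_convergence _ _ R mu setT measurableT
  (fun n z => (kern s (e n) z * sdiff x z)%:E) (fun z => (F z)%:E)
    (fun z => (majorant B x z)%:E) mks.
- exact/measurable_EFinP.
- apply: aeW => z _; apply: cvg_near_cst.
  have [z0|z0] := ltP 0 (enorm z).
    have : \forall n \near \oo, e n <= enorm z.
      move/cvgrPdist_le : ecvg => /(_ _ z0); apply: filterS => n.
      by rewrite sub0r normrN gtr0_norm.
    by apply: filterS => n en; rewrite /kern en /F z0.
  apply: nearW => n; rewrite /kern /F.
  by rewrite (ltNge 0) z0 leNgt (le_lt_trans z0 (e0 n)).
- exact: integrable_majorant.
- by apply: aeW => z n _; rewrite lee_fin; exact: kern_sdiff_le.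
rewrite (_ : (fun n => tfrac (e n) u x) =
    (fun n => - 2^-1 * fine (\int[mu]_z (kern s (e n) z * sdiff x z)%:E)%E));
      last first.
  apply/funext => n; have [iD E] := tfracE x (e0 n).
  by rewrite -[LHS]/(fine (tfrac (e n) u x)%:E) E fineM//; exact: integrable_fin_num.
apply: cvgM; first exact: cvg_cst.
by apply: fine_cvg; rewrite fineK//; exact: integrable_fin_num.
Qed.

Lemma measurable_tfrac eps : 0 < eps -> measurable_fun setT (tfrac eps u).
Proof.
move=> e0.
rewrite (_ : tfrac eps u = fine \o
  (fun x => \int[mu]_z (kern s eps z * (u x - u (x + z)%R))%:E)%E); last first.
  by apply/funext => x /=; rewrite -tfrac_int.
apply: measurableT_comp => //.
pose G (p : 'rV[R]_N * 'rV[R]_N) := kern s eps p.2 * (u p.1 - u (p.1 + p.2)).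
have mG : measurable_fun setT G.
  apply: measurable_funM; first by apply: measurable_kern; mfun.
  apply: measurable_funB; first by apply: (measurableT_comp mu_); mfun.
  by apply: (measurableT_comp mu_); mfun.
rewrite (_ : (fun x => _) = (fun x =>
  \int[mu]_z (Num.max (G (x, z)) 0)%:E - \int[mu]_z (Num.max (- G (x, z))%R 0)%:E)%E).
  apply: emeasurable_funB.
    apply: (@measurable_tonelli _ _ _ _ R mu (fun p => Num.max (G p) 0)) => [|p].
      by mfun.
    by rewrite le_max lexx orbT.
  apply: (@measurable_tonelli _ _ _ _ R mu (fun p => Num.max (- G p) 0)) => [|p].
    by mfun.
  by rewrite le_max lexx orbT.
apply/funext => x; rewrite integralE; congr (_ - _)%E.
  by apply: eq_integral => z _; rewrite funeposE -EFin_max.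
by apply: eq_integral => z _; rewrite funenegE -EFinN -EFin_max.
Qed.

End fixed_u.
End truncated_fraclap.

(** * The discrete Kato inequality *)

Section convexity.
Context (R : realType).
Implicit Types (p t a b : R).

(** A subgradient of [|t|^p]; at [t = 0] it is [0], also when [p = 1]. *)
Definition powgrad p t : R := p * `|t| `^ (p - 1) * (ind (0 < t) - ind (t < 0)).

Lemma measurable_powgrad p : measurable_fun setT (powgrad p).
Proof. by rewrite /powgrad; mfun; exact: normr_measurable. Qed.

(** Write [t^p = t t^(p-1)] and use [t^(p-1) >= 1 + (p-1) ln t] and
    [t ln t >= t - 1]. *)
Lemma powR_bernoulli p t : 1 <= p -> 0 <= t -> 1 + p * (t - 1) <= t `^ p.
Proof.
move=> p1; rewrite le_eqVlt => /orP[/eqP<-|t0].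
  by rewrite powR0 ?gt_eqF ?(lt_le_trans ltr01)//; lra.
have -> : t `^ p = t * t `^ (p - 1) by rewrite mulr_powRB1 ?(ltW t0)//
  (lt_le_trans ltr01).
have h1 : 1 + (p - 1) * ln t <= t `^ (p - 1) by rewrite /powR gt_eqF// expR_ge1Dx.
have h2 : t - 1 <= t * ln t.
  have := @le_ln1Dx _ (t^-1 - 1); rewrite (_ : 1 + (t^-1 - 1) = t^-1); last by ring.
  rewrite lnV ?posrE// => /(_ _) h.
  have := h ltac:(by rewrite ltrBrDl subrr invr_gt0).
  by rewrite -(ler_pM2l t0) mulrBr mulfV ?gt_eqF// mulr1 mulrN; lra.
apply: le_trans (ler_wpM2l (ltW t0) h1).
have p0 : 0 <= p - 1 by rewrite subr_ge0.
by have := ler_wpM2l p0 h2; lra.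
Qed.

(** Bernoulli's inequality for [|b| / |a|], and [sgn a (b - a) <= |b| - |a|]. *)
Lemma powR_convex p a b : 1 <= p ->
  `|a| `^ p + powgrad p a * (b - a) <= `|b| `^ p.
Proof.
move=> p1; have p0 : 0 < p by exact: lt_le_trans p1.
have [a0|aN0] := eqVneq a 0.
  by rewrite a0 /powgrad !ltxx ind0 subrr mulr0 mul0r normr0 powR0 ?gt_eqF//
    addr0 powR_ge0.
have A0 : 0 < `|a| by rewrite normr_gt0.
have h : (ind (0 < a) - ind (a < 0)) * (b - a) <= `|b| - `|a|.
  have [a0|a0|a0] := ltgtP a 0; rewrite ?ind0 ?ind1.
  - by rewrite (ltr0_norm a0); have := ler_norm (- b); rewrite normrN; lra.
  - by rewrite (gtr0_norm a0); have := ler_norm b; lra.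
  - by rewrite a0 eqxx in aN0.
have t0 : 0 <= `|b| / `|a| by rewrite divr_ge0.
have := powR_bernoulli p1 t0.
rewrite -(ler_pM2l (powR_gt0 p A0)) -powRM//.
rewrite (_ : `|a| * (`|b| / `|a|) = `|b|); last by field; rewrite gt_eqF.
apply: le_trans; rewrite [leRHS]mulrDr mulr1 lerD2l /powgrad -mulrA.
rewrite -(mulr_powRB1 (ltW A0) p0).
rewrite (_ : `|a| * `|a| `^ (p - 1) * (p * (`|b| / `|a| - 1)) = p * `|a| `^ (p - 1) *
  (`|b| - `|a|)); last by field; rewrite gt_eqF.
by rewrite ler_wpM2l// mulr_ge0 ?powR_ge0// ltW.
Qed.

Lemma powgradM p t : 0 < p -> powgrad p t * t = p * `|t| `^ p.
Proof.
move=> p0; rewrite -(mulr_powRB1 (normr_ge0 t) p0) /powgrad.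
have [t0|t0|->] := ltgtP t 0; rewrite ?ind0 ?ind1.
- by rewrite ltr0_norm//; ring.
- by rewrite gtr0_norm//; ring.
- by rewrite normr0 !mulr0 mul0r mulr0.
Qed.

Lemma powgrad_bound p t B : 1 <= p -> `|t| <= B -> `|powgrad p t| <= p * B `^ (p - 1).
Proof.
move=> p1 tB; have p0 : 0 <= p by exact: le_trans p1.
rewrite /powgrad !normrM (ger0_norm p0) (ger0_norm (powR_ge0 _ _)).
rewrite -[leRHS]mulr1 ler_pM ?mulr_ge0 ?powR_ge0//.
  rewrite ler_wpM2l// ge0_ler_powR ?nnegrE ?subr_ge0//.
  exact: le_trans tB.
have [t0|t0|_] := ltgtP t 0; rewrite ?ind0 ?ind1 ?subr0 ?sub0r ?normrN ?normr1
  ?normr0//.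
Qed.

End convexity.

Section discrete_kato.
Context (R : realType) (N : nat) (s c p : R).
Hypotheses (s_gt0 : 0 < s) (c_ge0 : 0 <= c) (p_ge1 : 1 <= p).
Local Notation mu := (lebesgue_rV R N).
Implicit Types (x z : 'rV[R]_N) (h : R).
Variable u : 'rV[R]_N -> R.
Hypotheses (Lu : Ls_space s u).

Let W x : R := `|u x| `^ p.

Definition Dlap h x : R := \sum_(i < N) h ^- 2 *
  (u (x + h *: 'e_i) + u (x - h *: 'e_i) - 2 * u x).

Let mu_ : measurable_fun setT u. Proof. by case: Lu. Qed.

Lemma measurable_powu : measurable_fun setT W.
Proof.
apply: (measurable_fun_powR p); exact: (measurableT_comp (@normr_measurable _ _) mu_).
Qed.

Lemma Dop_kato h x : powgrad p (u x) * Dlap h x + 2 * N%:R * h ^- 2 * W x <= Dop h W x.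
Proof.
have -> : 2 * N%:R * h ^- 2 * W x = \sum_(i < N) h ^- 2 * (2 * W x).
  by rewrite sumr_const card_ord -[RHS]mulr_natl; ring.
rewrite mulr_sumr -big_split/=; apply: ler_sum => i _.
rewrite mulrCA -mulrDr ler_wpM2l ?invr_ge0 ?sqr_ge0//.
have := powR_convex (u x) (u (x + h *: 'e_i)) p_ge1.
have := powR_convex (u x) (u (x - h *: 'e_i)) p_ge1.
by rewrite /W; lra.
Qed.

(** The right-hand side may be infinite; when it is finite, all terms are
    integrable and the inequality holds jump by jump. *)
Lemma Kop_kato h x : 0 < h ->
  ((powgrad p (u x) * (- tfrac s h u x) + kmass N s h * W x)%:E <= Kop s h W x)%E.
Proof.
move=> h0; have W0 y : 0 <= W y by exact: powR_ge0.
have mW := measurable_powu.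
have K0 := @Kop_ge0 R N s h W x W0.
have [->|Kfin] := eqVneq (Kop s h W x) +oo%E; first exact: leey.
have mk : measurable_fun setT (fun z => kern s h z * W (x + z)).
  by apply: measurable_funM; [apply: (@measurable_kern _ _ _ _ _ _ id);
    mfun|apply: (measurableT_comp mW); mfun].
have iK : mu.-integrable setT (fun z => (kern s h z * W (x + z))%:E).
  apply/integrableP; split; first exact/measurable_EFinP.
  rewrite (_ : (\int[mu]_z _ = Kop s h W x)%E) ?ltey//.
  by apply: eq_integral => z _; rewrite /= ger0_norm// mulr_ge0 ?kern_ge0.
have i1 := integrable_kern N s_gt0 h0.
have i2 := integrable_kern_diff s_gt0 Lu x h0.
have i3 := integrableZl measurableT (W x) i1.
have i4 := integrableZl measurableT (- powgrad p (u x)) i2.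
apply: (@le_trans _ _ (\int[mu]_z ((W x)%:E * (kern s h z)%:E +
   (- powgrad p (u x))%:E * (kern s h z * (u x - u (x + z)%R))%:E))%E).
  rewrite integralD// !integralZl// int_kern//.
  by rewrite -tfrac_int// -!EFinM -EFinD lee_fin le_eqVlt; apply/orP; left; apply/eqP;
    ring.
apply: le_integral => //; first exact: integrableD.
move=> z _; rewrite -!EFinM -EFinD lee_fin.
have := ler_wpM2l (kern_ge0 s h z) (powR_convex (u x) (u (x + z)) p_ge1).
by rewrite /W; lra.
Qed.

(** Both parts of [Pop h] average increments of [|u|^p] with nonnegative weights,
    and each increment is at least [powgrad p (u x)] times that of [u]. *)
Lemma Pop_kato h x : 0 < h ->
  ((powgrad p (u x) * (Dlap h x - c * tfrac s h u x) + Pmass N s c h * W x)%:E <=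
    Pop s c h W x)%E.
Proof.
move=> h0; have K : (c%:E * (powgrad p (u x) * (- tfrac s h u x) + kmass N s h * W x)%:E
  <= c%:E * Kop s h W x)%E.
  by rewrite lee_wpmul2l ?lee_fin// Kop_kato.
have D : ((powgrad p (u x) * Dlap h x + 2 * N%:R * h ^- 2 * W x)%:E <=
  (Dop h W x)%:E)%E.
  by rewrite lee_fin; exact: Dop_kato.
apply: le_trans (leeD D K).
by rewrite -EFinM -EFinD lee_fin le_eqVlt /Pmass; apply/orP; left; apply/eqP; ring.
Qed.

End discrete_kato.

(** * Consistency of the discretization *)

Section discretization.
Context (R : realType) (N : nat) (s : R).
Hypotheses (s_gt0 : 0 < s) (s_lt1 : s < 1).
Variable u : 'rV[R]_N -> R.
Hypotheses (Cu : Ck 2 u) (Lu : Ls_space s u).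

(** The steps start at [1/2], the largest one allowed by [Pop_cutoff]. *)
Definition step (n : nat) : R := n.+2%:R^-1.

Lemma step_gt0 n : 0 < step n.
Proof. by rewrite invr_gt0. Qed.

Lemma step_le n : step n <= 2^-1.
Proof. by rewrite lef_pV2 ?posrE// ler_nat. Qed.

Lemma step_cvg : step n @[n --> \oo] --> 0.
Proof.
have := @cvg_harmonic R; rewrite -(cvg_shiftS) /=.
exact.
Qed.

(** The discretization of [Delta - (-Delta)^s], applied to [u]. *)
Definition Sop (n : nat) x : R := Dlap u (step n) x - fraclap_const N s *
  tfrac s (step n) u x.

Lemma fraclap_const_ge0 : 0 <= fraclap_const N s.
Proof.
have G z : 0 <= @Gamma R z.
  by apply: Rintegral_ge0 => t _; rewrite mulr_ge0 ?powR_ge0 ?expR_ge0.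
have s0 := ltW s_gt0; rewrite /fraclap_const.
by repeat first [done | exact: G | exact: powR_ge0 | apply: divr_ge0 | apply: mulr_ge0].
Qed.

Lemma Dlap_cvg x : Dlap u (step n) x @[n --> \oo] --> laplacian u x.
Proof.
rewrite /Dlap /laplacian; move: (index_enum _) => r; elim: r => [|i r IHr].
  by rewrite big_nil; under eq_fun do rewrite big_nil; exact: cvg_cst.
rewrite big_cons; under eq_fun do rewrite big_cons.
apply: cvgD IHr; apply/cvgrPdist_le => e e0.
have [d d0 hd] := second_diff_cvg i x Cu e0.
have := step_cvg; move/cvgrPdist_lt => /(_ _ d0); apply: filterS => n.
rewrite sub0r normrN (gtr0_norm (step_gt0 n)) => sd; rewrite distrC.
exact: hd (step_gt0 n) sd.
Qed.

Lemma Sop_cvg x : Sop n x @[n --> \oo] --> laplacian u x - fraclap s u x.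
Proof.
apply: cvgB; first exact: Dlap_cvg.
apply: cvgM; first exact: cvg_cst.
have [l hl] := tfrac_cvg s_gt0 s_lt1 Cu Lu x.
have -> : lim (tfrac s eps u x @[eps --> (0:R)^'+]) = l by apply/cvg_lim.
move/cvg_at_rightP : hl; apply; split; first exact: step_gt0.
exact: step_cvg.
Qed.

Lemma Dlap_bound r : exists2 B, 0 <= B & forall n x,
  enorm x <= r -> `|Dlap u (step n) x| <= B.
Proof.
have [B B0 hB] := second_diff_bound r Cu.
exists (N%:R * B) => [|n x xr]; first exact: mulr_ge0.
apply: (le_trans (ler_norm_sum _ _ _)).
have -> : N%:R * B = \sum_(i < N) B by rewrite sumr_const card_ord mulr_natl.
apply: ler_sum => i _.
have s0 := step_gt0 n.
have h1 : enorm (step n *: 'e_i : 'rV[R]_N) = step n by rewrite enormZ_delta gtr0_norm.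
rewrite normrM ger0_norm ?invr_ge0 ?sqr_ge0// mulrC ler_pdivrMr ?exprn_gt0//.
rewrite -{3}h1; apply: hB => //; rewrite h1.
by apply: (le_trans (step_le n)); rewrite invf_le1 ?ler1n.
Qed.

Lemma Sop_bound r : 0 <= r -> exists2 B, 0 <= B & forall n x,
  enorm x <= r -> `|Sop n x| <= B.
Proof.
move=> r0; have [B1 B10 h1] := Dlap_bound r.
have [B2 B20 h2] := tfrac_bound s_gt0 s_lt1 Cu Lu r0.
exists (B1 + fraclap_const N s * B2) => [|n x xr].
  by rewrite addr_ge0// mulr_ge0// fraclap_const_ge0.
apply: (le_trans (ler_normB _ _)); apply: lerD; first exact: h1.
rewrite normrM ger0_norm ?fraclap_const_ge0//.
by rewrite ler_wpM2l ?fraclap_const_ge0// h2// step_gt0.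
Qed.

Lemma measurable_Sop n : measurable_fun setT (Sop n).
Proof.
have mu_ : measurable_fun setT u by case: Lu.
apply: measurable_funB.
  apply: measurable_sum => i; apply: measurable_funM; first exact: measurable_cst.
  apply: measurable_funB; last by apply: measurable_funM => //; exact: measurable_cst.
  by apply: measurable_funD; apply: (measurableT_comp mu_); mfun.
by apply: measurable_funM; [exact: measurable_cst|apply: measurable_tfrac => //;
  exact: step_gt0].
Qed.

End discretization.

(** * The tested inequality *)

Section energy.
Context (R : realType) (N : nat) (s alpha beta C0 p : R).
Hypotheses (s_gt0 : 0 < s) (s_lt1 : s < 1) (alpha_ge0 : 0 <= alpha)
  (beta_gt0 : 0 < beta)
  (C0_gt0 : 0 < C0) (p_ge1 : 1 <= p).
Local Notation mu := (lebesgue_rV R N).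
Local Notation c := (fraclap_const N s).
Variable u : 'rV[R]_N -> R.
Hypotheses (Cu : Ck 2 u) (Lu : Ls_space s u) (Lpu : Lp_psi p beta u).
Local Notation w := (@barrier R N beta).
Local Notation rho0 := (@rho_min R N alpha C0).
Implicit Types (x : 'rV[R]_N) (d L C : R).

Let W x : R := `|u x| `^ p.

Let mW : measurable_fun setT W. Proof. exact: measurable_powu Lu. Qed.
Let W_ge0 x : 0 <= W x. Proof. exact: powR_ge0. Qed.
Let mw : measurable_fun setT w. Proof. exact: measurable_barrier. Qed.
Let w_ge0 x : 0 <= w x. Proof. exact: barrier_ge0. Qed.
Let p_gt0 : 0 < p. Proof. exact: lt_le_trans p_ge1. Qed.

Lemma rho_min_ge0 x : 0 <= rho0 x.
Proof. by rewrite mulr_ge0 ?powR_ge0// ltW. Qed.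

Lemma measurable_rho_min : measurable_fun setT rho0.
Proof. by rewrite /rho_min; mfun. Qed.

Lemma rho_min_le x : rho0 x <= C0.
Proof.
rewrite /rho_min -[leRHS]mulr1 ler_wpM2l ?(ltW C0_gt0)//.
have h : 1 <= 1 + enorm x ^+ 2 by rewrite lerDl sqr_ge0.
have a2 : 0 <= alpha / 2 by rewrite divr_ge0.
by have := powRN_le ltr01 h a2; rewrite powR1.
Qed.

Let Ww_ge0 x : 0 <= W x * w x. Proof. exact: mulr_ge0. Qed.

Let inner_ge0 d x : 0 <= ind (2 * d <= w x) * (rho0 x * (W x * w x)).
Proof. by apply: mulr_ge0; [exact: ind_ge0|apply: mulr_ge0; [exact: rho_min_ge0|]]. Qed.

Let outer_ge0 d x : 0 <= ind (w x < 2 * d) * (W x * w x).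
Proof. by apply: mulr_ge0; [exact: ind_ge0|]. Qed.

Definition inner_mass d : \bar R :=
  (\int[mu]_x (ind (2 * d <= w x)%R * (rho0 x * (W x * w x))%R)%:E)%E.
Definition outer_mass d : \bar R :=
  (\int[mu]_x (ind (w x < 2 * d)%R * (W x * w x)%R)%:E)%E.

Lemma barrier_psi x : w x <= 2 `^ (beta / 2) * psi beta x.
Proof.
have := @max1_rho_min R N beta 1 (ltW beta_gt0) ltr01 x.
by rewrite /rho_min divr1 mul1r /psi.
Qed.

(** The barrier is at most a constant times the weight of the [L^p] space. *)
Lemma int_Ww_fin : (\int[mu]_x (W x * w x)%:E < +oo)%E.
Proof.
have [_ h] := Lpu.
have mpsi : measurable_fun setT (@psi R N beta) by rewrite /psi; mfun.
apply: (@le_lt_trans _ _ (\int[mu]_x (2 `^ (beta / 2) * (W x * psi beta x))%:E)%E).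
  apply: le_int; [by mfun|by mfun|by move=> x; rewrite mulr_ge0|].
  by move=> x; rewrite mulrCA ler_wpM2l// barrier_psi.
rewrite intZ ?powR_ge0//; last 2 first.
- by mfun.
- by move=> x; rewrite mulr_ge0 ?powR_ge0.
rewrite lte_mul_pinfty ?lee_fin ?powR_ge0//.
Qed.

Lemma integrable_Ww : mu.-integrable setT (fun x => (W x * w x)%:E).
Proof.
apply/integrableP; split; first by apply/measurable_EFinP; mfun.
rewrite (_ : (\int[mu]_x _ = \int[mu]_x (W x * w x)%:E)%E) ?int_Ww_fin//.
by apply: eq_integral => x _; rewrite /= ger0_norm// mulr_ge0.
Qed.

Lemma outer_mass_fin d : outer_mass d \is a fin_num.
Proof.
rewrite ge0_fin_numE; last exact: int_ge0.
apply: le_lt_trans int_Ww_fin; apply: le_int; [by mfun|by mfun|by []|].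
by move=> x; rewrite -[leRHS]mul1r ler_wpM2r ?ind_le1// mulr_ge0.
Qed.

Lemma inner_mass_fin d : inner_mass d \is a fin_num.
Proof.
have mr := measurable_rho_min.
have r0 x : 0 <= rho0 x := rho_min_ge0 x.
rewrite ge0_fin_numE; last exact: int_ge0.
apply: (@le_lt_trans _ _ (\int[mu]_x (C0 * (W x * w x))%:E)%E).
  apply: le_int; [by mfun|by mfun|by []|].
  move=> x; apply: (@le_trans _ _ (rho0 x * (W x * w x))).
    by rewrite -[leRHS]mul1r ler_wpM2r ?ind_le1//; exact: mulr_ge0.
  by rewrite ler_wpM2r ?mulr_ge0// rho_min_le.
rewrite intZ ?(ltW C0_gt0)//; last by mfun.
by rewrite lte_mul_pinfty ?lee_fin ?(ltW C0_gt0)// int_Ww_fin.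
Qed.

Lemma int_remainder L C d : 0 <= L -> 0 <= C ->
  (\int[mu]_x (W x * remainder alpha beta C0 L C d x)%:E =
   L%:E * inner_mass d + C%:E * outer_mass d)%E.
Proof.
move=> L0 CC0; have mr := measurable_rho_min.
have r0 x : 0 <= rho0 x := rho_min_ge0 x.
have i0 := inner_ge0 d.
have o0 := outer_ge0 d.
rewrite -!intZ//; [|by mfun|by mfun].
rewrite -intD; [|by mfun|by mfun|by move=> x; rewrite mulr_ge0|by move=> x;
  rewrite mulr_ge0].
by apply: eq_integral => x _; rewrite /remainder; congr EFin; ring.
Qed.

Variables (rho cc : 'rV[R]_N -> R) (c0 : R).
Hypotheses (c0_gt0 : 0 < c0) (rho_ge : forall x, rho0 x <= rho x) (cc_ge : forall x,
  c0 <= cc x).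
Hypothesis eq_u : forall x, laplacian u x - fraclap s u x - rho x * cc x * u x = 0.

Section fixed_cutoff.
Variables (L C d : R).
Hypotheses (L_ge0 : 0 <= L) (C_ge0 : 0 <= C) (d_gt0 : 0 < d).
Hypothesis Pop_cut : forall h x, 0 < h -> h <= 2^-1 ->
  (Pop s c h (cutoff beta d) x <=
   (Pmass N s c h * cutoff beta d x + remainder alpha beta C0 L C d x)%:E)%E.

Local Notation phi := (@cutoff R N beta d).

Let phi_ge0 x : 0 <= phi x. Proof. exact: cutoff_ge0. Qed.
Let mphi : measurable_fun setT phi. Proof. exact: measurable_cutoff. Qed.

Let rd : R := d `^ (- beta^-1).

(** The support of the cutoff is bounded, uniformly in the step; this is what
    gives the bounds needed for dominated convergence. *)
Lemma cutoff_supp x : rd < enorm x -> phi x = 0.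
Proof.
move=> xr; apply: cutoff_out => //.
have rd0 : 0 < rd by exact: powR_gt0.
have rdb : rd `^ (- beta) = d.
  by rewrite -powRrM mulrNN mulVf ?gt_eqF// powRr1// ltW.
rewrite -[leRHS]rdb powRN_le ?(ltW beta_gt0)//.
by rewrite le_max (ltW xr) orbT.
Qed.

Lemma cutoff_bounded_mul (f : 'rV[R]_N -> R) B : 0 <= B ->
  (forall x, enorm x <= rd -> `|f x| <= B) ->
  forall x, `|phi x * f x| <= B * ind (enorm x <= rd).
Proof.
move=> B0 hf x; have [xr|xr] := leP (enorm x) rd; last first.
  by rewrite cutoff_supp// mul0r normr0 ind0 mulr0.
rewrite ind1 mulr1 normrM ger0_norm// -[leRHS]mul1r ler_pM// ?hf//.
exact: (le_trans (cutoff_le _ _ _) (barrier_le1 _ (ltW beta_gt0))).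
Qed.

Lemma integrable_ball B : mu.-integrable setT (fun x => (B * ind (enorm x <= rd))%:E).
Proof.
have i1 : mu.-integrable setT (fun x => (ind (enorm x <= rd))%:E).
  apply/integrableP; split; first by apply/measurable_EFinP; mfun.
  rewrite (_ : (\int[mu]_x _ = \int[mu]_x (ind (enorm x <= rd)%R)%:E)%E)
    ?int_ball_fin//.
  by apply: eq_integral => x _; rewrite /= ger0_norm// ind_ge0.
by have := integrableZl measurableT B i1.
Qed.

Lemma integrable_cutoff_mul (f : 'rV[R]_N -> R) B : measurable_fun setT f -> 0 <= B ->
  (forall x, enorm x <= rd -> `|f x| <= B) ->
  mu.-integrable setT (fun x => (phi x * f x)%:E).
Proof.
move=> mf B0 hf; apply: le_integrable (integrable_ball B) => //.
  by apply/measurable_EFinP; exact: measurable_funM.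
move=> x _ /=; rewrite lee_fin [leRHS]ger0_norm ?mulr_ge0 ?ind_ge0//.
exact: cutoff_bounded_mul.
Qed.

Let g x := powgrad p (u x).
Let S n x := Sop s u n x.

Let mu_ : measurable_fun setT u. Proof. by case: Lu. Qed.
Let mg : measurable_fun setT g. Proof. exact:
  (measurableT_comp (measurable_powgrad p) mu_). Qed.
Let mS n : measurable_fun setT (S n). Proof. exact: measurable_Sop. Qed.

Let gS_bound : exists2 B, 0 <= B & forall n x, enorm x <= rd -> `|g x * S n x| <= B.
Proof.
have rd0 : 0 <= rd by exact: powR_ge0.
have [B1 B10 h1] := continuous_ball_bounded rd Cu.1.
have [B2 B20 h2] := Sop_bound s_gt0 s_lt1 Cu Lu rd0.
exists (p * B1 `^ (p - 1) * B2) => [|n x xr].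
  by rewrite !mulr_ge0 ?powR_ge0// ltW.
rewrite normrM ler_pM// ?h2//.
by apply: powgrad_bound => //; exact: h1.
Qed.

Let W_bound : exists2 B, 0 <= B & forall x, enorm x <= rd -> `|W x| <= B.
Proof.
have [B1 B10 h1] := continuous_ball_bounded rd Cu.1.
exists (B1 `^ p) => [|x xr]; first exact: powR_ge0.
rewrite ger0_norm// ge0_ler_powR ?nnegrE ?(ltW p_gt0)//; exact: h1.
Qed.

(** Kato's inequality tested with the cutoff, the symmetry of [Pop], and the
    supersolution inequality for the cutoff.  The terms with [Pmass], which
    diverges as the step tends to [0], are finite and cancel. *)
Lemma step_inequality n :
  (\int[mu]_x (phi x * (g x * S n x)%R)%:E <= L%:E * inner_mass d + C%:E *
    outer_mass d)%E.
Proof.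
have [B B0 hB] := gS_bound; have [BW BW0 hBW] := W_bound.
have h0 := @step_gt0 R n; have h2 := @step_le R n.
have cge0 : 0 <= c := fraclap_const_ge0 N s_gt0.
set M := Pmass N s c (step R n).
have igS : mu.-integrable setT (fun x => (phi x * (g x * S n x))%:E).
  apply: (@integrable_cutoff_mul (fun x => g x * S n x) B) => //; last exact: hB.
  exact: measurable_funM.
have iW : mu.-integrable setT (fun x => (phi x * W x)%:E).
  exact: (@integrable_cutoff_mul _ BW).
have iMW := integrableZl measurableT M iW.
have mPW := measurable_Pop s c (step R n) mW W_ge0.
have mPp := measurable_Pop s c (step R n) mphi phi_ge0.
have PW0 x : (0 <= Pop s c (step R n) W x)%E := Pop_ge0 s cge0 (step R n) x W_ge0.
have key : (\int[mu]_x ((phi x)%:E * Pop s c (step R n) W x) <=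
    M%:E * \int[mu]_x (phi x * W x)%:E + (L%:E * inner_mass d + C%:E * outer_mass d))%E.
  rewrite -(int_Pop_sym s cge0 (step R n) mW W_ge0 mphi phi_ge0) -int_remainder//.
  have M0 : 0 <= M.
    apply: addr_ge0; apply: mulr_ge0; rewrite ?kmass_ge0 ?invr_ge0 ?sqr_ge0//.
  have mrem : measurable_fun setT (remainder alpha beta C0 L C d : 'rV[R]_N -> R).
    by rewrite /remainder; have mr := measurable_rho_min; mfun.
  have rem0 x : 0 <= remainder alpha beta C0 L C d x.
    have := rho_min_ge0 x => r0.
    by apply: addr_ge0; apply: mulr_ge0; rewrite ?ind_ge0//; apply: mulr_ge0 => //;
      apply: mulr_ge0.
  rewrite -intZ//; [|by mfun|by move=> x; rewrite mulr_ge0].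
  rewrite -intD; [|by mfun|by mfun|by move=> x; rewrite !mulr_ge0|by move=> x;
    rewrite mulr_ge0].
  apply: ge0_le_integral => //.
  - by move=> x _; rewrite mule_ge0 ?lee_fin// Pop_ge0.
  - by apply: emeasurable_funM => //; exact/measurable_EFinP.
  - by apply/measurable_EFinP; mfun.
  move=> x _; apply: (@le_trans _ _
    ((W x)%:E * (M * phi x + remainder alpha beta C0 L C d x)%:E)%E).
    by rewrite lee_wpmul2l ?lee_fin// Pop_cut.
  by rewrite -EFinM lee_fin le_eqVlt; apply/orP; left; apply/eqP; ring.
have Wfin : (\int[mu]_x (phi x * W x)%:E)%E \is a fin_num by exact: integrable_fin_num.
have ifin := inner_mass_fin d; have ofin := outer_mass_fin d.
have Rfin : (L%:E * inner_mass d + C%:E * outer_mass d)%E \is a fin_num.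
  by rewrite fin_numD !fin_numM.
have iP : mu.-integrable setT (fun x => (phi x)%:E * Pop s c (step R n) W x)%E.
  apply/integrableP; split.
    by apply: emeasurable_funM => //; exact/measurable_EFinP.
  rewrite (_ : (\int[mu]_x _ = \int[mu]_x ((phi x)%:E * Pop s c (step R n) W x))%E);
    last first.
    by apply: eq_integral => x _; rewrite gee0_abs// mule_ge0// lee_fin.
  apply: (le_lt_trans key); rewrite ltey_eq; apply/orP; left.
  by rewrite fin_numD Rfin fin_numM.
have : (\int[mu]_x ((phi x * (g x * S n x))%:E + M%:E * (phi x * W x)%:E) <=
    \int[mu]_x ((phi x)%:E * Pop s c (step R n) W x))%E.
  apply: le_integral => //; first exact: integrableD.
  move=> x _; rewrite -EFinM -EFinD.
  apply: (@le_trans _ _ ((phi x)%:E * (g x * S n x + M * W x)%:E)%E).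
    by rewrite -EFinM lee_fin le_eqVlt; apply/orP; left; apply/eqP; ring.
  rewrite lee_wpmul2l ?lee_fin//.
  exact: (Pop_kato s_gt0 cge0 p_ge1 Lu x h0).
rewrite integralD// integralZl// => /le_trans /(_ key).
by rewrite addeC leeD2lE// fin_numM.
Qed.

(** On the support of the cutoff, the discretized operator applied to [u] converges
    boundedly to [rho cc u], and [powgrad p (u x) * u x] is [p |u x|^p]. *)
Lemma cutoff_inequality :
  ((p * c0)%:E * inner_mass d <= L%:E * inner_mass d + C%:E * outer_mass d)%E.
Proof.
have [B B0 hB] := gS_bound.
have cvgS x : phi x * (g x * S n x) @[n --> \oo] --> phi x * (p * (rho x * cc x) * W x).
  apply: cvgM; first exact: cvg_cst.
  have -> : p * (rho x * cc x) * W x = g x * (laplacian u x - fraclap s u x).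
    have -> : laplacian u x - fraclap s u x = rho x * cc x * u x by apply/eqP;
      rewrite -subr_eq0 eq_u.
    rewrite [RHS](_ : _ = rho x * cc x * (powgrad p (u x) * u x)); last by rewrite /g;
      ring.
    by rewrite powgradM// -/(W x); ring.
  by apply: cvgM; [exact: cvg_cst|exact: Sop_cvg].
have mfn n : measurable_fun setT (fun x => phi x * (g x * S n x)).
  by apply: measurable_funM => //; exact: measurable_funM.
have mfl : measurable_fun setT (fun x => phi x * (p * (rho x * cc x) * W x)).
  by apply: (measurable_fun_cvg mfn) => x _; exact: cvgS.
have [||||_ _ cv] := @dominated_convergence _ _ R mu setT measurableT
  (fun n x => (phi x * (g x * S n x))%:E)
    (fun x => (phi x * (p * (rho x * cc x) * W x))%:E)
  (fun x => (B * ind (enorm x <= rd))%:E) (fun n => (measurable_EFinP _ _).2 (mfn n)).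
- exact/measurable_EFinP.
- by apply: aeW => x _; apply: cvg_EFin; [exact: nearW|exact: cvgS].
- exact: integrable_ball.
- apply: aeW => x n _; rewrite lee_fin.
  exact: (@cutoff_bounded_mul (fun y => g y * S n y) B B0 (hB n)).
have lim_le : (\int[mu]_x (phi x * (p * (rho x * cc x) * W x)%R)%:E <= L%:E *
  inner_mass d + C%:E * outer_mass d)%E.
  apply: cvge_le cv; apply: nearW => n; exact: step_inequality.
apply: le_trans lim_le.
have mr := measurable_rho_min; have r0 x : 0 <= rho0 x := rho_min_ge0 x.
have pc0 : 0 <= p * c0 by rewrite mulr_ge0// ltW.
rewrite -intZ//; last by mfun.
apply: le_int => //; first by mfun.
  by move=> x; apply: mulr_ge0.
move=> x; have [wd|wd] := leP (2 * d) (w x); last first.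
  rewrite ind0 mul0r mulr0 !mulr_ge0//; first exact: ltW.
    exact: le_trans (rho_ge x).
  by apply: le_trans (cc_ge x); exact: ltW.
rewrite ind1 mul1r (cutoff_in d_gt0 wd).
rewrite (_ : p * c0 * _ = w x * (p * (rho0 x * c0) * W x)); last by ring.
rewrite ler_wpM2l// ler_wpM2r// ler_wpM2l ?(ltW p_gt0)//.
by apply: ler_pM => //; exact: ltW.
Qed.

End fixed_cutoff.

(** The sets [w < 2d] decrease to the empty set since [w > 0]. *)
Lemma outer_mass_cvg : outer_mass (n.+1%:R^-1) @[n --> \oo] --> 0%E.
Proof.
have mo n : measurable_fun setT (fun x => ind (w x < 2 * n.+1%:R^-1) * (W x * w x)) by
  mfun.
have Ww0 x : 0 <= W x * w x by rewrite mulr_ge0.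
have [||||_ _ cv] := @dominated_convergence _ _ R mu setT measurableT
  (fun n x => (ind (w x < 2 * n.+1%:R^-1) * (W x * w x))%:E) (cst 0%E)
  (fun x => (W x * w x)%:E) (fun n => (measurable_EFinP _ _).2 (mo n)).
- exact: measurable_cst.
- apply: aeW => x _; apply: cvg_near_cst.
  have w0 : 0 < w x / 2 by rewrite divr_gt0// barrier_gt0.
  have := near_infty_natSinv_lt (PosNum w0); apply: filterS => n /= nw.
  rewrite ltNge (_ : 2 * n.+1%:R^-1 <= w x) ?ind0 ?mul0r//.
  by rewrite -ler_pdivlMl// mulrC ltW.
- exact: integrable_Ww.
- apply: aeW => x n _; rewrite lee_fin ger0_norm ?mulr_ge0 ?ind_ge0//.
  by rewrite -[leRHS]mul1r ler_wpM2r ?ind_le1.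
by rewrite integral0 in cv.
Qed.

End energy.

(** * Vanishing of the solution *)

Section lower_bound.
Context (R : realType) (N : nat) (s alpha beta C0 p : R).
Hypotheses (alpha_ge0 : 0 <= alpha) (beta_gt0 : 0 < beta) (C0_gt0 : 0 < C0)
  (p_ge1 : 1 <= p).
Local Notation mu := (lebesgue_rV R N).
Variable u : 'rV[R]_N -> R.
Hypotheses (Cu : Ck 2 u) (Lu : Ls_space s u).

(** By continuity, [|u| >= |u x0| / 2] on a small cube around [x0], on which the
    two other factors are also bounded below; for small [d], the cube is
    contained in the set [w >= 2d]. *)
Lemma inner_mass_lower x0 : u x0 != 0 -> exists kd : R * R, [/\ 0 < kd.1, 0 < kd.2 &
  forall d, d <= kd.2 -> (kd.1%:E <= inner_mass alpha beta C0 p u d)%E].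
Proof.
move=> u0; have a0 : 0 < `|u x0| / 2 by rewrite divr_gt0// normr_gt0.
have /cvgrPdist_lt /(_ _ a0) /nbhs_ballP[e /= e0 he] := Cu.1 x0.
(* A cube, whose volume is given directly by the product formula. *)
pose I i := `[x0 ord0 i - e / 2, x0 ord0 i + e / 2]%classic : set (measurableTypeR R).
pose A := [set x : 'rV[R]_N | forall i, I i (x ord0 i)].
have mA : measurable A.
  rewrite (_ : A = \bigcap_(i : 'I_N) ((fun x : 'rV[R]_N => x ord0 i) @^-1` I i)).
    apply: fin_bigcap_measurable => // i _; rewrite -[X in measurable X]setTI.
    by apply: measurable_rV_coord => //; exact: measurable_itv.
  by apply/seteqP; split => [x h i _|x h i]; exact: h.
have muA : mu A = (e ^+ N)%:E.
  have E : mu A = (\prod_(i < N) lebesgue_measure (I i))%E.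
    by apply: (@lebesgue_rV_box R N I) => i; exact: measurable_itv.
  apply: (etrans E); rewrite (eq_bigr (fun=> e%:E)) => [|i _].
    by rewrite prodEFin prodr_const card_ord.
  rewrite lebesgue_measure_itv/= lte_fin ifT; first by rewrite -EFinB; congr EFin;
    field.
  by rewrite ltrD2l gtrN ?divr_gt0.
have dist x i : A x -> `|x0 ord0 i - x ord0 i| <= e / 2.
  move=> /(_ i); rewrite /I /= in_itv/= => /andP[h1 h2].
  by rewrite ler_norml; apply/andP; split; lra.
have uA x : A x -> `|u x0| / 2 <= `|u x|.
  move=> Ax; have : ball x0 e x.
    split => // i j; rewrite (ord1 i) /ball/=.
    by apply: (le_lt_trans (dist _ j Ax)); rewrite ltr_pdivrMr// ltr_pMr// ltr1n.
  move=> /he; have := lerB_dist (u x0) (u x); lra.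
(* [K] bounds the squared norm on the cube. *)
pose K := \sum_(i < N) (`|x0 ord0 i| + e / 2) ^+ 2.
have K0 : 0 <= K by apply: sumr_ge0 => i _; exact: sqr_ge0.
have nA x : A x -> enorm x ^+ 2 <= K.
  move=> Ax; rewrite enorm_sqr; apply: ler_sum => i _.
  rewrite -expr2 -real_normK ?num_real//
    lerXn2r ?nnegrE ?addr_ge0 ?divr_ge0 ?(ltW e0)//.
  have := dist _ i Ax; have := lerB_dist (x ord0 i) (x0 ord0 i);
    rewrite (distrC (x ord0 i)).
  lra.
pose k1 := C0 * (1 + K) `^ (- (alpha / 2)); pose k2 := (1 + K) `^ (- (beta / 2)).
have K1 : 0 < 1 + K by rewrite ltr_wpDr.
have k10 : 0 < k1 by rewrite mulr_gt0 ?powR_gt0.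
have k20 : 0 < k2 by rewrite powR_gt0.
have rA x : A x -> k1 <= rho_min alpha C0 x.
  move=> Ax; rewrite /k1 /rho_min ler_wpM2l ?(ltW C0_gt0)// powRN_le ?divr_ge0//.
  - by rewrite ltr_wpDr ?sqr_ge0.
  - by rewrite lerD2l nA.
have wA x : A x -> k2 <= barrier beta x.
  move=> Ax; rewrite barrierE /k2 powRN_le ?divr_ge0 ?(ltW beta_gt0)//.
  - by rewrite exprn_gt0// max1_gt0.
  have := nA x Ax => h; have [x1|x1] := leP (enorm x) 1; first by rewrite expr1n lerDl.
  by apply: (le_trans h); rewrite lerDr.
pose k3 := (`|u x0| / 2) `^ p.
have k30 : 0 < k3 by rewrite powR_gt0.
exists (k1 * (k3 * k2) * e ^+ N, k2 / 2); split => /=.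
- by apply: mulr_gt0 (exprn_gt0 _ e0); apply: mulr_gt0 k10 (mulr_gt0 k30 k20).
- by rewrite divr_gt0.
move=> d d2.
have mw := @measurable_barrier R N beta; have mr := @measurable_rho_min R N alpha C0.
have mW := measurable_powu p Lu.
apply: (@le_trans _ _ (\int[mu]_x (k1 * (k3 * k2) * \1_A x)%:E)%E).
  rewrite intZ//.
  - by rewrite integral_indic// setIT EFinM le_eqVlt; apply/orP; left; apply/eqP;
      congr (_ * _)%E; exact: (esym muA).
  - by apply: mulr_ge0 (ltW k10) (mulr_ge0 (ltW k30) (ltW k20)).
apply: le_int.
- by apply: measurable_funM => //; exact: measurable_indic.
- apply: measurable_funM; first by mfun.
  by apply: measurable_funM => //; exact: measurable_funM.
- by move=> x; apply: mulr_ge0 => //;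
    apply: mulr_ge0 (ltW k10) (mulr_ge0 (ltW k30) (ltW k20)).
move=> x; rewrite indicE; case: (boolP (x \in A)) => [/set_mem Ax|_]; last first.
  rewrite mulr0 mulr_ge0 ?ind_ge0// mulr_ge0 ?rho_min_ge0// mulr_ge0 ?powR_ge0//.
have wx := wA x Ax.
rewrite (_ : 2 * d <= barrier beta x); last first.
  by apply: le_trans wx; rewrite mulrC -ler_pdivlMr.
rewrite ind1 mul1r mulr1; apply: (ler_pM (ltW k10) _ (rA x Ax)).
  exact: mulr_ge0 (ltW k30) (ltW k20).
apply: (ler_pM (ltW k30) (ltW k20) _ wx).
rewrite /k3 ge0_ler_powR ?nnegrE ?(ltW a0)//; last exact: uA.
exact: le_trans p_ge1.
Qed.

End lower_bound.

Theorem theorem2p6 (R : realType) (N : nat) (s alpha C0 beta : R)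
    (N_ge1 : (1 <= N)%N) (s_gt0 : 0 < s) (s_lt1 : s < 1)
    (alpha_ge0 : 0 <= alpha) (C0_gt0 : 0 < C0) (beta_gt0 : 0 < beta)
    (conditions :
      [\/ 0 < beta <= N%:R - 2 * s /\ alpha <= 2,
          N%:R - 2 * s < beta < N%:R /\ alpha <= 2 * s,
          beta = N%:R /\ alpha < 2 * s
        | N%:R < beta /\ alpha + beta <= 2 * s + N%:R]) :
  exists Lambda : R, 0 < Lambda /\
    forall (rho c : 'rV[R]_N -> R) (c0 p : R) (u : 'rV[R]_N -> R),
      continuous rho ->
      (forall x, C0 * (1 + enorm x ^+ 2) `^ (- (alpha / 2)) <= rho x) ->
      continuous c ->
      0 < c0 ->
      (forall x, c0 <= c x) ->
      1 <= p ->
      Lambda < p * c0 ->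
      Ck 2 u ->
      Ls_space s u ->
      (forall x, laplacian u x - fraclap s u x - rho x * c x * u x = 0) ->
      Ls_space s (fun x => `|u x| `^ p) ->
      Lp_psi p beta u ->
      forall x, u x = 0.
Proof.
have cge0 := fraclap_const_ge0 N s_gt0.
have [L [C [L0 CC0 hP]]] :=
  Pop_cutoff N_ge1 s_gt0 s_lt1 alpha_ge0 beta_gt0 C0_gt0 cge0 conditions.
exists L; split => // rho c c0 p u _ rho_ge _ c0_gt0 c_ge p1 Lpc Cu Lu equ _ Lpu x.
apply/eqP/negPn/negP => ux.
have [[k d0] /= [k0 d00 hk]] := inner_mass_lower alpha_ge0 beta_gt0 C0_gt0 p1 Cu Lu ux.
have ifin d := inner_mass_fin alpha_ge0 beta_gt0 C0_gt0 Lu Lpu d.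
have ofin d := outer_mass_fin beta_gt0 Lu Lpu d.
have lower (d : R) : 0 < d -> d <= 1 -> d <= d0 ->
    (p * c0 - L) * k <= C * fine (outer_mass beta p u d).
  move=> d1 d2 d3.
  have Pop_cut h (y : 'rV[R]_N) : 0 < h -> h <= 2^-1 ->
    (Pop s (fraclap_const N s) h (cutoff beta d) y <=
      (Pmass N s (fraclap_const N s) h * cutoff beta d y +
        remainder alpha beta C0 L C d y)%:E)%E.
    by move=> h0 h2; exact: hP.
  have := cutoff_inequality s_gt0 s_lt1 alpha_ge0 beta_gt0 C0_gt0 p1 Cu Lu Lpu
    c0_gt0 rho_ge c_ge equ (ltW L0) CC0 d1 Pop_cut.
  have := hk _ d3; rewrite -(fineK (ifin d)) -(fineK (ofin d)) -!EFinM -EFinD !lee_fin.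
  move=> h1; rewrite -lerBlDl -mulrBl; apply: le_trans.
  by rewrite ler_wpM2l// subr_ge0 ltW.
have cv : C * fine (outer_mass beta p u n.+1%:R^-1) @[n --> \oo] --> C * 0.
  by apply: cvgM; [exact: cvg_cst|exact: fine_cvg (outer_mass_cvg beta_gt0 Lu Lpu)].
have : (p * c0 - L) * k <= C * 0.
  apply: (cvgr_to_ge cv); have := near_infty_natSinv_lt (PosNum d00).
  apply: filterS => n /= nd; apply: lower (ltW nd) => //.
  by rewrite invf_le1// ler1n.
by rewrite mulr0 leNgt mulr_gt0// subr_gt0.
Qed.
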